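(* Let $\boldsymbol a$ and $\boldsymbol b$ be measure preserving actions of a countably infinite group $\Gamma$. Assume that $\boldsymbol a$ is free and $\boldsymbol a\prec\boldsymbol b$. (1) If $C(\boldsymbol b)<\infty$ then $C(\boldsymbol b)\le C(\boldsymbol a)$. (2) If $E_b$ is treeable then $C(\boldsymbol b)\le C(\boldsymbol a)$. (3) If $C(\boldsymbol a)=1$ then $C(\boldsymbol b)=1$.
   Context: A measure preserving (m.p.) action $\boldsymbol a=\Gamma\curvearrowright^a(X,\mu)$ is a Borel action of the countable discrete group $\Gamma$ on a standard probability space preserving $\mu$; $E_a$ denotes its orbit equivalence relation. It is free if $\mu(\{x:\gamma^a x=x\})=0$ for every $\gamma\in\Gamma\setminus\{e\}$. For $\boldsymbol b=\Gamma\curvearrowright^b(Y,\nu)$, $\boldsymbol a\prec\boldsymbol b$ ($\boldsymbol a$ is weakly contained in $\boldsymbol b$) means: for all Borel $A_1,\dots,A_n\subseteq X$, finite $F\subseteq\Gamma$ and $\epsilon>0$ there are Borel $B_1,\dots,B_n\subseteq Y$ with $|\mu(\gamma^aA_i\cap A_j)-\nu(\gamma^bB_i\cap B_j)|<\epsilon$ for all $\gamma\in F$, $i,j\le n$. Cost. An L-graphing on $(X,\mu)$ is a countable family $\Phi=\{\varphi_i:A_i\to B_i\}$ of $\mu$-preserving Borel bijections between Borel subsets of $X$; its cost is $C_\mu(\Phi)=\sum_i\mu(A_i)$. It is an L-graphing of a $\mu$-preserving countable Borel equivalence relation $E$ if the equivalence relation generated by $\Phi$ agrees with $E$ on a conull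 set. The cost of $E$ is $C_\mu(E)=\inf\{C_\mu(\Phi):\Phi\text{ an L-graphing of }E\}\in[0,\infty]$, and $C(\boldsymbol a)=C_\mu(E_a)$. A countable Borel equivalence relation $E$ on $X$ is treeable if there is an acyclic Borel graph on $X$ whose connected components are the $E$-classes. *)

(* Defs.v *)
From Stdlib Require Export Relation_Operators.
From HB Require Import structures.
From mathcomp Require Export all_boot all_order all_algebra.
From mathcomp Require Export all_classical all_reals all_analysis.

Set Implicit Arguments.
Unset Strict Implicit.
Unset Printing Implicit Defensive.

Import Order.TTheory GRing.Theory Num.Theory.

Local Open Scope classical_set_scope.
Local Open Scope ring_scope.

(* A Polish space is presented as a complete separable metric space; [X] is
   standard Borel when it is Borel isomorphic to one. *)
Definition standard_borel (R : realType) (d : measure_display)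
    (X : measurableType d) : Prop :=
  exists (P : metricType R) (f : X -> P),
    [/\ forall F : set_system P, ProperFilter F -> cauchy F ->
          exists l : P, F --> l,
        exists2 D : set P, countable D & dense D,
        bijective f &
        forall A : set X, measurable A <-> <<s [set U : set P | open U] >> (f @` A)].

(* [G] is discrete and countable, so the action is Borel as soon as each group
   element acts by a measurable map. *)
Record mp_action (R : realType) (G : groupType) (d : measure_display)
    (X : measurableType d) (mu : probability X R) := MpAction {
  act :> G -> X -> X;
  act_one : forall x, act 1%g x = x;
  act_mul : forall g h x, act (g * h)%g x = act g (act h x);
  act_measurable : forall g, measurable_fun setT (act g);
  act_preserving : forall g (A : set X), measurable A ->
    mu (act g @^-1` A) = mu A
}.

Section Actions.
Context (R : realType) (G : groupType).

Definition orbit_rel (d : measure_display) (X : measurableType d)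
    (mu : probability X R) (a : mp_action G mu) : X -> X -> Prop :=
  fun x y => exists g : G, a g x = y.

Definition free_action (d : measure_display) (X : measurableType d)
    (mu : probability X R) (a : mp_action G mu) : Prop :=
  forall g : G, g != 1%g -> mu [set x | a g x = x] = 0%E.

Definition weakly_contained (d d' : measure_display)
    (X : measurableType d) (Y : measurableType d')
    (mu : probability X R) (nu : probability Y R)
    (a : mp_action G mu) (b : mp_action G nu) : Prop :=
  forall (n : nat) (A : 'I_n -> set X) (F : set G) (eps : R),
    (forall i, measurable (A i)) -> finite_set F -> 0 < eps ->
    exists2 B : 'I_n -> set Y, forall i, measurable (B i) &
      forall g i j, F g ->
        (`| mu ((a g @` A i) `&` A j) - nu ((b g @` B i) `&` B j) | < eps%:E)%E.

End Actions.

Section Cost.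
Context (R : realType) (d : measure_display) (X : measurableType d).
Variable mu : probability X R.

(* A measure preserving Borel bijection [pdom -> pcod]; [pmap] is total only for
   convenience and its values outside [pdom] are irrelevant. *)
Record partial_iso := PartialIso {
  pdom : set X;
  pcod : set X;
  pmap : X -> X;
  pdom_measurable : measurable pdom;
  pcod_measurable : measurable pcod;
  pmap_bij : set_bij pdom pcod pmap;
  pmap_measurable : measurable_fun pdom pmap;
  pmap_preserving : forall B : set X, measurable B -> B `<=` pcod ->
    mu (pdom `&` pmap @^-1` B) = mu B
}.

(* Countable families are indexed by [nat]; a finite family is padded with
   isomorphisms with empty domain, which generate nothing and cost nothing. *)
Definition lgraphing_rel (Phi : nat -> partial_iso) : X -> X -> Prop :=
  clos_refl_sym_trans X
    (fun x y => exists i, pdom (Phi i) x /\ pmap (Phi i) x = y).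

Definition lgraphing_cost (Phi : nat -> partial_iso) : \bar R :=
  (\sum_(0 <= i <oo) mu (pdom (Phi i)))%E.

Definition lgraphing_of (E : X -> X -> Prop) (Phi : nat -> partial_iso) : Prop :=
  exists X0 : set X, [/\ measurable X0, mu (~` X0) = 0%E &
    forall x y, X0 x -> X0 y -> (lgraphing_rel Phi x y <-> E x y)].

Definition rel_cost (E : X -> X -> Prop) : \bar R :=
  ereal_inf [set lgraphing_cost Phi | Phi in lgraphing_of E].

End Cost.

Definition action_cost (R : realType) (G : groupType) (d : measure_display)
    (X : measurableType d) (mu : probability X R) (a : mp_action G mu) : \bar R :=
  rel_cost mu (orbit_rel a).

Section Treeable.
Context (d : measure_display) (X : measurableType d).

Definition borel_graph (E : X -> X -> Prop) : Prop :=
  [/\ forall x, ~ E x x, forall x y, E x y -> E y x &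
      measurable [set p : X * X | E p.1 p.2]].

(* [ordS] is the cyclic successor, so [p] below is a simple cycle of length
   [n.+3] in the graph. *)
Definition acyclic_graph (E : X -> X -> Prop) : Prop :=
  forall (n : nat) (p : 'I_n.+3 -> X),
    injective p -> ~ (forall i, E (p i) (p (ordS i))).

Definition treeable (E : X -> X -> Prop) : Prop :=
  exists T : X -> X -> Prop,
    [/\ borel_graph T, acyclic_graph T &
        forall x y, clos_refl_sym_trans X T x y <-> E x y].

End Treeable.

(* Main.v *)
Require Import Defs.
From mathcomp Require Import measurable_realfun ring lra.

(** The generating sets of [E_a] are written as families of restrictions of
    group elements.  A family generating [E_a] at cost less than [r] has a finite
    part which, through finitely many words, joins [x] to [f x] for all [f] in a
    given finite set, off a small set; since [a] is free, this is a statement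
    about the measures of finitely many Boolean combinations of translates, so
    weak containment transfers it to a family [S] for [b] of cost less than [r].

    (1) Add to [S] the part of a finite cost graphing of [E_b] that [S] does not
    generate; it has small cost.

    (3) Take families [S_n] of cost less than [1 + eps_n] that generate more and
    more of [E_b], and small sets [A_n] meeting the classes of [S_n] and of
    [S_(n+1)].  Contracting [S_(n+1)] onto [A_n] along a forest saves the
    cost [1 - nu A_n] of the forest, and [S_0] together with all the contracted
    families generates [E_b].  The same contraction gives [C(b) >= 1].

    (2) By (1) it suffices to bound the cost of a finite part [T] of a treeing
    by that of a family [S] generating [T] inside the treeing.  Replacing edges
    of [T] by paths of [S], and edges of [S] by their crossings of [T], gives
    operators [A] and [B] with [B A = 1], so that [A B] is an idempotent of
    trace [cost T] acting on the edges of [S]; its trace is at most [cost S]. *)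

Set Implicit Arguments.
Unset Strict Implicit.
Unset Printing Implicit Defensive.

Import Order.TTheory GRing.Theory Num.Theory.

Local Open Scope classical_set_scope.
Local Open Scope ring_scope.

(** * Measurable sets and probability *)

Section MeasurableSets.
Context d (X : measurableType d).

(** Weak containment compares only the measures of sets [A i (a g x) /\ A j x]. That [x] is
    connected to [f x] is not yet a statement of this kind, because it asks where a word sends [x].
    That some valid word has product exactly [f] is one, and under a free action the two agree
    almost everywhere. Validity is a conjunction of memberships, so approximation errors can only
    make the transferred family fall slightly short of what is wanted. The three parts differ in how
    this shortfall is repaired: by a tail of small total cost, by infinitely many approximations
    glued along small complete sections, or, for a treeing, by a bound on its finite parts that is
    uniform in their size. In the last case the natural trace inequality uses an orthogonal
    projection in a von Neumann algebra. Bounded kernels of finite propagation and near-minimizers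
    replace it, so that every operator product is a finite sum. *)

Lemma measurable_exists (I : countType) (F : I -> set X) :
  (forall i, measurable (F i)) -> measurable [set x | exists i, F i x].
Proof.
move=> mF; rewrite (_ : mkset _ =
    \bigcup_n (if unpickle n is Some i then F i else set0)).
  by apply: bigcupT_measurable => n; case: (unpickle n) => // i.
apply/seteqP; split=> [x [i Fix]|x [n _]].
  by exists (pickle i) => //; rewrite pickleK.
by case: (unpickle n) => // i; exists i.
Qed.

Lemma measurable_not (F : set X) :
  measurable F -> measurable [set x | ~ F x].
Proof. exact: measurableC. Qed.

Lemma measurable_forall (I : countType) (F : I -> set X) :
  (forall i, measurable (F i)) -> measurable [set x | forall i, F i x].
Proof.
move=> mF; rewrite (_ : mkset _ = ~` [set x | exists i, (~` F i) x]).
  by apply/measurableC/measurable_exists => i; exact: measurableC.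
apply/seteqP; split=> [x Fx [i]|x Fx i]; first by apply; exact: Fx.
by apply: contrapT => Fix; apply: Fx; exists i.
Qed.

Lemma measurable_conj (F H : set X) :
  measurable F -> measurable H -> measurable [set x | F x /\ H x].
Proof. exact: measurableI. Qed.

Lemma measurable_disj (F H : set X) :
  measurable F -> measurable H -> measurable [set x | F x \/ H x].
Proof. exact: measurableU. Qed.

Lemma measurable_imply (F H : set X) :
  measurable F -> measurable H -> measurable [set x | F x -> H x].
Proof.
move=> mF mH; rewrite (_ : mkset _ = ~` F `|` H).
  by apply: measurableU => //; exact: measurableC.
apply/seteqP; split=> [x FH|x [nF|Hx] //].
by have [Fx|] := pselect (F x); [right; exact: FH | left].
Qed.

Lemma measurable_iff (F H : set X) :
  measurable F -> measurable H -> measurable [set x | F x <-> H x].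
Proof.
by move=> mF mH; apply: measurable_conj; exact: measurable_imply.
Qed.

Lemma measurable_prop (P : Prop) : measurable [set _ : X | P].
Proof.
have [p|np] := pselect P.
  by rewrite (_ : mkset _ = setT) //; apply/seteqP; split.
by rewrite (_ : mkset _ = set0) //; apply/seteqP; split.
Qed.

(** The consequence of standardness that the proof works with: it makes coincidence sets of
    measurable maps measurable, tells a point from its translates, and orients the edges of a
    treeing. *)
Definition separating (U : nat -> set X) :=
  (forall n, measurable (U n)) /\
  forall x y, (forall n, U n x <-> U n y) -> x = y.

Lemma standard_borel_separating (R : realType) :
  standard_borel R X -> exists U, separating U.
Proof.
move=> [P [f [_ [D cD dD] [f1 fK f1K] mX]]].
have /countable_injP[c cinj] := cD.
(* Centres are addressed through the injection [c], so that pairs of naturals index the family;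
   taking interiors makes each set open by construction. *)
pose V (p : nat * nat) : set P :=
  [set q | exists2 z, D z /\ c z = p.1 &
                      ((ball z (p.2.+1%:R^-1 : R))°) q].
have oV p : open (V p).
  rewrite (_ : V p = \bigcup_(z in [set z | D z /\ c z = p.1])
      (ball z (p.2.+1%:R^-1 : R))°).
    by apply: bigcup_open => z _; exact: open_interior.
  by apply/seteqP; split=> [q [z]|q [z]] ? ?; exists z.
exists (fun n => f @^-1` (if unpickle n is Some p then V p else set0)); split.
  move=> n; apply/mX; rewrite (_ : f @` _ =
    if unpickle n is Some p then V p else set0).
    case: (unpickle n) => [p|]; first by apply: sub_sigma_algebra; exact: oV.
    exact: sigma_algebra0.
  apply/seteqP; split=> [q [x /= ? <-] //|q Vq].
  by exists (f1 q); rewrite /= ?f1K.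
move=> x y xy; apply: (can_inj fK); apply: contrapT => fxy.
have {}xy p : V p (f x) <-> V p (f y) by have := xy (pickle p); rewrite /= pickleK.
have e0 : 0 < mdist (f x) (f y) by rewrite mdist_gt0; case: eqP.
pose e := mdist (f x) (f y) / 2.
have e1 : 0 < e by rewrite divr_gt0.
have [N _ /(_ N (leqnn N)) Ne] := near_infty_natSinv_lt (PosNum e1).
have r0 : 0 < (N.+1%:R^-1 : R) by rewrite invr_gt0.
(* A centre within half the radius of [f x] leaves room for a ball around [f x], so [f x] lies in
   the interior and not merely in the ball. *)
have r1 : 0 < (N.+1%:R^-1 / 2 : R) by rewrite divr_gt0.
have [z [fxz Dz]] : ((ball (f x) (PosNum r1)%:num)° `&` D) !=set0.
  apply: dD; last exact: open_interior.
  by exists (f x); exact: nbhsx_ballx.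
have bxz : ball (f x) (N.+1%:R^-1 / 2) z by apply: interior_subset.
have Vx : V (c z, N) (f x).
  exists z => //=; apply/nbhs_ballP; exists (N.+1%:R^-1 / 2) => //= w xw.
  rewrite [N.+1%:R^-1]splitr; apply: ball_triangle xw.
  exact: ball_sym.
have /xy[z' [Dz' cz'] /interior_subset yz'] := Vx.
have zz' : z' = z by apply: cinj => //; rewrite inE.
move: yz' Ne bxz; rewrite {}zz' /= !ballEmdist /= => yz Ne xz.
have := metric_triangle (f x) z (f y).
have : mdist (f x) (f y) = 2 * e by rewrite /e; lra.
move: yz Ne xz; set r := N.+1%:R^-1; lra.
Qed.

End MeasurableSets.

Section MeasurableEq.
Context d d' (X : measurableType d) (Y : measurableType d') (U : nat -> set Y).
Hypothesis sepU : separating U.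

Lemma measurable_eq (D : set X) (f g : X -> Y) : measurable D ->
  measurable_fun D f -> measurable_fun D g ->
  measurable [set x | D x /\ f x = g x].
Proof.
move=> mD mf mg; rewrite (_ : mkset _ = [set x | D x /\ forall n,
    (D `&` f @^-1` U n) x <-> (D `&` g @^-1` U n) x]).
  apply: measurable_conj => //; apply: measurable_forall => n.
  by apply: measurable_iff; [apply: mf|apply: mg] => //; exact: sepU.1.
apply/seteqP; split=> [x [Dx fg]|x [Dx fg]]; split=> //.
  by move=> n; rewrite /= fg.
by apply: sepU.2 => n; have [fgn gfn] := fg n; split=> Hx;
  [apply: (fgn _).2|apply: (gfn _).2].
Qed.

Lemma measurable_eqT (f g : X -> Y) :
  measurable_fun setT f -> measurable_fun setT g ->
  measurable [set x | f x = g x].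
Proof.
move=> mf mg; have := measurable_eq measurableT mf mg.
by congr measurable; apply/seteqP; split=> // x [].
Qed.

End MeasurableEq.

Section RealProbability.
Context (R : realType) d (X : measurableType d) (mu : probability X R).

Definition pr (A : set X) : R := fine (mu A).

Lemma prE A : measurable A -> mu A = (pr A)%:E.
Proof. by move=> mA; rewrite fineK //; exact: fin_num_measure. Qed.

Lemma pr_ge0 A : 0 <= pr A.
Proof. exact/fine_ge0/measure_ge0. Qed.

Lemma pr0 : pr set0 = 0.
Proof. by rewrite /pr measure0. Qed.

Lemma prT : pr setT = 1.
Proof. by rewrite /pr probability_setT. Qed.

Lemma pr_le A B : measurable A -> measurable B -> A `<=` B -> pr A <= pr B.
Proof.
move=> mA mB AB; rewrite -lee_fin -!prE //.
by apply: le_measure => //; rewrite inE.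
Qed.

Lemma prU A B : measurable A -> measurable B -> (forall x, A x -> ~ B x) ->
  pr (A `|` B) = pr A + pr B.
Proof.
move=> mA mB AB; apply: EFin_inj; rewrite EFinD -!prE //.
  by rewrite measureU //; apply/seteqP; split=> // x [/AB].
exact: measurableU.
Qed.

Lemma prC A : measurable A -> pr (~` A) = 1 - pr A.
Proof.
move=> mA; have mC := measurableC mA.
have := prU mA mC; rewrite setUv prT => -> //; [by rewrite addrC addKr|by move=> x Ax; apply].
Qed.

Lemma prID B A : measurable A -> measurable B ->
  pr A = pr (A `&` B) + pr (A `\` B).
Proof.
move=> mA mB; rewrite -prU; first by rewrite setUIDK.
- exact: measurableI.
- exact: measurableD.
- by move=> x [_ Bx] [].
Qed.

Lemma prU_le A B : measurable A -> measurable B ->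
  pr (A `|` B) <= pr A + pr B.
Proof.
move=> mA mB; rewrite (prID (measurableU _ _ mA mB) mA).
have mU := measurableU _ _ mA mB.
apply: lerD.
  by apply: pr_le; [exact: measurableI|by []|move=> x []].
by apply: pr_le; [exact: measurableD|by []|move=> x [[]]].
Qed.

Lemma pr_cover (I : eqType) (r : seq I) (F : I -> set X) A :
  measurable A -> (forall i, i \in r -> measurable (F i)) ->
  (forall x, A x -> exists2 i, i \in r & F i x) ->
  pr A <= \sum_(i <- r) pr (F i).
Proof.
elim: r A => [|i r IHr] A mA mF Acov.
  rewrite big_nil (_ : A = set0) ?pr0 //.
  by apply/seteqP; split=> // x /Acov[].
have mFi : measurable (F i) by apply: mF; rewrite inE eqxx.
rewrite big_cons (prID mA mFi) lerD //.
  by apply: pr_le; [exact: measurableI|by []|move=> x []].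
apply: IHr => [|j jr|x [/Acov[j]]]; first exact: measurableD.
  by apply: mF; rewrite inE jr orbT.
by rewrite inE => /predU1P[-> //|jr Fjx] _; exists j.
Qed.

Lemma pr_pack (I : eqType) (r : seq I) (F : I -> set X) A :
  measurable A -> (forall i, i \in r -> measurable (F i)) -> uniq r ->
  (forall i j x, i \in r -> j \in r -> F i x -> F j x -> i = j) ->
  (forall i, i \in r -> F i `<=` A) ->
  \sum_(i <- r) pr (F i) <= pr A.
Proof.
elim: r A => [|i r IHr] A mA mF /=; first by rewrite big_nil pr_ge0.
have mFi : measurable (F i) by apply: mF; rewrite inE eqxx.
move=> /andP[ir ur] dF FA; rewrite big_cons (prID mA mFi) lerD //.
  apply: pr_le => //; first exact: measurableI.
  by move=> x Fix; split=> //; apply: FA Fix; rewrite inE eqxx.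
apply: IHr => // [|j jr|j k x jr kr|j jr x Fjx]; first exact: measurableD.
- by apply: mF; rewrite inE jr orbT.
- by apply: dF; rewrite inE ?jr ?kr orbT.
- split; first by apply: FA Fjx; rewrite inE jr orbT.
  move=> Fix; have ij : i = j by apply: (dF i j x); rewrite // inE ?eqxx ?jr ?orbT.
  by rewrite ij jr in ir.
Qed.

Lemma pr_null_le A B : measurable A -> measurable B -> pr B = 0 ->
  A `<=` B -> pr A = 0.
Proof.
by move=> mA mB B0 AB; apply/le_anti; rewrite pr_ge0 -B0 pr_le.
Qed.

Lemma pr_null_exists (I : countType) (F : I -> set X) :
  (forall i, measurable (F i)) -> (forall i, pr (F i) = 0) ->
  pr [set x | exists i, F i x] = 0.
Proof.
move=> mF F0; pose H n := if unpickle n is Some i then F i else set0.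
have HE : [set x | exists i, F i x] = \bigcup_n H n.
  apply/seteqP; split=> [x [i Fix]|x [n _]].
    by exists (pickle i) => //; rewrite /H pickleK.
  by rewrite /H; case: (unpickle n) => // i; exists i.
have mH n : measurable (H n) by rewrite /H; case: (unpickle n).
have H0 n : mu (H n) = 0%E.
  by rewrite prE // /H; case: (unpickle n) => [i|]; rewrite ?F0 ?pr0.
rewrite HE; apply: EFin_inj; rewrite -prE; last exact: bigcupT_measurable.
apply: measure_negligible; first exact: bigcupT_measurable.
by apply: negligible_bigcup => n; apply/(negligibleP mu (mH n)); exact: H0.
Qed.

Lemma pr_increasing (F : nat -> set X) e : (forall n, measurable (F n)) ->
  (forall n, F n `<=` F n.+1) -> pr [set x | forall n, ~ F n x] = 0 -> 0 < e ->
  exists n, pr (~` F n) < e.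
Proof.
move=> mF incF F0 e0.
have homoF : {homo F : n m / (n <= m)%N >-> (n <= m)%O}.
  apply: homo_leq => //; [exact: le_trans|].
  by move=> n; apply/subsetPset.
have mU : measurable (\bigcup_n F n) by exact: bigcupT_measurable.
have muU : mu (\bigcup_n F n) = 1%E.
  have := prC mU; rewrite prE // (_ : ~` _ = [set x | forall n, ~ F n x]).
    rewrite F0 => /eqP; rewrite eq_sym subr_eq0 => /eqP -> //.
  by apply/seteqP; split=> [x Ux n Fnx|x Ux [n _ /Ux //]]; apply: Ux; exists n.
have : mu (F n) @[n --> \oo] --> (1 : R)%:E.
  by rewrite -muU; exact: nondecreasing_cvg_mu.
move=> /fine_cvgP[_] /cvgrPdist_lt/(_ e e0)[N _ /(_ N (leqnn N))] /=.
rewrite -[fine (mu _)]/(pr _) -prC // => H; exists N.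
by apply: le_lt_trans H; exact: ler_norm.
Qed.

End RealProbability.

(** The selection device of the whole proof: choosing the least index that works cuts a countable
    cover into disjoint measurable pieces. *)
Definition first (P : nat -> Prop) k := P k /\ forall j, (j < k)%N -> ~ P j.

Lemma first_exists (P : nat -> Prop) : (exists k, P k) -> exists k, first P k.
Proof.
move=> /cid[k Pk].
have exP : exists n, `[< P n >] by exists k; apply/asboolP.
case: (ex_minnP exP) => m /asboolP Pm minm; exists m; split=> // j jm Pj.
by have := minm j (introT (asboolP _) Pj); rewrite leqNgt jm.
Qed.

Lemma first_unique (P : nat -> Prop) j k : first P j -> first P k -> j = k.
Proof.
move=> [Pj minj] [Pk mink].
by case: (ltngtP j k) => [/mink|/minj|].
Qed.

Lemma measurable_first d (X : measurableType d) (F : nat -> set X) k :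
  (forall i, measurable (F i)) -> measurable [set x | first (F^~ x) k].
Proof.
move=> mF; apply: measurable_conj => //; apply: measurable_forall => j.
by apply: measurable_imply; [exact: measurable_prop|exact: measurable_not].
Qed.

Section CountableSums.
Context (R : realType) d (X : measurableType d) (mu : probability X R).

Lemma esum_pickle (I : countType) (f : I -> \bar R) : (forall i, 0 <= f i)%E ->
  \esum_(i in [set: I]) f i =
  \esum_(n in [set: nat]) (if @pickle_inv I n is Some i then f i else 0%E).
Proof.
move=> f0; transitivity (\esum_(n in range (@pickle I))
    (if @pickle_inv I n is Some i then f i else 0%E)).
  rewrite (@reindex_esum R I nat setT (range pickle) pickle); last first.
    by apply: inj_bij => i j _ _; exact: (pcan_inj pickleK).
  by apply: eq_esum => i _; rewrite pickleK_inv.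
rewrite esum_mkcond; apply: eq_esum => n _; case: ifPn => //.
case E : (pickle_inv n) => [i|] //; rewrite notin_setE; case.
by exists i => //; have := @pickle_invK I n; rewrite /= E.
Qed.

Lemma esum_disjoint_le (I : countType) (F : I -> set X) A :
  measurable A -> (forall i, measurable (F i)) ->
  (forall i j x, F i x -> F j x -> i = j) -> (forall i, F i `<=` A) ->
  (\esum_(i in [set: I]) mu (F i) <= mu A)%E.
Proof.
move=> mA mF dF FA; apply: ge_ereal_sup => _ [D [finD _] <-].
rewrite -measure_fin_bigcup //; last first.
  by apply/trivIsetP => i j _ _ /eqP ij; apply/seteqP; split=> // x [/dF H /H].
apply: le_measure; rewrite ?inE //; first exact: fin_bigcup_measurable.
by move=> x [i _ /FA].
Qed.

Lemma pr_esum_le (I : countType) (F : I -> set X) : (forall i, measurable (F i)) ->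
  (mu [set x | exists i, F i x] <= \esum_(i in [set: I]) mu (F i))%E.
Proof.
move=> mF; rewrite esum_pickle // -nneseries_esumT; last by move=> n; case: pickle_inv.
pose H n := if @pickle_inv I n is Some i then F i else set0.
rewrite (_ : \big[_/_]_(0 <= i <oo) _ = (\sum_(0 <= n <oo) mu (H n))%E); last first.
  by apply: eq_eseriesr => n _; rewrite /H; case: pickle_inv.
have mH n : measurable (H n) by rewrite /H; case: pickle_inv.
apply: measure_sigma_subadditive => //; first exact: measurable_exists.
move=> x [i Fix]; exists (pickle i) => //; rewrite /H pickleK_inv //.
Qed.

End CountableSums.

(** * Families of restrictions of group elements *)

Section Action.
Context (R : realType) (G : groupType) d (X : measurableType d).
Context (mu : probability X R) (a : mp_action G mu).

Lemma actK g x : a g^-1%g (a g x) = x.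
Proof. by rewrite -act_mul mulVg act_one. Qed.

Lemma actKV g x : a g (a g^-1%g x) = x.
Proof. by rewrite -act_mul mulgV act_one. Qed.

Lemma act_inj g : injective (a g).
Proof. exact: can_inj (actK g). Qed.

Lemma act_image g A : a g @` A = [set x | A (a g^-1%g x)].
Proof.
apply/seteqP; split=> [_ [x Ax <-]|x /= Ax]; first by rewrite /= actK.
by exists (a g^-1%g x) => //; rewrite actKV.
Qed.

Lemma measurable_act g A : measurable A -> measurable [set x | A (a g x)].
Proof. by move=> mA; have := act_measurable a g measurableT mA; rewrite setTI. Qed.

Lemma pr_act g A : measurable A -> pr mu [set x | A (a g x)] = pr mu A.
Proof. by move=> mA; rewrite /pr -(act_preserving a g mA). Qed.

End Action.

Section Words.
Context (R : realType) (G : groupType) d (X : measurableType d).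
Context (mu : probability X R) (a : mp_action G mu).
Context (I : Type) (el : I -> G) (dom : I -> set X).

Definition fstep x y := exists i, dom i x /\ a (el i) x = y.
Definition frel := clos_refl_sym_trans X fstep.

Definition lel (l : I * bool) := if l.2 then el l.1 else (el l.1)^-1%g.

(* The location, relative to the current point, of the source of the edge
   crossed by the letter [l]. *)
Definition lsrc (l : I * bool) := if l.2 then 1%g else (el l.1)^-1%g.

Fixpoint valid (w : seq (I * bool)) x : Prop :=
  if w is l :: w' then dom l.1 (a (lsrc l) x) /\ valid w' (a (lel l) x) else True.

(** The first letter acts first and so stands rightmost in the product. *)
Fixpoint wprod (w : seq (I * bool)) : G :=
  if w is l :: w' then (wprod w' * lel l)%g else 1%g.

Lemma valid_cat u v x : valid (u ++ v) x <-> valid u x /\ valid v (a (wprod u) x).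
Proof.
elim: u x => [|l u IHu] x /=; first by rewrite act_one; split=> [|[]].
by rewrite IHu act_mul; split=> [[? []]|[[]]].
Qed.

Lemma wprod_cat u v : wprod (u ++ v) = (wprod v * wprod u)%g.
Proof. by elim: u => [|l u IHu] /=; rewrite ?mulg1 // IHu mulgA. Qed.

Definition winv (w : seq (I * bool)) := rev [seq (l.1, ~~ l.2) | l <- w].

Lemma wprod_winv w : wprod (winv w) = (wprod w)^-1%g.
Proof.
elim: w => [|[i b] w IHw]; first by rewrite /= invg1.
rewrite /winv /= rev_cons -cats1 wprod_cat -/(winv w) IHw /= mul1g invgM.
by rewrite /lel /=; case: b; rewrite /= ?invgK.
Qed.

Lemma valid_winv w x : valid w x -> valid (winv w) (a (wprod w) x).
Proof.
elim: w x => [|[i b] w IHw] x //= [domi vw].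
rewrite /winv /= rev_cons -cats1 valid_cat -/(winv w) act_mul.
split; first exact: IHw.
rewrite wprod_winv actK /=; split=> //; move: domi {vw}; rewrite /lsrc /lel /=.
by case: b; rewrite /= ?actK ?act_one.
Qed.

(** Connectedness becomes a union over countably many words, the source of measurability and of
    approximation by finite lists of words. *)
Lemma frelP x y : frel x y <-> exists w, valid w x /\ a (wprod w) x = y.
Proof.
split=> [|[w]].
  elim=> {x y} [x y [i [domi <-]]|x|x y _ [w [vw <-]]|x y z _ [u [vu <-]] _ [v [vv <-]]].
  - by exists [:: (i, true)]; rewrite /= mul1g act_one.
  - by exists [::]; rewrite /= act_one.
  - by exists (winv w); rewrite wprod_winv actK; split=> //; exact: valid_winv.
  - by exists (u ++ v); rewrite wprod_cat act_mul; split=> //; apply/valid_cat.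
elim: w x => [|[i b] w IHw] x /= [].
  by rewrite act_one => _ <-; exact: rst_refl.
move=> [domi vw]; rewrite act_mul => E.
apply: (@rst_trans _ _ _ (a (lel (i, b)) x)); last exact: IHw.
move: domi {vw E IHw}; rewrite /lel /lsrc /=; case: b => /= domi.
  by apply: rst_step; exists i; rewrite act_one in domi.
by apply/rst_sym/rst_step; exists i; rewrite actKV.
Qed.

Lemma frel_orbit x y : frel x y -> exists g, a g x = y.
Proof. by move=> /frelP[w [_ <-]]; exists (wprod w). Qed.

End Words.

Lemma frel_sub (R : realType) (G : groupType) d (X : measurableType d)
    (mu : probability X R) (a : mp_action G mu) (I J : Type)
    (el : I -> G) (dom : I -> set X) (el' : J -> G) (dom' : J -> set X) :
  (forall i x, dom i x -> frel a el' dom' x (a (el i) x)) ->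
  forall x y, frel a el dom x y -> frel a el' dom' x y.
Proof.
move=> H x y; elim=> {x y} [x y [i [/H ? <-]] //|x|x y _ ?|x y z _ ? _ ?].
- exact: rst_refl.
- exact: rst_sym.
- by apply: (@rst_trans _ _ _ y).
Qed.

Section MeasurableWords.
Context (R : realType) (G : groupType) d (X : measurableType d).
Context (mu : probability X R) (a : mp_action G mu) (U : nat -> set X).
Hypothesis sepU : separating U.
Context (I : countType) (el : I -> G) (dom : I -> set X).
Hypothesis mdom : forall i, measurable (dom i).

Lemma measurable_valid w : measurable [set x | valid a el dom w x].
Proof.
elim: w => [|l w IHw]; first exact: measurable_prop.
apply: measurable_conj; first exact: measurable_act.
exact: (measurable_act a (lel el l) IHw).
Qed.

Lemma measurable_act_eq g h : measurable [set x | a g x = a h x].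
Proof. by apply: (measurable_eqT sepU); exact: act_measurable. Qed.

Lemma measurable_frel g h : measurable [set x | frel a el dom (a g x) (a h x)].
Proof.
rewrite (_ : mkset _ = [set x | exists w, valid a el dom w (a g x) /\
    a (wprod el w * g)%g x = a h x]).
  apply: measurable_exists => w; apply: measurable_conj.
    exact: (measurable_act a g (measurable_valid w)).
  exact: measurable_act_eq.
by apply/seteqP; split=> x /=; [move=> /frelP|move=> H; apply/frelP; move: H] => -[w [vw E]];
  exists w; rewrite act_mul in E *.
Qed.

End MeasurableWords.

(** * Cost in terms of restricted group elements *)

Section Cost.
Context (R : realType) (G : groupType) d (X : measurableType d).
Context (mu : probability X R) (a : mp_action G mu) (U : nat -> set X).
Hypothesis sepU : separating U.
Context (e : nat -> G) (eS : forall g, exists n, e n = g).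

Definition generating (I : Type) (el : I -> G) (dom : I -> set X) :=
  forall g, pr mu [set x | ~ frel a el dom x (a g x)] = 0.

Lemma act_piece_subproof (g : G) (D B : set X) : measurable D -> measurable B ->
  B `<=` [set x | D (a g^-1%g x)] -> mu (D `&` a g @^-1` B) = mu B.
Proof.
move=> mD mB BD; rewrite -(act_preserving a g mB); congr (mu _).
by apply/seteqP; split=> [x []//|x Bx]; split=> //; have := BD _ Bx; rewrite /= actK.
Qed.

Definition act_piece (g : G) (D : set X) (mD : measurable D) : partial_iso mu.
Proof.
apply: (@PartialIso _ _ _ mu D [set x | D (a g^-1%g x)] (a g)) => //.
- exact: measurable_act.
- split=> [x Dx /=|x y _ _ /act_inj //|y Dy]; first by rewrite actK.
  by exists (a g^-1%g y) => //; rewrite actKV.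
- by apply: measurable_funS (act_measurable a g).
- by move=> B mB; exact: act_piece_subproof.
Defined.

Lemma action_cost_le (I : countType) (el : I -> G) (dom : I -> set X) :
  (forall i, measurable (dom i)) -> generating el dom ->
  (action_cost a <= \esum_(i in [set: I]) mu (dom i))%E.
Proof.
move=> mdom gen.
pose Phi n := if @pickle_inv I n is Some i then act_piece (el i) (mdom i)
              else act_piece 1%g (measurable0 : measurable (set0 : set X)).
have -> : \esum_(i in [set: I]) mu (dom i) = lgraphing_cost Phi.
  rewrite esum_pickle // /lgraphing_cost nneseries_esumT //.
  by apply: eq_esum => n _; rewrite /Phi; case: pickle_inv => //=; rewrite measure0.
apply: ereal_inf_lbound; exists Phi => //.
have PhiP x y : lgraphing_rel Phi x y <-> frel a el dom x y.
  split; elim=> {x y} [x y|x|x y _ ?|x y z _ ? _ ?]; do ?[exact: rst_refl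
    | exact: rst_sym | by apply: (@rst_trans _ _ _ y)].
    move=> [n []]; rewrite /Phi; case: pickle_inv => //= i Dx <-.
    by apply: rst_step; exists i.
  move=> [i [Dx <-]]; apply: rst_step; exists (pickle i).
  by rewrite /Phi pickleK_inv.
have mrel g : measurable [set x | frel a el dom x (a g x)].
  have := measurable_frel a sepU el mdom 1%g g.
  by congr measurable; apply/seteqP; split=> x /=; rewrite act_one.
exists [set x | forall k, frel a el dom x (a (e k) x)]; split.
- by apply: measurable_forall => k; exact: mrel.
- rewrite (_ : ~` _ = [set x | exists k, ~ frel a el dom x (a (e k) x)]).
    rewrite prE; last by apply: measurable_exists => k; exact: measurable_not (mrel _).
    by rewrite pr_null_exists // => k; [exact: measurable_not (mrel _)|exact: gen].
  by apply/seteqP; split=> [x /existsNP //|x [k xk] H]; exact/xk.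
- move=> x y xX yX; rewrite PhiP; split; first exact: frel_orbit.
  by move=> [g <-]; have [k <-] := eS g; exact: xX.
Qed.

End Cost.

Section FamilyOfGraphing.
Context (R : realType) (G : groupType) d (X : measurableType d).
Context (mu : probability X R) (a : mp_action G mu) (U : nat -> set X).
Hypothesis sepU : separating U.
Context (e : nat -> G) (eS : forall g, exists n, e n = g).

Definition nat_el (I : countType) (el : I -> G) n :=
  if @pickle_inv I n is Some i then el i else 1%g.
Definition nat_dom (I : countType) (dom : I -> set X) n :=
  if @pickle_inv I n is Some i then dom i else set0.

Section NatFamily.
Context (I : countType) (el : I -> G) (dom : I -> set X).

Lemma measurable_nat_dom n : (forall i, measurable (dom i)) ->
  measurable (nat_dom dom n).
Proof. by move=> mdom; rewrite /nat_dom; case: pickle_inv. Qed.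

Lemma nat_family_cost :
  \esum_(n in [set: nat]) mu (nat_dom dom n) = \esum_(i in [set: I]) mu (dom i).
Proof.
rewrite esum_pickle //; apply: eq_esum => n _; rewrite /nat_dom.
by case: pickle_inv => //; rewrite measure0.
Qed.

Lemma frel_nat_family x y :
  frel a (nat_el el) (nat_dom dom) x y <-> frel a el dom x y.
Proof.
split; apply: frel_sub => {x y}.
  move=> n x; rewrite /nat_dom /nat_el; case: pickle_inv => // i Dx.
  by apply: rst_step; exists i.
move=> i x Dx; apply: rst_step; exists (pickle i).
by rewrite /nat_dom /nat_el pickleK_inv.
Qed.

End NatFamily.

(** The converse of [action_cost_le]. Where a graphing stays inside [X0], each of its maps is cut
    along the least [k] for which it agrees with [e k]; the pieces are disjoint and do not increase
    the cost. The work lies in showing that the discarded edges matter only on an invariant null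
    set. *)
Lemma family_of_cost r : (action_cost a < r)%E ->
  exists (el : nat -> G) (dom : nat -> set X),
    [/\ forall i, measurable (dom i), generating a el dom &
        (\esum_(i in [set: nat]) mu (dom i) < r)%E].
Proof.
move=> /ereal_inf_lt[_ [Phi [X0 [mX0 muX0 PhiE]] <-]] costr.
pose D i := [set x | [/\ pdom (Phi i) x, X0 x & X0 (pmap (Phi i) x)]].
have mpre i B : measurable B -> measurable (pdom (Phi i) `&` pmap (Phi i) @^-1` B).
  by move=> mB; exact: (pmap_measurable (pdom_measurable (Phi i)) mB).
have DE i : D i = (pdom (Phi i) `&` pmap (Phi i) @^-1` X0) `&` X0.
  by apply/seteqP; split=> x [] //= [].
have mD i : measurable (D i) by rewrite DE; apply: measurableI => //; exact: mpre.
have DX i x : D i x -> exists g, a g x = pmap (Phi i) x.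
  move=> [px xX yX]; apply/(PhiE _ _ xX yX); apply: rst_step.
  by exists i.
pose piece (p : nat * nat) := [set x |
  first (fun k => D p.1 x /\ pmap (Phi p.1) x = a (e k) x) p.2].
have mpiece p : measurable (piece p).
  apply: measurable_first => k; apply: (measurable_eq sepU) => //.
    apply: measurable_funS (pmap_measurable (p := Phi p.1)).
      exact: pdom_measurable.
    by move=> x [].
  by apply: measurable_funS (act_measurable a _).
pose Im i := [set y | exists k, piece (i, k) (a (e k)^-1%g y)].
have mIm i : measurable (Im i).
  by apply: measurable_exists => k; exact: measurable_act.
have Dpiece i x : D i x -> exists k, piece (i, k) x /\ pmap (Phi i) x = a (e k) x.
  move=> Dx; have [g gx] := DX _ _ Dx; have [k ek] := eS g.
  have [j Pj] : exists k, piece (i, k) x.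
    by apply: first_exists; exists k; rewrite ek.
  by exists j; split=> //; case: Pj => -[].
have ImP i y : Im i y -> exists k x, [/\ piece (i, k) x, pmap (Phi i) x = a (e k) x & y = a (e k) x].
  move=> [k pk]; exists k, (a (e k)^-1%g y); split=> //; last by rewrite actKV.
  by case: pk => -[].
have DIm i x : D i x -> Im i (pmap (Phi i) x).
  by move=> /Dpiece[k [pk ->]]; exists k; rewrite actK.
have ImD i : Im i `<=` pcod (Phi i).
  move=> y /ImP[k [x [[[[px _ _] _] _] <- ->]]].
  by have [fP _ _] := pmap_bij (Phi i); exact: fP.
have prX0 : pr mu (~` X0) = 0 by rewrite /pr muX0.
have mX0C := measurableC mX0.
have prpre i B : measurable B -> B `<=` pcod (Phi i) ->
    pr mu (pdom (Phi i) `&` pmap (Phi i) @^-1` B) = pr mu B.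
  by move=> mB BC; rewrite /pr (@pmap_preserving _ _ _ _ (Phi i) B).
have pdomN i : pr mu (pdom (Phi i) `\` D i) = 0.
  have mpd := pdom_measurable (Phi i); have mpc := pcod_measurable (Phi i).
  have mB : measurable (~` X0 `&` pcod (Phi i)) by exact: measurableI.
  apply: (@pr_null_le _ _ _ _ _
      (~` X0 `|` pdom (Phi i) `&` pmap (Phi i) @^-1` (~` X0 `&` pcod (Phi i)))).
  - exact: measurableD.
  - by apply: measurableU => //; exact: mpre.
  - apply/le_anti; rewrite pr_ge0 andbT.
    apply: (le_trans (prU_le _ _ _)) => //; first exact: mpre.
    rewrite prX0 prpre // add0r -prX0; apply: pr_le => //.
  - move=> x [px nDx]; have [xX|] := pselect (X0 x); last by left.
    right; split=> //; split=> [yX|]; first exact: nDx.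
    by have [fP _ _] := pmap_bij (Phi i); exact: fP.
(* The codomain side matters as well: a good point could be entered by an edge from a bad one. If
   the point lies in [Im i], injectivity of the map makes that edge a good one. *)
have pcodN i : pr mu (pcod (Phi i) `\` Im i) = 0.
  have mpd := pdom_measurable (Phi i); have mpc := pcod_measurable (Phi i).
  apply/le_anti; rewrite pr_ge0 andbT.
  have := prID mu mpc (mIm i); rewrite (setIidr (@ImD i)).
  have := prID mu mpd (mD i); rewrite pdomN addr0.
  have := prpre i _ mpc (@subset_refl _ _).
  rewrite setIidl; last by have [fP _ _] := pmap_bij (Phi i).
  have DI : pdom (Phi i) `&` D i `<=` pdom (Phi i) `&` pmap (Phi i) @^-1` Im i.
    by move=> x [px /DIm].
  have := pr_le mu (measurableI _ _ mpd (mD i)) (mpre i _ (mIm i)) DI.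
  by rewrite prpre //; lra.
pose bad x := ~ X0 x \/ exists i, (pdom (Phi i) `\` D i) x \/ (pcod (Phi i) `\` Im i) x.
have mpair i : measurable [set x | (pdom (Phi i) `\` D i) x \/ (pcod (Phi i) `\` Im i) x].
  apply: measurable_disj; apply: measurableD => //.
    exact: pdom_measurable.
  exact: pcod_measurable.
have mbad : measurable [set x | bad x].
  by apply: measurable_disj => //; exact: measurable_exists.
have prbad : pr mu [set x | bad x] = 0.
  apply/le_anti; rewrite pr_ge0 andbT.
  apply: (le_trans (prU_le _ _ _)) => //; first exact: measurable_exists.
  rewrite prX0 pr_null_exists ?addr0 // => i.
  apply/le_anti; rewrite pr_ge0 andbT.
  apply: (le_trans (prU_le _ _ _)); last by rewrite pdomN pcodN addr0.
    by apply: measurableD => //; exact: pdom_measurable.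
  by apply: measurableD => //; exact: pcod_measurable.
(* The saturation of [bad] is invariant and still null, so the graphing can be followed outside
   it. *)
pose sat x := exists k, bad (a (e k) x).
have msat : measurable [set x | sat x].
  by apply: measurable_exists => k; exact: (measurable_act a (e k) mbad).
have prsat : pr mu [set x | sat x] = 0.
  apply: pr_null_exists => k; first exact: (measurable_act a (e k) mbad).
  by rewrite (pr_act a (e k) mbad).
have satG g x : sat (a g x) -> sat x.
  move=> [k]; rewrite -act_mul => bk; have [j ej] := eS (e k * g)%g.
  by exists j; rewrite ej.
have satGV g x : sat x -> sat (a g x).
  by move=> sx; apply: (satG g^-1%g); rewrite actK.
have sat_bad x : ~ sat x -> ~ bad x.
  move=> nsx bx; apply: nsx; have [k ek] := eS 1%g.
  by exists k; rewrite ek act_one.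
pose el (p : nat * nat) := e p.2.
have Dstep i x : D i x -> frel a el piece x (pmap (Phi i) x).
  move=> /Dpiece[k [pk ->]]; apply: rst_step; exists (i, k); split=> //.
(* The induction runs through symmetric closures, so goodness has to propagate from either end to
   the other. *)
have relP x y : lgraphing_rel Phi x y ->
    (~ sat x -> frel a el piece x y /\ ~ sat y) /\
    (~ sat y -> frel a el piece x y /\ ~ sat x).
  elim=> {x y} [x y [i [px pxy]]|x|x y _ [IH1 IH2]|x y z _ [IH1 IH2] _ [IH3 IH4]].
  - have Dgood : D i x -> (~ sat x -> frel a el piece x y /\ ~ sat y) /\
        (~ sat y -> frel a el piece x y /\ ~ sat x).
      move=> Dx; have := Dstep _ _ Dx; have [g gx] := DX _ _ Dx.
      rewrite pxy in gx *; rewrite -gx.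
      by split=> ns; split=> //; [move/satG|move/(satGV g)].
    have [sx|nsx] := pselect (sat x); last first.
      apply: Dgood; apply: contrapT => nDx; apply: (sat_bad _ nsx).
      by right; exists i; left.
    have [sy|nsy] := pselect (sat y); first by split.
    apply: Dgood; have [fP fI _] := pmap_bij (Phi i).
    have Iy : Im i y.
      apply: contrapT => nIy; apply: (sat_bad _ nsy).
      by right; exists i; right; split=> //; rewrite -pxy; exact: fP.
    have [k [z [[[Dz _] _] pz yz]]] := ImP _ _ Iy.
    have -> // : x = z.
    apply: fI; rewrite ?inE //; first by case: Dz.
    by rewrite pxy pz.
  - by split=> ?; split=> //; exact: rst_refl.
  - by split=> [/IH2|/IH1] [? ?]; split=> //; exact: rst_sym.
  - split=> [/IH1[xy /IH3[yz nsz]]|/IH4[yz /IH2[xy nsx]]]; split=> //;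
      by apply: (@rst_trans _ _ _ y).
exists (nat_el el), (nat_dom piece); split.
- by move=> i; exact: measurable_nat_dom.
- move=> g; apply: (@pr_null_le _ _ _ _ _ [set x | sat x]) => //.
    apply: measurable_not; have := measurable_frel a sepU (nat_el el)
      (fun n => measurable_nat_dom n mpiece) 1%g g.
    by congr measurable; apply/seteqP; split=> x /=; rewrite act_one.
  move=> x /= nfx; apply: contrapT => nsx; apply: nfx; apply/frel_nat_family.
  have [|+ _] := relP x (a g x); last by case/(_ nsx).
  apply/PhiE; last by exists g.
    by apply: contrapT => nX; apply: (sat_bad _ nsx); left.
  apply: contrapT => nX; apply: (sat_bad (a g x)); last by left.
  by move/satG.
- rewrite nat_family_cost -setXTT.
  rewrite -(@esum_esum _ _ _ setT (fun _ => setT) (fun i k => mu (piece (i, k)))) //.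
  apply: le_lt_trans costr; rewrite /lgraphing_cost nneseries_esumT //.
  apply: le_esum => i _; apply: esum_disjoint_le => //.
  + exact: pdom_measurable.
  + by move=> j k x; exact: first_unique.
  + by move=> k x [[[]]].
Qed.

End FamilyOfGraphing.

Section FiniteSums.
Context (R : realType) d (X : measurableType d) (mu : probability X R).

Lemma pr_coverF (T : finType) (P : pred T) (F : T -> set X) A :
  measurable A -> (forall i, measurable (F i)) ->
  (forall x, A x -> exists2 i, P i & F i x) ->
  pr mu A <= \sum_(i | P i) pr mu (F i).
Proof.
move=> mA mF cov; rewrite -big_filter; apply: pr_cover => // x /cov[i Pi Fix].
by exists i => //; rewrite mem_filter Pi mem_index_enum.
Qed.

Lemma pr_packF (T : finType) (P : pred T) (F : T -> set X) A :
  measurable A -> (forall i, measurable (F i)) ->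
  (forall i j x, F i x -> F j x -> i = j) ->
  (forall i, P i -> F i `<=` A) ->
  \sum_(i | P i) pr mu (F i) <= pr mu A.
Proof.
move=> mA mF dF FA; rewrite -big_filter; apply: pr_pack => //.
- by rewrite filter_uniq // index_enum_uniq.
- by move=> i j x _ _; exact: dF.
- by move=> i; rewrite mem_filter => /andP[/FA].
Qed.

Lemma sum_le_card (T : finType) (P : pred T) (f : T -> R) c : 0 <= c ->
  (forall i, P i -> f i <= c) -> \sum_(i | P i) f i <= #|T|%:R * c.
Proof.
move=> c0 fc; apply: (le_trans (ler_sum _ fc)).
rewrite sumr_const -[leLHS]mulr_natl ler_wpM2r // ler_nat; exact: max_card.
Qed.

End FiniteSums.

(** * Transfer along weak containment *)

Section WeakContainment.
Context (R : realType) (G : groupType).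
Context d (X : measurableType d) (mu : probability X R) (a : mp_action G mu).
Context d' (Y : measurableType d') (nu : probability Y R) (b : mp_action G nu).
Hypothesis wc : weakly_contained a b.

Lemma weakly_contained_fin (T : finType) (A : T -> set X) (F : seq G) eps :
  (forall t, measurable (A t)) -> 0 < eps ->
  exists2 B : T -> set Y, forall t, measurable (B t) &
    forall g i j, g \in F ->
      `| pr mu [set x | A i (a g x) /\ A j x] -
         pr nu [set y | B i (b g y) /\ B j y] | < eps.
Proof.
move=> mA e0.
(* Weak containment speaks of images under [g], this lemma of preimages; hence the inverses. *)
have [||B mB BP] := wc (A := fun k : 'I_#|T| => A (enum_val k))
  (F := [set g | g^-1%g \in F]) _ _ e0.
- by move=> k; exact: mA.
- rewrite (_ : mkset _ = [set (g^-1)%g | g in [set` F]]); first exact: finite_image.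
  apply/seteqP; split=> [g /= gF|_ [g gF <-]]; last by rewrite /= invgK.
  by exists (g^-1)%g => //; rewrite invgK.
exists (fun t => B (enum_rank t)); first by move=> t; exact: mB.
move=> g i j gF; have := BP (g^-1)%g (enum_rank i) (enum_rank j).
rewrite /= invgK => /(_ gF); rewrite !act_image !invgK !enum_rankK.
rewrite !prE; first by rewrite -EFinB abse_EFin lte_fin.
  by apply: measurable_conj => //; exact: (measurable_act b).
by apply: measurable_conj => //; exact: (measurable_act a).
Qed.

(** With 1 among the tested group elements, disjointness of the [A t] forces every overlap of two of
    the new sets below [del], and the overlaps can be cut away. *)
Lemma weakly_contained_disjoint (T : finType) (A : T -> set X) (F : seq G) eps :
  (forall t, measurable (A t)) -> (forall i j x, A i x -> A j x -> i = j) ->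
  0 < eps ->
  exists B : T -> set Y, [/\ forall t, measurable (B t),
    forall i j x, B i x -> B j x -> i = j &
    forall g i j, g \in F ->
      `| pr mu [set x | A i (a g x) /\ A j x] -
         pr nu [set y | B i (b g y) /\ B j y] | < eps].
Proof.
move=> mA dA e0; pose N : R := #|T|%:R.
have N0 : 0 <= N by exact: ler0n.
(* Both sets of a pair lose at most [N * del], on top of the comparison error [del]: less than
   [(2 * N + 2) * del] in all. *)
pose del := eps / (2 * N + 2).
have del0 : 0 < del by rewrite divr_gt0 //; lra.
have delE : (2 * N + 2) * del = eps by rewrite mulrC divfK //; apply/eqP; lra.
have [B mB BP] := weakly_contained_fin (1%g :: F) mA del0.
pose O t := [set y | exists s, s != t /\ (B s y /\ B t y)].
have mO t : measurable (O t).
  apply: measurable_exists => s; apply: measurable_conj; first exact: measurable_prop.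
  exact: measurable_conj.
have prO t : pr nu (O t) <= N * del.
  apply: (le_trans (@pr_coverF _ _ _ nu _ (fun s => s != t)
      (fun s => [set y | B s y /\ B t y]) _ _ _ _)) => //.
  - by move=> s; exact: measurable_conj.
  - by move=> y [s [st BB]]; exists s.
  apply: sum_le_card; first exact: ltW.
  move=> s st; have := BP 1%g s t; rewrite inE eqxx => /(_ isT).
  rewrite (_ : [set x | A s (a 1%g x) /\ A t x] = set0) ?pr0; last first.
    apply/seteqP; split=> // x /=; rewrite act_one => -[As At].
    by move: st; rewrite (dA _ _ _ As At) eqxx.
  rewrite (_ : [set x | B s (b 1%g x) /\ B t x] = [set x | B s x /\ B t x]).
    by rewrite sub0r normrN ger0_norm ?pr_ge0 // => /ltW.
  by apply/seteqP; split=> x /=; rewrite act_one.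
exists (fun t => B t `\` O t); split=> [t|i j y [Bi nOi] [Bj _]|g i j gF].
- exact: measurableD.
- by apply: contrapT => /eqP ij; apply: nOi; exists j; rewrite eq_sym.
have mBB : measurable [set y | B i (b g y) /\ B j y].
  by apply: measurable_conj => //; exact: (measurable_act b).
have mBD t : measurable (B t `\` O t) by exact: measurableD.
have mDD : measurable [set y | (B i `\` O i) (b g y) /\ (B j `\` O j) y].
  by apply: measurable_conj => //; exact: (measurable_act b).
have mOg : measurable [set y | O i (b g y)] by exact: (measurable_act b).
have le1 : pr nu [set y | (B i `\` O i) (b g y) /\ (B j `\` O j) y] <=
    pr nu [set y | B i (b g y) /\ B j y].
  by apply: pr_le => // y [[? _] [? _]].
have le2 : pr nu [set y | B i (b g y) /\ B j y] <=
    pr nu [set y | (B i `\` O i) (b g y) /\ (B j `\` O j) y] +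
    (pr nu (O i) + pr nu (O j)).
  rewrite -(pr_act b g (mO i)).
  apply: (le_trans _ (le_trans (prU_le _ mDD (measurableU _ _ mOg (mO j)))
    (lerD (lexx _) (prU_le _ mOg (mO j))))).
  apply: pr_le => //; first by apply: measurableU => //; exact: measurableU.
  move=> y [Bi Bj]; have [Oi|nOi] := pselect (O i (b g y)); first by right; left.
  by have [Oj|nOj] := pselect (O j y); [right; right|left].
have := BP g i j; rewrite inE gF orbT => /(_ isT).
have := prO i; have := prO j; move: le1 le2.
set p := pr nu _; set q := pr nu [set y | B i _ /\ _]; set r := pr mu _.
rewrite !ltr_norml => ? ? ? ?; move/andP=> [? ?]; apply/andP; lra.
Qed.

End WeakContainment.

Section Approximation.
Context (R : realType) (G : groupType).
Context d (X : measurableType d) (mu : probability X R) (a : mp_action G mu).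
Context d' (Y : measurableType d') (nu : probability Y R) (b : mp_action G nu).
Hypothesis wc : weakly_contained a b.
Context (I : choiceType) (A : I -> set X) (mA : forall i, measurable (A i)).

(* Only positive membership constraints are transferred; this is all that the
   validity of paths in a graphing needs. *)
Lemma weakly_contained_approx (L : seq (G * I)) eps : 0 < eps ->
  exists B : I -> set Y, [/\ forall i, measurable (B i),
    forall i, i \notin [seq p.2 | p <- L] -> B i = set0,
    forall i, pr nu (B i) <= pr mu (A i) + eps &
    forall W : set (seq (G * I)), (forall c, W c -> {subset c <= L}) ->
      forall (mW : measurable [set x | exists c, W c /\
                forall p, p \in c -> A p.2 (a p.1 x)])
        (mW' : measurable [set y | exists c, W c /\
                forall p, p \in c -> B p.2 (b p.1 y)]),
      pr mu [set x | exists c, W c /\ forall p, p \in c -> A p.2 (a p.1 x)] <=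
      pr nu [set y | exists c, W c /\ forall p, p \in c -> B p.2 (b p.1 y)] + eps].
Proof.
(* The pairs [(1, i)] are added so that the pattern of a point decides its membership in [A i]
   itself. *)
move=> e0; pose L1 := L ++ [seq (1%g, p.2) | p <- L].
pose m := size L1; pose l := tnth (in_tuple L1).
have lP p : p \in L1 -> exists j, l j = p by move=> /seq_tnthP[j ->]; exists j.
pose T := {set 'I_m}.
(* The atoms of the algebra generated by the translates. It is these that are transferred, to sets
   [B0 t], and [B i] is rebuilt as the union of those [B0 t] whose atom lies in [A i]. *)
pose P (t : T) := [set x | forall j, (j \in t) <-> A (l j).2 (a (l j).1 x)].
have mP t : measurable (P t).
  apply: measurable_forall => j; apply: measurable_iff.
    exact: measurable_prop.
  exact: measurable_act.
have dP s t x : P s x -> P t x -> s = t.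
  move=> Ps Pt; apply/setP => j; apply/idP/idP.
    by move=> /(Ps j)/(Pt j).
  by move=> /(Pt j)/(Ps j).
pose pat x : T := finset.finset (fun j => `[< A (l j).2 (a (l j).1 x) >]).
have patP x : P (pat x) x.
  by move=> j; rewrite finset.in_set; split=> /asboolP.
pose N : R := #|{: T}|%:R; pose M : R := m%:R.
have N0 : 0 <= N by exact: ler0n.
have M0 : 0 <= M by exact: ler0n.
(* Each of the [N] atoms costs [del] in measure and [(N + 1) * del] for each of the at most [M]
   constraints. *)
pose K := N * (1 + M * (N + 1)) + N + 1.
have K0 : 0 < K by have := mulr_ge0 M0 N0; rewrite /K; nra.
pose del := eps / K.
have del0 : 0 < del by rewrite divr_gt0.
have delE : K * del = eps by rewrite mulrC divfK // gt_eqF.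
have Ndel0 : 0 <= (N + 1) * del by rewrite mulr_ge0 ?addr_ge0 // ltW.
have [B0 [mB0 dB0 BP]] := weakly_contained_disjoint wc (1%g :: [seq p.1 | p <- L1])
  mP dP del0.
have BP1 t : `| pr mu (P t) - pr nu (B0 t) | < del.
  have := BP 1%g t t; rewrite inE eqxx => /(_ isT).
  rewrite (_ : [set x | P t (a 1%g x) /\ P t x] = P t); last first.
    by apply/seteqP; split=> x /=; rewrite act_one; [case|split].
  rewrite (_ : [set x | B0 t (b 1%g x) /\ B0 t x] = B0 t) //.
  by apply/seteqP; split=> x /=; rewrite act_one; [case|split].
pose sel i (t : T) := [exists j, (l j == (1%g, i)) && (j \in t)].
have selA i t x : sel i t -> P t x -> A i x.
  by move=> /existsP[j /andP[/eqP lj jt]] Px; have := (Px j).1 jt; rewrite lj act_one.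
have Asel i x : (1%g, i) \in L1 -> A i x -> sel i (pat x).
  move=> /lP[j lj] Ax; apply/existsP; exists j; rewrite lj eqxx /=.
  by apply/(patP x); rewrite lj act_one.
pose B i := [set y | exists t, sel i t /\ B0 t y].
have mB i : measurable (B i).
  apply: measurable_exists => t; apply: measurable_conj => //.
  exact: measurable_prop.
have L1P p : p \in L1 -> (1%g, p.2) \in L1.
  rewrite /L1 !mem_cat => /orP[pL|/mapP[q qL ->]]; apply/orP; right.
    by apply/mapP; exists p.
  by apply/mapP; exists q.
pose C j := [set y | B (l j).2 (b (l j).1 y)].
have mC j : measurable (C j) by exact: (measurable_act b).
(* In [X] the atom [P t] is covered by its intersections with the translated atoms inside
   [A (l j).2]. Comparing these at most [N] intersections with their counterparts costs [N * del],
   and comparing the atom itself another [del]. *)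
have badP (t : T) j : j \in t -> pr nu (B0 t `\` C j) <= (N + 1) * del.
  move=> jt; have ljL : l j \in L1 by exact: mem_tnth.
  have gF : (l j).1 \in 1%g :: [seq p.1 | p <- L1].
    by rewrite inE map_f ?orbT.
  have mPP s : measurable [set x | P s (a (l j).1 x) /\ P t x].
    by apply: measurable_conj => //; exact: (measurable_act a).
  have mBB s : measurable [set y | B0 s (b (l j).1 y) /\ B0 t y].
    by apply: measurable_conj => //; exact: (measurable_act b).
  have cov : pr mu (P t) <= \sum_(s | sel (l j).2 s)
      pr mu [set x | P s (a (l j).1 x) /\ P t x].
    apply: pr_coverF => // x Px; exists (pat (a (l j).1 x)) => //.
    by apply: Asel; [exact: L1P|exact/(Px j)].
  have pack : \sum_(s | sel (l j).2 s)
      pr nu [set y | B0 s (b (l j).1 y) /\ B0 t y] <= pr nu (B0 t `&` C j).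
    apply: pr_packF => //; first exact: measurableI.
    - by move=> s s' y [Bs _] [Bs' _]; exact: dB0 Bs Bs'.
    - by move=> s ss y [Bs Bt]; split=> //; exists s.
  have cmp : \sum_(s | sel (l j).2 s) pr mu [set x | P s (a (l j).1 x) /\ P t x] -
     \sum_(s | sel (l j).2 s) pr nu [set y | B0 s (b (l j).1 y) /\ B0 t y]
     <= N * del.
    rewrite -sumrB; apply: sum_le_card; first exact: ltW.
    by move=> s _; have := BP _ s t gF; rewrite ltr_norml => /andP[_ /ltW].
  have := BP1 t; rewrite ltr_norml => /andP[H1 _].
  have := prID nu (mB0 t) (mC j).
  rewrite mulrDl mul1r; lra.
exists B; split=> // [i iL|i|W WL mW mW'].
- apply/seteqP; split=> // y [t [/existsP[j /andP[/eqP lj _]] _]].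
  have : l j \in L1 by exact: mem_tnth.
  rewrite lj mem_cat => /orP[H|/mapP[q qL [qi]]].
    by move: iL; rewrite (map_f snd H).
  by move: iL; rewrite qi map_f.
- have c1 : pr nu (B i) <= \sum_(t | sel i t) pr nu (B0 t).
    by apply: pr_coverF => // y [t [st Bt]]; exists t.
  have c2 : \sum_(t | sel i t) pr mu (P t) <= pr mu (A i).
    by apply: pr_packF => // t st x; exact: selA.
  have c3 : \sum_(t | sel i t) pr nu (B0 t) - \sum_(t | sel i t) pr mu (P t)
      <= N * del.
    rewrite -sumrB; apply: sum_le_card; first exact: ltW.
    by move=> t _; have := BP1 t; rewrite ltr_norml => /andP[+ _]; lra.
  have : N * del <= eps.
    by rewrite -delE; apply: ler_wpM2r; [exact: ltW|rewrite /K; nra].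
  lra.
- pose good (t : T) := `[< exists c, W c /\
    forall p, p \in c -> exists j, l j = p /\ j \in t >].
  have c1 : pr mu [set x | exists c, W c /\ forall p, p \in c -> A p.2 (a p.1 x)]
      <= \sum_(t | good t) pr mu (P t).
    apply: pr_coverF => // x [c [Wc cx]]; exists (pat x) => //.
    apply/asboolP; exists c; split=> // p pc.
    have /lP[j lj] : p \in L1 by rewrite mem_cat (WL _ Wc).
    by exists j; split=> //; apply/(patP x); rewrite lj; exact: cx.
  (* A pattern is not automatically realised in [Y]: [B1 t] is the part of [B0 t] on which its
     positive constraints hold. *)
  pose B1 (t : T) := [set y | B0 t y /\ forall j, j \in t -> C j y].
  have mB1 t : measurable (B1 t).
    apply: measurable_conj => //; apply: measurable_forall => j.
    by apply: measurable_imply => //; exact: measurable_prop.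
  have c2 : \sum_(t | good t) pr nu (B1 t) <=
      pr nu [set y | exists c, W c /\ forall p, p \in c -> B p.2 (b p.1 y)].
    apply: pr_packF => //; first by move=> s t y [Bs _] [Bt _]; exact: dB0 Bs Bt.
    move=> t /asboolP[c [Wc ct]] y [_ Cy]; exists c; split=> // p /ct[j [<-]].
    exact: Cy.
  have c3 (t : T) : pr nu (B0 t) <= pr nu (B1 t) + M * ((N + 1) * del).
    rewrite (prID nu (mB0 t) (mB1 t)); apply: lerD.
      by apply: pr_le; [exact: measurableI|by []|move=> y []].
    apply: (le_trans (@pr_coverF _ _ _ nu _ (fun j => j \in t)
      (fun j => B0 t `\` C j) _ _ _ _)).
    + exact: measurableD.
    + by move=> j; exact: measurableD.
    + move=> y [By nB1]; apply: contrapT => H; apply: nB1; split=> // j jt.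
      by apply: contrapT => nC; apply: H; exists j.
    + rewrite /M -[m in m%:R]card_ord; apply: sum_le_card => //.
      by move=> j; exact: badP.
  have c4 : \sum_(t | good t) pr mu (P t) - \sum_(t | good t) pr nu (B1 t) <=
      N * (del + M * ((N + 1) * del)).
    rewrite -sumrB; apply: sum_le_card.
      by apply: addr_ge0; [exact: ltW|exact: mulr_ge0].
    by move=> t _; have := BP1 t; have := c3 t; rewrite ltr_norml => + /andP[_ +]; lra.
  have : N * (del + M * ((N + 1) * del)) <= eps.
    have -> : N * (del + M * ((N + 1) * del)) = N * (1 + M * (N + 1)) * del by ring.
    by rewrite -delE; apply: ler_wpM2r; [exact: ltW|rewrite /K; lra].
  lra.
Qed.

End Approximation.

Section FiniteSupport.
Context (R : realType).

Lemma esum_ord (f : nat -> \bar R) n : (forall i, 0 <= f i)%E ->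
  (\sum_(i < n) f i = \esum_(i in `I_n) f i)%E.
Proof. by move=> f0; rewrite esum_fset ?fsbig_ord. Qed.

Lemma esum_finite (f : nat -> \bar R) n : (forall i, 0 <= f i)%E ->
  (forall i, (n <= i)%N -> f i = 0%E) ->
  (\esum_(i in [set: nat]) f i = \sum_(i < n) f i)%E.
Proof.
move=> f0 fn; rewrite esum_ord // [RHS]esum_mkcond; apply: eq_esum => i _.
by case: ifPn => //; rewrite notin_setE /= => /negP; rewrite -leqNgt => /fn.
Qed.

Lemma le_sum_esum (f : nat -> \bar R) n : (forall i, 0 <= f i)%E ->
  (\sum_(i < n) f i <= \esum_(i in [set: nat]) f i)%E.
Proof.
move=> f0; rewrite esum_ord // esum_mkcond; apply: le_esum => i _.
by case: ifP.
Qed.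

End FiniteSupport.

Section Constraints.
Context (R : realType) (G : groupType) d (X : measurableType d).
Context (mu : probability X R) (a : mp_action G mu).
Context (I : eqType) (el : I -> G) (dom : I -> set X).

(** The validity of a word as a list of membership constraints, the form in which
    [weakly_contained_approx] transfers it. *)
Fixpoint wcons (w : seq (I * bool)) (g : G) : seq (G * I) :=
  if w is l :: w' then ((lsrc el l * g)%g, l.1) :: wcons w' (lel el l * g)%g
  else [::].

Lemma valid_wcons w g x : valid a el dom w (a g x) <->
  forall p, p \in wcons w g -> dom p.2 (a p.1 x).
Proof.
elim: w g => [|l w IHw] g /=; first by split.
rewrite -!act_mul IHw; split=> [[H1 H2] p|H].
  by rewrite inE => /predU1P[->|/H2].
split; first by apply: (H (_, _)); rewrite inE eqxx.
by move=> p pw; apply: H; rewrite inE pw orbT.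
Qed.

End Constraints.

Section Transfer.
Context (R : realType) (G : groupType).
Context d (X : measurableType d) (mu : probability X R) (a : mp_action G mu).
Context d' (Y : measurableType d') (nu : probability Y R) (b : mp_action G nu).
Context (U : nat -> set X) (sepU : separating U).
Hypotheses (free : free_action a) (wc : weakly_contained a b).

Definition wlist n : seq (seq (nat * bool)) :=
  seq.pmap (@unpickle (seq (nat * bool))) (iota 0 n).

Lemma mem_wlist w n : (pickle w < n)%N -> w \in wlist n.
Proof.
move=> wn; rewrite mem_pmap; apply/mapP; exists (pickle w).
  by rewrite mem_iota.
by rewrite pickleK.
Qed.

Lemma wlist_sub m n : (m <= n)%N -> {subset wlist m <= wlist n}.
Proof.
move=> mn w; rewrite !mem_pmap => /mapP[k + ->].
by rewrite mem_iota => /andP[_ km]; apply/map_f; rewrite mem_iota (leq_trans km).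
Qed.

Lemma pr_act_eq g h : g != h -> pr mu [set x | a g x = a h x] = 0.
Proof.
move=> gh; rewrite (_ : mkset _ = [set x | a (h^-1 * g)%g x = x]); last first.
  apply/seteqP; split=> x /=; rewrite act_mul; first by move=> ->; rewrite actK.
  by move=> E; rewrite -[in RHS]E actKV.
rewrite /pr free //; apply: contra_neq gh => E.
by rewrite -[g](mulVKg h) E mulg1.
Qed.

Section Words.
Context (el : nat -> G).

(** The product has to be [f] itself, not merely to move [z] where [f] does. This leaves a condition
    on the sets [dom i] alone, which makes sense for both actions at once. *)
Definition wreach d0 (Z : measurableType d0) (la : probability Z R)
    (c : mp_action G la) (dom : nat -> set Z) (W : seq (seq (nat * bool))) f z :=
  exists w, [/\ w \in W, wprod el w = f & valid c el dom w z].

Lemma measurable_wreach d0 (Z : measurableType d0) (la : probability Z R)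
    (c : mp_action G la) (dom : nat -> set Z) W f :
  (forall i, measurable (dom i)) -> measurable [set z | wreach c dom W f z].
Proof.
move=> mdom; rewrite (_ : mkset _ = [set z | exists w : seq (nat * bool),
    (w \in W /\ wprod el w = f) /\ valid c el dom w z]).
  apply: measurable_exists => w; apply: measurable_conj; first exact: measurable_prop.
  exact: measurable_valid.
by apply/seteqP; split=> z [w]; [case=> ? ? ?|case=> -[? ?] ?]; exists w.
Qed.

Context (dom : nat -> set X) (mdom : forall i, measurable (dom i)).
Hypothesis gen : generating a el dom.

(** Freeness enters here: almost everywhere a word that takes [x] to [a f x] has product [f], so the
    finite lists of words exhaust a conull set. *)
Lemma wreach_limit f eps : 0 < eps ->
  exists n, pr mu (~` [set x | wreach a dom (wlist n) f x]) < eps.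
Proof.
move=> e0; apply: pr_increasing => //.
- by move=> n; exact: measurable_wreach.
- by move=> n x [w [wn wf vw]]; exists w; split=> //; exact: wlist_sub wn.
pose bad w := [set x | wprod el w != f /\ a (wprod el w) x = a f x].
have mbad w : measurable (bad w).
  apply: measurable_conj; first exact: measurable_prop.
  exact: measurable_act_eq sepU _ _.
have mfr : measurable [set x | ~ frel a el dom x (a f x)].
  apply: measurable_not; have := measurable_frel a sepU el mdom 1%g f.
  by congr measurable; apply/seteqP; split=> x /=; rewrite act_one.
have mb : measurable [set x | exists w : seq (nat * bool), bad w x].
  exact: measurable_exists.
apply: (@pr_null_le _ _ _ _ _
   ([set x | ~ frel a el dom x (a f x)] `|` [set x | exists w : seq (nat * bool), bad w x])).
- apply: measurable_forall => n; apply: measurable_not; exact: measurable_wreach.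
- exact: measurableU.
- apply/le_anti; rewrite pr_ge0 andbT; apply: (le_trans (prU_le _ _ _)) => //.
  rewrite gen add0r pr_null_exists // => w; rewrite /bad.
  have [E|nE] := eqVneq (wprod el w) f.
    rewrite (_ : mkset _ = set0) ?pr0 //; apply/seteqP; split=> // x [].
    by [].
  rewrite (_ : mkset _ = [set x | a (wprod el w) x = a f x]) ?pr_act_eq //.
  by apply/seteqP; split=> x //= [].
- move=> x nW; have [fr|] := pselect (frel a el dom x (a f x)); last by left.
  right; have /frelP[w [vw E]] := fr; exists w; split=> //.
  apply/eqP => wf; apply: (nW (pickle w).+1).
  by exists w; split=> //; exact: mem_wlist.
Qed.

Lemma wreach_limit_seq (F : seq G) eps : 0 < eps ->
  exists N, forall f, f \in F ->
    pr mu (~` [set x | wreach a dom (wlist N) f x]) < eps.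
Proof.
move=> e0; elim: F => [|f F [N NP]]; first by exists 0%N.
have [M MP] := wreach_limit f e0.
exists (maxn N M) => h; rewrite inE => hF.
have mono K K' : (K <= K')%N ->
    pr mu (~` [set x | wreach a dom (wlist K') h x]) <=
    pr mu (~` [set x | wreach a dom (wlist K) h x]).
  move=> KK; apply: pr_le; do ?[by apply: measurableC; exact: measurable_wreach].
  by move=> x nK [w [wK wf vw]]; apply: nK; exists w; split=> //; exact: wlist_sub wK.
case/predU1P: hF => [hf|hF].
  by apply: le_lt_trans (mono M _ (leq_maxr _ _)) _; rewrite hf.
by apply: le_lt_trans (mono N _ (leq_maxl _ _)) _; exact: NP.
Qed.

Lemma transfer (r : R) (F : seq G) eps :
  (\esum_(i in [set: nat]) mu (dom i) < r%:E)%E -> 0 < eps ->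
  exists (dom' : nat -> set Y) n W,
    [/\ forall i, measurable (dom' i), forall i, (n <= i)%N -> dom' i = set0,
        (\esum_(i in [set: nat]) nu (dom' i) < r%:E)%E &
        forall f, f \in F -> pr nu [set y | ~ wreach b dom' W f y] < eps].
Proof.
move=> costr e0.
have e20 : 0 < eps / 2 by lra.
have [N NP] := wreach_limit_seq F e20.
pose W := wlist N.
pose L := flatten [seq wcons el w 1%g | w <- W].
(* Only indices met by the words of [W] survive the transfer, so the error per set is paid at most
   [n] times. *)
pose n := (\max_(p <- L) p.2).+1.
have nL i : (n <= i)%N -> i \notin [seq p.2 | p <- L].
  move=> ni; apply/mapP => -[p pL ip]; move: ni; rewrite /n ltnNge ip.
  by rewrite (leq_bigmax_seq _ pL).
have [c cE] : exists c : R, (\esum_(i in [set: nat]) mu (dom i) = c%:E)%E.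
  exists (fine (\esum_(i in [set: nat]) mu (dom i))); rewrite fineK //.
  rewrite ge0_fin_numE ?(lt_trans costr) ?ltry //.
  by apply: esum_ge0.
move: (costr); rewrite cE lte_fin => cr.
(* The strict inequality [c < r] supplies the slack that absorbs the [n] errors in cost; half of
   [eps] was spent on the choice of [W]. *)
pose eps' := Num.min (eps / 2) ((r - c) / (n%:R + 1)).
have n1 : 0 < n%:R + 1 :> R by rewrite addr_gt0 ?ltr0n.
have e'0 : 0 < eps' by rewrite lt_min !divr_gt0 //; lra.
have [B [mB B0 Bc BW]] := weakly_contained_approx wc mdom L e'0.
exists B, n, W; split=> // [i /nL /B0 //||f fF].
- rewrite (@esum_finite _ _ n) => [|i|i /nL /B0 ->]; rewrite ?measure0 //.
  have : (\sum_(i < n) mu (dom i) <= c%:E)%E by rewrite -cE; apply: le_sum_esum.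
  under eq_bigr do rewrite prE //.
  under [in X in _ -> X]eq_bigr do rewrite prE //.
  rewrite !sumEFin lee_fin lte_fin => le1.
  have : \sum_(i < n) pr nu (B i) - \sum_(i < n) pr mu (dom i) <= n%:R * eps'.
    rewrite -sumrB -[n in n%:R]card_ord; apply: sum_le_card; first exact: ltW.
    by move=> i _; have := Bc i; lra.
  have : n%:R * eps' < r - c.
    apply: (@lt_le_trans _ _ ((n%:R + 1) * eps')); first by rewrite mulrDl mul1r ltrDl.
    by rewrite -ler_pdivlMl // mulrC ge_min lexx orbT.
  lra.
- pose Wf := [set c | exists w, [/\ w \in W, wprod el w = f & c = wcons el w 1%g]].
  have WfP d0 (Z : measurableType d0) (la : probability Z R) (k : mp_action G la) D :
      [set z | wreach k D W f z] =
      [set z | exists c, Wf c /\ forall p, p \in c -> D p.2 (k p.1 z)].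
    apply/seteqP; split=> [z [w [wW wf vw]]|z [_ [[w [wW wf ->]] H]]].
      exists (wcons el w 1%g); split; first by exists w.
      by apply/(valid_wcons k); rewrite act_one.
    by exists w; split=> //; rewrite -(act_one k z); exact/valid_wcons.
  have WfL q : Wf q -> {subset q <= L}.
    move=> [w [wW _ ->]] p pw; apply/flattenP; exists (wcons el w 1%g) => //.
    exact: map_f.
  have mX := @measurable_wreach _ _ _ a dom W f mdom.
  have mY := @measurable_wreach _ _ _ b B W f mB.
  have := BW Wf WfL; rewrite -!WfP => /(_ mX mY).
  have := NP f fF; rewrite -/W !prC //.
  have : eps' <= eps / 2 by rewrite ge_min lexx.
  lra.
Qed.

End Words.
End Transfer.

(** * Freeness passes along weak containment *)

Section FreeTransfer.
Context (R : realType) (G : groupType).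
Context d (X : measurableType d) (mu : probability X R) (a : mp_action G mu).
Context d' (Y : measurableType d') (nu : probability Y R) (b : mp_action G nu).
Context (U : nat -> set X) (sepU : separating U).
Context (V : nat -> set Y) (sepV : separating V).
Hypotheses (free : free_action a) (wc : weakly_contained a b).

(** Where [g] moves [x], some separating set changes its value; this cuts [X], up to a null set,
    into sets disjoint from their translates. Finitely many of them transfer to sets that cover most
    of [Y] and hardly meet their translates, whereas a fixed point of [g] in [B i] lies in both. *)
Lemma weakly_contained_free : free_action b.
Proof.
move=> g g1; have mfix : measurable [set y | b g y = y].
  have := measurable_act_eq b sepV g 1%g.
  by congr measurable; apply/seteqP; split=> y /=; rewrite act_one.
suff H e : 0 < e -> pr nu [set y | b g y = y] <= e.
  rewrite prE //; congr EFin; apply/le_anti; rewrite pr_ge0 andbT.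
  by apply/ler_addgt0Pr => e e0; rewrite add0r; exact: H.
move=> e0.
(* The bit chooses between [U] and its complement: [x] is on the chosen side and [a g x] is not. *)
pose W (k : nat) := [set x | if @unpickle (nat * bool)%type k is Some p
  then (U p.1 x <-> is_true p.2) /\ ~ (U p.1 (a g x) <-> is_true p.2) else False].
have mW k : measurable (W k).
  rewrite /W; case: unpickle => [p|]; last exact: measurable_prop.
  apply: measurable_conj; last apply: measurable_not; apply: measurable_iff;
    do ?[exact: measurable_prop | exact: sepU.1 | exact: (measurable_act a g (sepU.1 _))].
have WW k x : W k x -> W k (a g x) -> False.
  by rewrite /W /=; case: unpickle => // p [_ H] [H' _].
have Wcov x : a g x <> x -> exists k, W k x.
  move=> gx; have [k Uk] : exists k, ~ (U k (a g x) <-> U k x).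
    by apply: contrapT => H; apply: gx; apply: sepU.2 => k; apply: contrapT => nH;
      apply: H; exists k.
  have [Ukx|nUkx] := pselect (U k x).
    exists (pickle (k, true)); rewrite /W /= pickleK /=; split; first by split.
    by move=> H; apply: Uk; split=> // _; exact/H.
  exists (pickle (k, false)); rewrite /W /= pickleK /=; split; first by split.
  by move=> H; apply: Uk; split=> // /H.
pose A k := [set x | first (W^~ x) k].
have mA k : measurable (A k) by exact: measurable_first.
have [n nP] : exists n, pr mu (~` [set x | exists k : 'I_n, A k x]) < e / 4.
  apply: pr_increasing => [n|n x [k Ak]||].
  - by apply: measurable_exists => k.
  - by exists (widen_ord (leqnSn n) k).
  - apply: (@pr_null_le _ _ _ _ _ [set x | a g x = x]).
    + apply: measurable_forall => n; apply: measurable_not.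
      by apply: measurable_exists => k.
    + have := measurable_act_eq a sepU g 1%g.
      by congr measurable; apply/seteqP; split=> x /=; rewrite act_one.
    + by rewrite /pr free.
    + move=> x H; apply: contrapT => /Wcov/first_exists[k Ak].
      by apply: (H k.+1); exists ord_max.
  - lra.
have mAn : measurable [set x | exists k : 'I_n, A k x] by apply: measurable_exists => k.
pose N : R := n%:R; have N0 : 0 <= N by exact: ler0n.
(* The uncovered part of [Y] costs at most [e / 4 + N * del], the overlaps another [N * del]. *)
pose del := e / (4 * N + 4).
have del0 : 0 < del by rewrite divr_gt0 //; lra.
have delE : (4 * N + 4) * del = e by rewrite mulrC divfK //; apply/eqP; lra.
have dA (i j : 'I_n) x : A i x -> A j x -> i = j.
  by move=> Ai Aj; apply/val_inj; exact: (first_unique Ai Aj).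
have [B [mB dB BP]] := weakly_contained_disjoint wc [:: 1%g; g]
  (fun i : 'I_n => mA i) dA del0.
have mBn : measurable [set y | exists k : 'I_n, B k y] by apply: measurable_exists.
have c1 : \sum_(i < n) pr nu (B i) <= pr nu [set y | exists k : 'I_n, B k y].
  by apply: pr_packF => // i _ y Bi; exists i.
have c2 : pr mu [set x | exists k : 'I_n, A k x] <= \sum_(i < n) pr mu (A i).
  by apply: pr_coverF => // x [k Ak]; exists k.
have c3 : \sum_(i < n) pr mu (A i) - \sum_(i < n) pr nu (B i) <= N * del.
  rewrite -sumrB /N -[n in n%:R]card_ord; apply: sum_le_card; first exact: ltW.
  move=> i _; have := BP 1%g i i; rewrite inE eqxx => /(_ isT).
  rewrite (_ : [set x | A i (a 1%g x) /\ A i x] = A i); last first.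
    by apply/seteqP; split=> x /=; rewrite act_one; [case|split].
  rewrite (_ : [set x | B i (b 1%g x) /\ B i x] = B i); last first.
    by apply/seteqP; split=> x /=; rewrite act_one; [case|split].
  by rewrite ltr_norml => /andP[_ /ltW].
have c4 : pr nu [set y | b g y = y] <=
    pr nu (~` [set y | exists k : 'I_n, B k y]) +
    \sum_(i < n) pr nu [set y | B i (b g y) /\ B i y].
  have mBB (i : 'I_n) : measurable [set y | B i (b g y) /\ B i y].
    by apply: measurable_conj => //; exact: (measurable_act b).
  have mBBn : measurable [set y | exists i : 'I_n, B i (b g y) /\ B i y].
    exact: measurable_exists.
  apply: (@le_trans _ _ (pr nu (~` [set y | exists k : 'I_n, B k y]) +
      pr nu [set y | exists i : 'I_n, B i (b g y) /\ B i y])); last first.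
    by apply: lerD => //; apply: pr_coverF => // y [i H]; exists i.
  apply: le_trans (prU_le _ (measurableC mBn) mBBn); apply: pr_le => //.
    by apply: measurableU => //; exact: measurableC.
  move=> y /= gy; have [[k Bk]|] := pselect (exists k : 'I_n, B k y); last by left.
  by right; exists k; rewrite gy.
have c5 : \sum_(i < n) pr nu [set y | B i (b g y) /\ B i y] <= N * del.
  rewrite /N -[n in n%:R]card_ord; apply: sum_le_card; first exact: ltW.
  move=> i _; have := BP g i i; rewrite !inE eqxx orbT => /(_ isT).
  rewrite (_ : [set x | A i (a g x) /\ A i x] = set0) ?pr0.
    by rewrite sub0r normrN ger0_norm ?pr_ge0 // => /ltW.
  by apply/seteqP; split=> // x [[/= ? _] [/= ? _]]; exact: (@WW i x).
move: nP c4; rewrite !prC //; nra.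
Qed.

End FreeTransfer.

Section Sums.
Context (R : realType).

Lemma esum_tail (f : nat -> \bar R) (eps : R) : (forall i, 0 <= f i)%E ->
  (\esum_(i in [set: nat]) f i < +oo)%E -> 0 < eps ->
  exists M, (\esum_(i in [set: nat]) (if (i < M)%N then 0%E else f i) <= eps%:E)%E.
Proof.
move=> f0 ffin e0.
have := nneseries_tail_cvg (f := f) (P := xpredT).
rewrite nneseries_esumT // => /(_ ffin (fun k _ => f0 k)) /fine_cvgP[[N1 _ N1P]].
move=> /cvgrPdist_lt/(_ eps e0)[N2 _ N2P].
pose M := maxn N1 N2; exists M.
have := N1P M (leq_maxl _ _); have := N2P M (leq_maxr _ _) => /=.
rewrite sub0r normrN => tl fl.
rewrite -nneseries_esumT; last by move=> i; case: ifP.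
rewrite (_ : (\sum_(0 <= i <oo) _)%E = (\sum_(M <= i <oo) f i)%E).
  by rewrite -(fineK fl) lee_fin; apply/ltW; apply: le_lt_trans tl; exact: ler_norm.
rewrite (@nneseries_split _ _ 0%N M); last by move=> k _; case: ifP.
rewrite add0n big_nat_cond big1 ?add0e.
  rewrite eseries_cond [RHS]eseries_cond; apply: eq_eseriesr => i /=.
  by rewrite ltnNge => ->.
by move=> i; rewrite andbT => /andP[_ ->].
Qed.

Lemma esum_sum_type (I J : countType) (f : I + J -> \bar R) :
  (forall i, 0 <= f i)%E ->
  \esum_(k in [set: I + J]) f k =
  (\esum_(i in [set: I]) f (inl i) + \esum_(j in [set: J]) f (inr j))%E.
Proof.
move=> f0; rewrite (esumID (range inl)) // setTI; congr adde.
  rewrite (@reindex_esum _ _ _ setT (range inl) inl) //.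
  by apply: inj_bij => i j _ _ [].
rewrite (@reindex_esum _ _ _ setT _ (inr : J -> I + J)%type) //.
split=> [j _|i j _ _ []//|[i|j]]; first by split=> // -[].
  by move=> [_ H]; exfalso; apply: H; exists i.
by exists j.
Qed.

End Sums.

(** * Actions of finite cost *)

Section FiniteCost.
Context (R : realType) (G : groupType).
Context d (X : measurableType d) (mu : probability X R) (a : mp_action G mu).
Context d' (Y : measurableType d') (nu : probability Y R) (b : mp_action G nu).
Context (U : nat -> set X) (sepU : separating U).
Context (V : nat -> set Y) (sepV : separating V).
Context (e : nat -> G) (eS : forall g, exists n, e n = g).
Hypotheses (free : free_action a) (wc : weakly_contained a b).

Lemma wreach_frel (el : nat -> G) (dom : nat -> set Y) W f y :
  wreach el b dom W f y -> frel b el dom y (b f y).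
Proof. by move=> [w [_ <- vw]]; apply/frelP; exists w. Qed.

Lemma finite_cost_le (r eta : R) : (action_cost a < r%:E)%E ->
  (action_cost b < +oo)%E -> 0 < eta -> (action_cost b <= (r + eta)%:E)%E.
Proof.
move=> ar bfin eta0.
have [ela [doma [mda gena costa]]] := family_of_cost sepU eS ar.
have [el [dom [mdom gen costb]]] := family_of_cost sepV eS bfin.
have eta20 : 0 < eta / 2 by lra.
(* The transfer handles finitely many generators only. Those beyond [M] may be added whole, which is
   cheap because the total cost is finite. *)
have [M tailM] := esum_tail (fun i => measure_ge0 nu (dom i)) costb eta20.
have M1 : 0 < M%:R + 1 :> R by have := ler0n R M; lra.
have del0 : 0 < eta / 2 / (M%:R + 1) by rewrite divr_gt0.
have [dom' [n [W [mdom' _ cost' WP]]]] :=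
  transfer sepU free wc mda gena [seq el i | i <- iota 0 M] costa del0.
pose D i := [set y | dom i y /\ ~ wreach ela b dom' W (el i) y].
have mW f : measurable [set y | wreach ela b dom' W f y] by exact: measurable_wreach.
have mD i : measurable (D i) by apply: measurable_conj => //; exact: measurable_not (mW _).
pose elF (k : nat + nat) := match k with inl i => ela i | inr i => el i end.
pose domF (k : nat + nat) := match k with inl i => dom' i | inr i => D i end.
have mF k : measurable (domF k) by case: k.
have relS y z : frel b ela dom' y z -> frel b elF domF y z.
  apply: frel_sub => {y z} i y Dy; apply: rst_step.
  by exists (inl i).
have relF y z : frel b el dom y z -> frel b elF domF y z.
  apply: frel_sub => {y z} i y Dy.
  have [Wy|nWy] := pselect (wreach ela b dom' W (el i) y).
    by apply: relS; exact: wreach_frel Wy.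
  by apply: rst_step; exists (inr i).
have genF : generating b elF domF.
  move=> g; have meas (I : countType) (l : I -> G) (D0 : I -> set Y) :
      (forall i, measurable (D0 i)) -> measurable [set y | ~ frel b l D0 y (b g y)].
    move=> mD0; apply: measurable_not; have := measurable_frel b sepV l mD0 1%g g.
    by congr measurable; apply/seteqP; split=> y /=; rewrite act_one.
  apply: (pr_null_le (meas _ _ _ mF) (meas _ _ _ mdom) (gen g)).
  by move=> y nF fr; apply: nF; exact: relF.
apply: (le_trans (action_cost_le sepV eS mF genF)).
rewrite esum_sum_type // EFinD; apply: leeD; first exact: ltW.
rewrite [eta]splitr EFinD.
have split_le i : (nu (D i) <= (if (i < M)%N then nu (D i) else 0) +
    (if (i < M)%N then 0 else nu (dom i)))%E.
  case: ifP => iM; first by rewrite adde0.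
  by rewrite add0e; apply: le_measure; rewrite ?inE // => y [].
apply: (le_trans (le_esum (fun i _ => split_le i))).
rewrite esumD; [|by move=> i _; case: ifP..].
apply: leeD => //.
rewrite (@esum_finite _ _ M); last first.
- by move=> i Mi; rewrite ltnNge Mi.
- by move=> i; case: ifP.
under eq_bigr => i _ do rewrite ltn_ord prE //.
rewrite sumEFin lee_fin.
apply: (@le_trans _ _ (M%:R * (eta / 2 / (M%:R + 1)))); last first.
  by rewrite mulrA ler_pdivrMr //; lra.
rewrite -[M in M%:R * _]card_ord; apply: sum_le_card; first exact: ltW.
move=> i _; apply: (@le_trans _ _ (pr nu [set y | ~ wreach ela b dom' W (el i) y])).
  by apply: pr_le => //; [exact: measurable_not (mW _)|move=> y []].
by apply/ltW/WP; apply/mapP; exists (i : nat); rewrite // mem_iota /= add0n ltn_ord.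
Qed.

Lemma action_cost_real (c : \bar R) :
  (forall r eta : R, (action_cost a < r%:E)%E -> 0 < eta -> (c <= (r + eta)%:E)%E) ->
  (c <= action_cost a)%E.
Proof.
move=> H; apply/lee_addgt0Pr => eps e0.
have a0 : (0 <= action_cost a)%E.
  apply: le_ereal_inf_tmp => _ [Phi _ <-]; exact: nneseries_ge0.
move: H a0; case: (action_cost a) => [r| |] // H _; last by rewrite leey.
have := H (r + eps / 2) (eps / 2); rewrite lte_fin -addrA -splitr EFinD.
by apply; lra.
Qed.

End FiniteCost.

(** * Markers and contraction *)

Section Markers.
Context (R : realType) (G : groupType).
Context d (Y : measurableType d) (nu : probability Y R) (b : mp_action G nu).
Context (V : nat -> set Y) (sepV : separating V).
Context (e : nat -> G) (eS : forall g, exists n, e n = g).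
Hypotheses (free : free_action b) (Ginf : infinite_set [set: G]).

Definition free_part := [set y | forall g, g != 1%g -> b g y <> y].

Lemma free_partE : free_part = [set y | forall k, e k != 1%g -> ~ b (e k) y = b 1%g y].
Proof.
apply/seteqP; split=> y H; first by move=> k k1; rewrite act_one; exact: H.
by move=> g; have [k <-] := eS g => /H; rewrite act_one.
Qed.

Lemma measurable_free_part : measurable free_part.
Proof.
rewrite free_partE; apply: measurable_forall => k; apply: measurable_imply.
  exact: measurable_prop.
exact/measurable_not/(measurable_act_eq b sepV).
Qed.

Lemma pr_free_part : pr nu (~` free_part) = 0.
Proof.
have mE k : measurable [set y | e k != 1%g /\ b (e k) y = b 1%g y].
  by apply: measurable_conj; [exact: measurable_prop|exact: (measurable_act_eq b sepV)].
rewrite (_ : ~` _ = [set y | exists k, e k != 1%g /\ b (e k) y = b 1%g y]).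
  apply: pr_null_exists => // k.
  have [k1|k1] := eqVneq (e k) 1%g.
    by rewrite [X in pr _ X](_ : _ = set0) ?pr0 //; apply/seteqP; split=> // y [].
  rewrite [X in pr _ X](_ : _ = [set y | b (e k) y = y]); first by rewrite /pr free.
  by apply/seteqP; split=> y; rewrite /= act_one; [case|split].
rewrite free_partE; apply/seteqP; split=> y.
  move=> H; apply: contrapT => nH; apply: H => k k1 E.
  by apply: nH; exists k.
by move=> [k [k1 E]] H; exact: H E.
Qed.

Lemma free_part_act g y : free_part y -> free_part (b g y).
Proof.
move=> fy h h1 E; apply: (fy (g^-1 * h * g)%g).
  apply: contra h1 => /eqP E1; apply/eqP.
  have -> : h = (g * (g^-1 * h * g) * g^-1)%g by rewrite !mulgA mulgV mul1g mulgK.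
  by rewrite E1 mulg1 mulgV.
by rewrite !act_mul E actK.
Qed.

Lemma free_part_inj y g h : free_part y -> b g y = b h y -> g = h.
Proof.
move=> fy E; apply: contrapT => /eqP gh; apply: (fy (h^-1 * g)%g).
  by apply: contra gh => /eqP E1; rewrite -[g](mulVKg h) E1 mulg1.
by rewrite act_mul E actK.
Qed.

(* The maximal [H]-independent set is built greedily along countably many
   independent sets that cover the free part. *)
Lemma maximal_independent (H : seq G) : 1%g \notin H ->
  (forall h, h \in H -> (h^-1)%g \in H) ->
  exists A : set Y, [/\ measurable A,
    forall y h, h \in H -> A y -> ~ A (b h y) &
    forall y, free_part y -> A y \/ exists2 h, h \in H & A (b h y)].
Proof.
move=> H1 HV.
(* Cylinders of the separating family. [W n] is a cylinder without the points that some [h] in [H]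
   keeps inside it. Such sets are independent, and they cover the free part because each further [h]
   is excluded by one more coordinate. *)
pose C (s : seq (nat * bool)) := [set y | forall p, p \in s -> (V p.1 y <-> is_true p.2)].
have mC s : measurable (C s).
  apply: measurable_forall => p; apply: measurable_imply; first exact: measurable_prop.
  by apply: measurable_iff; [exact: sepV.1|exact: measurable_prop].
pose W n := [set y | if @unpickle (seq (nat * bool)) n is Some s
  then C s y /\ forall h, h \in H -> ~ C s (b h y) else False].
have mall (P : G -> set Y) : (forall h, measurable (P h)) ->
    measurable [set y | forall h, h \in H -> P h y].
  move=> mP; rewrite (_ : mkset _ = [set y | forall k, e k \in H -> P (e k) y]).
    by apply: measurable_forall => k; apply: measurable_imply => //; exact: measurable_prop.
  by apply/seteqP; split=> y Hy h; [exact: Hy|have [k <-] := eS h; exact: Hy].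
have mW n : measurable (W n).
  rewrite /W; case: unpickle => [s|]; last exact: measurable_prop.
  apply: measurable_conj => //; apply: mall => h; apply: measurable_not.
  exact: (measurable_act b).
have WW n y h : h \in H -> W n y -> ~ W n (b h y).
  by move=> hH; rewrite /W /mkset; case: unpickle => // s [_ /(_ h hH) nC] [].
have Wcov y : free_part y -> exists n, W n y.
  move=> fy; suff [s sP] : exists s, C s y /\ forall h, h \in H -> ~ C s (b h y).
    by exists (pickle s); rewrite /W /mkset pickleK.
  elim: H H1 {HV mall W mW WW} => [|h K IH]; first by exists [::].
  rewrite inE negb_or => /andP[h1 /IH[s [Cs sP]]].
  have [k Vk] : exists k, ~ (V k (b h y) <-> V k y).
    apply: contrapT => nk; apply: (fy h); first by rewrite eq_sym.
    by apply: sepV.2 => k; apply: contrapT => nV; apply: nk; exists k.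
  exists ((k, `[< V k y >]) :: s); split.
    move=> p; rewrite inE => /predU1P[->|/Cs //] /=.
    by split=> [/asboolP|/asboolP].
  move=> g; rewrite inE => /predU1P[->|gK] CC.
    apply: Vk; have := CC (k, `[< V k y >]); rewrite inE eqxx => /(_ isT) /= ->.
    by split=> /asboolP.
  by apply: (sP g gK) => p ps; apply: CC; rewrite inE ps orbT.
pose fix M n : set Y := if n is n'.+1 then
  M n' `|` (W n' `&` [set y | forall h, h \in H -> ~ M n' (b h y)]) else set0.
have mM n : measurable (M n).
  elim: n => [|n IHn] /=; first exact: measurable0.
  apply: measurableU => //; apply: measurableI => //; apply: mall => h.
  by apply: measurable_not; exact: (measurable_act b).
have Mle m n : (m <= n)%N -> M m `<=` M n.
  elim: n => [|n IHn]; first by rewrite leqn0 => /eqP ->.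
  by rewrite leq_eqVlt => /predU1P[-> //|mn] y My; left; exact: IHn My.
have indep n y h : h \in H -> M n y -> ~ M n (b h y).
  move=> hH; elim: n => [|n IHn] //= [My|[Wy nM]] [Mh|[Wh nMh]].
  - exact: IHn.
  - by apply: (nMh _ (HV _ hH)); rewrite actK.
  - exact: (nM h).
  - exact: (WW n y h).
exists [set y | exists n, M n y]; split.
- exact: measurable_exists.
- move=> y h hH [m Mm] [n Mn]; apply: (indep (maxn m n) y h hH).
    exact: Mle (leq_maxl _ _) _ Mm.
  exact: Mle (leq_maxr _ _) _ Mn.
- move=> y /Wcov[n Wn].
  have [[h hH Mh]|nM] := pselect (exists2 h, h \in H & M n (b h y)).
    by right; exists h => //; exists n.
  left; exists n.+1; right; split=> // h hH Mh; apply: nM.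
  by exists h.
Qed.

(** For [F] with more than [1 / eps] elements and [H] the nontrivial quotients of [F], an
    [H]-independent set has disjoint translates under [F], hence small measure. Maximality brings
    every free point into it by an element of [H]; the null set of other points is added. That one
    finite [H] serves all points is what later allows an approximate graphing to realise it. *)
Lemma markers eps : 0 < eps -> exists (A : set Y) (H : seq G),
  [/\ measurable A, pr nu A < eps & forall y, exists2 h, h \in H & A (b h y)].
Proof.
move=> e0.
have [N _ /(_ N (leqnn N)) Ne] := near_infty_natSinv_lt (PosNum e0).
have [B _ cardB] := infinite_set_fset N.+1 Ginf.
pose F : seq G := finmap.enum_fset B.
have uF : uniq F by exact: finmap.fset_uniq.
have sF : (N.+1 <= size F)%N by [].
pose H := [seq h <- [seq (g^-1 * f)%g | g <- F, f <- F] | h != 1%g].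
have HP h : h \in H -> (h^-1)%g \in H.
  rewrite !mem_filter => /andP[h1 /allpairsP[[g f] [gF fF E]]].
  rewrite invg_eq1 h1 /=; apply/allpairsP; exists (f, g); split=> //=.
  by rewrite E /= invgM invgK.
have H1 : 1%g \notin H by rewrite mem_filter eqxx.
have [A [mA indA maxA]] := maximal_independent H1 HP.
have prA : pr nu A < eps.
  have : \sum_(f <- F) pr nu [set y | A (b f^-1%g y)] <= pr nu setT.
    apply: pr_pack => //; [by move=> f _; exact: (measurable_act b)|].
    move=> f g y fF gF Af Ag; apply: contrapT => /eqP fg.
    apply: (indA _ (g^-1 * f)%g _ Af); last by rewrite -act_mul mulgK.
    rewrite mem_filter; apply/andP; split; last first.
      by apply/allpairsP; exists (g, f).
    by apply: contra fg => /eqP E; rewrite -[f](mulVKg g) E mulg1.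
  under eq_bigr do rewrite (pr_act b _ mA).
  rewrite big_const_seq count_predT iter_addr_0 prT => sle.
  have : pr nu A *+ N.+1 <= 1.
    by apply: le_trans sle; apply: ler_wpMn2l => //; exact: pr_ge0.
  rewrite -mulr_natr -ler_pdivlMr ?ltr0n // mul1r => H2.
  by apply: le_lt_trans H2 Ne.
exists (A `|` ~` free_part), (1%g :: H); split.
- by apply: measurableU => //; apply: measurableC; exact: measurable_free_part.
- apply: le_lt_trans prA; rewrite -[leRHS]addr0 -pr_free_part; apply: prU_le => //.
  by apply: measurableC; exact: measurable_free_part.
- move=> y; have [fy|nfy] := pselect (free_part y).
    have [Ay|[h hH Ah]] := maxA y fy.
      by exists 1%g; rewrite ?inE ?eqxx // act_one; left.
    by exists h; [rewrite inE hH orbT|left].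
  by exists 1%g; rewrite ?inE ?eqxx // act_one; right.
Qed.

End Markers.

(** Letters are numbered so that a least one can be chosen. *)
Definition letter (k : nat) : nat * bool := (k./2, odd k).
Definition code (i : nat) (s : bool) : nat := (s + i.*2)%N.

Lemma letterK i s : letter (code i s) = (i, s).
Proof. by rewrite /letter /code half_bit_double oddD odd_double addbF oddb. Qed.

Lemma codeK k : code (letter k).1 (letter k).2 = k.
Proof. exact: odd_double_half. Qed.

Section Contraction.
Context (R : realType) (G : groupType).
Context d (Y : measurableType d) (nu : probability Y R) (b : mp_action G nu).
Context (e : nat -> G) (eS : forall g, exists n, e n = g).
Context (el : nat -> G) (dom : nat -> set Y) (A : set Y).
Hypotheses (mdom : forall i, measurable (dom i)) (mA : measurable A).
Hypothesis complete : forall y, exists z, A z /\ frel b el dom y z.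

(* [lv n]: the points at distance at most [n] from [A] in the graphing;
   [depth n]: those at distance exactly [n]. *)
Fixpoint lv n : set Y := if n is n'.+1 then
  lv n' `|` [set y | exists k, dom (letter k).1 (b (lsrc el (letter k)) y) /\
                               lv n' (b (lel el (letter k)) y)] else A.

Definition depth n := [set y | first (lv^~ y) n].

Definition cand n k := [set y | dom (letter k).1 (b (lsrc el (letter k)) y) /\
                                lv n (b (lel el (letter k)) y)].

(* [y] is at distance [n.+1] from [A], and the letter [k] is the chosen first
   step of a shortest path to [A]. *)
Definition chosen n k := [set y | depth n.+1 y /\ first ((cand n)^~ y) k].

(* [root n g y]: [y] has depth [n] and the chosen path to [A] ends at [b g y]. *)
Fixpoint root n (g : G) : set Y := if n is n'.+1 then
  [set y | exists k, chosen n' k y /\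
     root n' (g * (lel el (letter k))^-1)%g (b (lel el (letter k)) y)]
  else [set y | A y /\ g = 1%g].

Lemma measurable_lv n : measurable (lv n).
Proof.
elim: n => [|n IHn] //=; apply: measurableU => //; apply: measurable_exists => k.
by apply: measurable_conj; exact: measurable_act.
Qed.

Lemma measurable_depth n : measurable (depth n).
Proof. by apply: measurable_first => k; exact: measurable_lv. Qed.

Lemma measurable_chosen n k : measurable (chosen n k).
Proof.
apply: measurable_conj; first exact: measurable_depth.
apply: measurable_first => j; apply: measurable_conj; apply: measurable_act => //.
exact: measurable_lv.
Qed.

Lemma measurable_root n g : measurable (root n g).
Proof.
elim: n g => [|n IHn] g /=; first by apply: measurable_conj; [|exact: measurable_prop].
apply: measurable_exists => k; apply: measurable_conj; first exact: measurable_chosen.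
exact: (measurable_act b _ (IHn _)).
Qed.

Lemma depth_exists y : exists n, depth n y.
Proof.
apply: first_exists; have [z [Az /frelP[w [vw wz]]]] := complete y.
exists (size w); move: Az; rewrite -{z}wz; elim: w y vw => [|[i s] w IHw] y /=.
  by rewrite act_one.
move=> [Di vw]; rewrite act_mul => /(IHw _ vw) H; right; exists (code i s).
by rewrite letterK /= /code half_bit_double; split.
Qed.

Lemma depth_unique m n y : depth m y -> depth n y -> m = n.
Proof. by move=> dm dn; exact: (first_unique dm dn). Qed.

Lemma chosen_depth n k y : chosen n k y -> depth n (b (lel el (letter k)) y).
Proof.
move=> [[_ dy] [[Dk ln] _]]; split=> // m mn lm.
apply: (dy m.+1) => //; right; exists k; split=> //.
Qed.

Lemma chosen_exists n y : depth n.+1 y -> exists k, chosen n k y.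
Proof.
move=> dy; have [k fk] : exists k, first ((cand n)^~ y) k.
  apply: first_exists; have [[lny|[k [Dk lk]]] H] := dy; last by exists k.
  by case: (H n (ltnSn n)).
by exists k.
Qed.

Lemma root_depth n g y : root n g y -> depth n y.
Proof.
by case: n => [[Ay _]|n [k [[dy _] _]]] //; split.
Qed.

Lemma root_exists n y : depth n y -> exists g, root n g y.
Proof.
elim: n y => [|n IHn] y dy; first by exists 1%g; split=> //; case: dy.
have [k ck] := chosen_exists dy; have [g rg] := IHn _ (chosen_depth ck).
by exists (g * lel el (letter k))%g, k; rewrite mulgK.
Qed.

Lemma root_unique n g h y : root n g y -> root n h y -> g = h.
Proof.
elim: n g h y => [|n IHn] g h y; first by move=> [_ ->] [_ ->].
move=> [k [[_ fk] rk]] [j [[_ fj] rj]]; have E := first_unique fk fj.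
by rewrite -{j fj}E in rj; have /mulIg := IHn _ _ _ rk rj.
Qed.

Definition Root g := [set y | exists n, root n g y].

Lemma measurable_Root g : measurable (Root g).
Proof. by apply: measurable_exists => n; exact: measurable_root. Qed.

Lemma Root_exists y : exists g, Root g y.
Proof.
have [n dn] := depth_exists y; have [g rg] := root_exists dn.
by exists g, n.
Qed.

Lemma Root_unique g h y : Root g y -> Root h y -> g = h.
Proof.
move=> [m rm] [n rn]; have E := depth_unique (root_depth rm) (root_depth rn).
by rewrite -{n}E in rn; exact: root_unique rm rn.
Qed.

Lemma chosen_Root n k y g h :
  chosen n k y -> Root g y -> Root h (b (lel el (letter k)) y) ->
  g = (h * lel el (letter k))%g.
Proof.
move=> ck [m rm] Rh; have E : m = n.+1 := depth_unique (root_depth rm) ck.1.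
rewrite {m}E in rm; have [j [cj rj]] := rm.
have E := first_unique cj.2 ck.2; rewrite {j cj}E in rj.
have : Root (g * (lel el (letter k))^-1)%g (b (lel el (letter k)) y) by exists n.
by move=> /(Root_unique Rh) ->; rewrite mulgVK.
Qed.

(** The edges of the forest, each owned by the end that is farther from [A]: its source in
    [used_fwd], its target in [used_bwd]. The latter is thus a set of targets, and [used] pulls it
    back to sources. *)
Definition used_fwd i := [set x | exists n, chosen n (code i true) x].
Definition used_bwd i := [set x | exists n, chosen n (code i false) x].
Definition used i := used_fwd i `|` [set x | used_bwd i (b (el i) x)].

Lemma measurable_used_fwd i : measurable (used_fwd i).
Proof. by apply: measurable_exists => n; exact: measurable_chosen. Qed.

Lemma measurable_used_bwd i : measurable (used_bwd i).
Proof. by apply: measurable_exists => n; exact: measurable_chosen. Qed.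

Lemma measurable_used i : measurable (used i).
Proof.
apply: measurableU; first exact: measurable_used_fwd.
exact: (measurable_act b _ (measurable_used_bwd i)).
Qed.

Lemma used_fwd_dom i : used_fwd i `<=` dom i.
Proof. by move=> x [n [_ [[+ _] _]]]; rewrite letterK /lsrc /= act_one. Qed.

Lemma used_bwd_dom i x : used_bwd i (b (el i) x) -> dom i x.
Proof. by move=> [n [_ [[+ _] _]]]; rewrite letterK /lsrc /= actK. Qed.

(** A chosen step lowers the depth by one, so no edge is chosen from both its ends. *)
Lemma used_disjoint i x : used_fwd i x -> ~ used_bwd i (b (el i) x).
Proof.
move=> [m cm] [n cn]; have := chosen_depth cm; have := chosen_depth cn.
rewrite !letterK /lel /= actK => /depth_unique/(_ cm.1) nm /depth_unique/(_ cn.1) mn.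
by move: nm; rewrite mn => /eqP; rewrite -addn2 -[X in X == _]addn0 eqn_add2l.
Qed.

Lemma pr_used i : pr nu (used_fwd i) + pr nu (used_bwd i) = pr nu (dom i `&` used i).
Proof.
rewrite -(pr_act b (el i) (measurable_used_bwd i)) -prU.
- congr pr; apply/seteqP; split=> [x H|x []//]; split=> //.
  by case: H => [/used_fwd_dom|/used_bwd_dom].
- exact: measurable_used_fwd.
- exact: (measurable_act b _ (measurable_used_bwd i)).
- by move=> x; exact: used_disjoint.
Qed.

(** The enumeration [e] may repeat; keeping least indices only prevents a group element from being
    counted twice. *)
Definition canonical p := first (fun q => e q = e p) p.

Lemma canonical_exists g : exists2 p, canonical p & e p = g.
Proof.
have [p [ep Hp]] := first_exists (eS g); exists p => //; split=> //.
by move=> j jp; rewrite ep; exact: Hp.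
Qed.

Lemma canonical_inj p q : canonical p -> canonical q -> e p = e q -> p = q.
Proof. by move=> cp cq E; apply: (first_unique cp); rewrite /canonical -E in cq. Qed.

Definition cel (p : nat * (nat * nat)) := (e p.2.2 * el p.1 * (e p.2.1)^-1)%g.

Definition cpiece (p : nat * (nat * nat)) := [set x | (dom p.1 `\` used p.1) x /\
  ((canonical p.2.1 /\ canonical p.2.2) /\
   (Root (e p.2.1) x /\ Root (e p.2.2) (b (el p.1) x)))].

Definition cdom (p : nat * (nat * nat)) := [set z | cpiece p (b (e p.2.1)^-1%g z)].

Lemma measurable_cpiece p : measurable (cpiece p).
Proof.
apply: measurable_conj; first by apply: measurableD => //; exact: measurable_used.
apply: measurable_conj; first exact: measurable_prop.
apply: measurable_conj; first exact: measurable_Root.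
exact: (measurable_act b _ (measurable_Root _)).
Qed.

Lemma measurable_cdom p : measurable (cdom p).
Proof. exact: (measurable_act b _ (measurable_cpiece p)). Qed.

Lemma contraction_frel x y : A x -> A y -> frel b el dom x y -> frel b cel cdom x y.
Proof.
move=> Ax Ay xy; have RA z : A z -> Root 1%g z by move=> Az; exists 0%N.
(* The invariant speaks of roots, so that the induction can pass through points outside [A]; points
   of [A] are their own roots. A forest edge joins points with the same root and contracts to
   nothing. *)
suff H g h : Root g x -> Root h y -> frel b cel cdom (b g x) (b h y).
  by have := H _ _ (RA _ Ax) (RA _ Ay); rewrite !act_one.
move=> {Ax Ay}; elim: xy g h => {x y} [x y [i [Di <-]]|x|x y _ IH|x y z _ IH1 _ IH2] g h Rg Rh.
- have [[[n cn]|[n cn]]|nu_] := pselect (used i x).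
  + have := chosen_Root (h := h) cn Rg; rewrite letterK /lel /= => /(_ Rh) ->.
    by rewrite act_mul; exact: rst_refl.
  + have := chosen_Root (h := g) cn Rh; rewrite letterK /lel /= actK => /(_ Rg) ->.
    by rewrite act_mul actK; exact: rst_refl.
  + have [p cp ep] := canonical_exists g; have [q cq eq] := canonical_exists h.
    apply: rst_step; exists (i, (p, q)); split.
      by rewrite /cdom /= ep actK /cpiece /= ep eq.
    by rewrite /cel /= ep eq !act_mul actK.
- by rewrite (Root_unique Rg Rh); exact: rst_refl.
- by apply: rst_sym; exact: IH.
- have [k Rk] := Root_exists y; apply: (@rst_trans _ _ _ (b k y)).
    exact: IH1.
  exact: IH2.
Qed.

Lemma contraction_cost :
  (\esum_(p in [set: nat * (nat * nat)]) nu (cdom p) + (1 - pr nu A)%:E <=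
   \esum_(i in [set: nat]) nu (dom i))%E.
Proof.
rewrite (_ : \esum_(i in setT) nu (dom i) =
    (\esum_(i in [set: nat]) nu (dom i `\` used i) +
     \esum_(i in [set: nat]) nu (dom i `&` used i))%E); last first.
  rewrite -esumD //; apply: eq_esum => i _.
  rewrite !prE //; do ?[apply: measurableD|apply: measurableI] => //; do ?exact: measurable_used.
  by rewrite -EFinD addrC -prID //; exact: measurable_used.
apply: leeD.
  rewrite -setXTT -(@esum_esum _ _ _ setT (fun _ => setT) (fun i q => nu (cdom (i, q)))) //.
  apply: le_esum => i _.
  rewrite (eq_esum (b := fun q => nu (cpiece (i, q)))); last first.
    move=> q _; rewrite !prE; [|exact: measurable_cpiece|exact: measurable_cdom].
    by rewrite (pr_act b _ (measurable_cpiece _)).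
  apply: esum_disjoint_le => [|q|q q' x|q x []//].
  - by apply: measurableD => //; exact: measurable_used.
  - exact: measurable_cpiece.
  - move=> [_ [[c1 c2] [R1 R2]]] [_ [[c1' c2'] [R1' R2']]].
    move: q q' c1 c2 R1 R2 c1' c2' R1' R2' => [p q] [p' q'] /= c1 c2 R1 R2 c1' c2' R1' R2'.
    by rewrite (canonical_inj c1 c1' (Root_unique R1 R1'))
               (canonical_inj c2 c2' (Root_unique R2 R2')).
rewrite (eq_esum (b := fun i => nu (used_fwd i) + nu (used_bwd i)))%E; last first.
  move=> i _; rewrite !prE -?EFinD ?pr_used //.
  - exact: measurable_used_bwd.
  - exact: measurable_used_fwd.
  - by apply: measurableI => //; exact: measurable_used.
pose F (k : nat + nat) := match k with inl i => used_fwd i | inr i => used_bwd i end.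
have mF k : measurable (F k).
  by case: k => i; [exact: measurable_used_fwd|exact: measurable_used_bwd].
rewrite esumD // -(@esum_sum_type _ _ _ (fun k => nu (F k))) //.
apply: le_trans (pr_esum_le nu mF).
rewrite -prC // -prE; last exact: measurableC.
apply: le_measure; rewrite ?inE; [exact: measurableC|exact: measurable_exists|].
move=> y nAy; have [[|n] dn] := depth_exists y; first by case: dn.
have [k ck] := chosen_exists dn; move: ck; rewrite -(codeK k).
by case: (letter k) => i [] /= ck; [exists (inl i)|exists (inr i)]; exists n.
Qed.

End Contraction.

(** * Cost one *)

Section CostOne.
Context (R : realType) (G : groupType).
Context d (Y : measurableType d) (nu : probability Y R) (b : mp_action G nu).
Context (V : nat -> set Y) (sepV : separating V).
Context (e : nat -> G) (eS : forall g, exists n, e n = g).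

Lemma contraction (el : nat -> G) (dom : nat -> set Y) (A : set Y) :
  (forall i, measurable (dom i)) -> measurable A ->
  (forall y, exists z, A z /\ frel b el dom y z) ->
  exists (elT : nat -> G) (domT : nat -> set Y),
    [/\ forall i, measurable (domT i),
        forall x y, A x -> A y -> frel b el dom x y -> frel b elT domT x y &
        (\esum_(i in [set: nat]) nu (domT i) + (1 - pr nu A)%:E <=
         \esum_(i in [set: nat]) nu (dom i))%E].
Proof.
move=> mdom mA complete.
exists (nat_el (cel e el)), (nat_dom (cdom b e el dom A)); split.
- by move=> i; apply: measurable_nat_dom => p; exact: measurable_cdom.
- move=> x y Ax Ay xy; apply/frel_nat_family.
  exact: contraction_frel.
- by rewrite nat_family_cost; exact: contraction_cost.
Qed.

Lemma measurable_frel1 (I : countType) (el : I -> G) (dom : I -> set Y) g :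
  (forall i, measurable (dom i)) -> measurable [set y | frel b el dom y (b g y)].
Proof.
move=> mdom; have := measurable_frel b sepV el mdom 1%g g.
by congr measurable; apply/seteqP; split=> y /=; rewrite act_one.
Qed.

(** A family of cost [c < 1] could be contracted onto a complete section of measure less than
    [1 - c], saving more than it costs. *)
Lemma action_cost_ge1 : free_action b -> infinite_set [set: G] ->
  (1 <= action_cost b)%E.
Proof.
move=> free Ginf; rewrite leNgt; apply/negP => b1.
have [el [dom [mdom gen cost1]]] := family_of_cost sepV eS b1.
have [c cE] : exists c : R, (\esum_(i in [set: nat]) nu (dom i) = c%:E)%E.
  exists (fine (\esum_(i in [set: nat]) nu (dom i))); rewrite fineK //.
  by rewrite ge0_fin_numE ?(lt_trans cost1) ?ltry //; exact: esum_ge0.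
move: cost1; rewrite cE lte_fin => c1.
have c10 : 0 < 1 - c by lra.
have [A0 [H [mA0 prA0 A0P]]] := markers sepV eS free Ginf c10.
(* Contraction asks every point to be connected to the section; the null set where generation fails
   is put into the section. *)
pose N := [set y | exists k, ~ frel b el dom y (b (e k) y)].
have mNk k : measurable [set y | ~ frel b el dom y (b (e k) y)].
  by apply: measurable_not; exact: measurable_frel1.
have mN : measurable N by exact: measurable_exists.
have prN : pr nu N = 0 by apply: pr_null_exists => // k; exact: gen.
have mA : measurable (A0 `|` N) by exact: measurableU.
have complete y : exists z, (A0 `|` N) z /\ frel b el dom y z.
  have [Ny|nNy] := pselect (N y).
    by exists y; split; [right|exact: rst_refl].
  have [h _ Ah] := A0P y; exists (b h y); split; first by left.
  have [k <-] := eS h; apply: contrapT => nf; apply: nNy.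
  by exists k.
have [elT [domT [_ _]]] := contraction mdom mA complete.
rewrite cE => le_c.
have : ((1 - pr nu (A0 `|` N))%:E <= c%:E)%E.
  apply: le_trans le_c; rewrite -[leLHS]add0e; apply: leeD => //.
  by apply: esum_ge0.
rewrite lee_fin; have := prU_le nu mA0 mN; rewrite prN; lra.
Qed.

End CostOne.

Section CostOneUpper.
Context (R : realType) (G : groupType).
Context d (X : measurableType d) (mu : probability X R) (a : mp_action G mu).
Context d' (Y : measurableType d') (nu : probability Y R) (b : mp_action G nu).
Context (U : nat -> set X) (sepU : separating U).
Context (V : nat -> set Y) (sepV : separating V).
Context (e : nat -> G) (eS : forall g, exists n, e n = g).
Hypotheses (free : free_action a) (wc : weakly_contained a b).
Hypothesis Ginf : infinite_set [set: G].

Lemma good_graphing (r : R) (F : seq G) eps :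
  (action_cost a < r%:E)%E -> 0 < eps ->
  exists S : (nat -> G) * (nat -> set Y),
    [/\ forall i, measurable (S.2 i),
        (\esum_(i in [set: nat]) nu (S.2 i) < r%:E)%E &
        forall f, f \in F -> pr nu [set y | ~ frel b S.1 S.2 y (b f y)] < eps].
Proof.
move=> ar e0.
have [ela [doma [mda gena costa]]] := family_of_cost sepU eS ar.
have [dom' [n [W [mdom' _ cost' WP]]]] := transfer sepU free wc mda gena F costa e0.
exists (ela, dom'); split=> // f /WP; apply: le_lt_trans.
apply: pr_le.
- by apply: measurable_not; exact: (measurable_frel1 b sepV).
- by apply: measurable_not; exact: measurable_wreach.
- by move=> y nf /wreach_frel.
Qed.

Lemma cost_one_upper eta : action_cost a = 1%E -> 0 < eta ->
  (action_cost b <= (1 + eta)%:E)%E.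
Proof.
move=> a1 eta0; have freeb := weakly_contained_free sepU sepV free wc.
(* The final 4 pays at stage [n] for the excess cost of [S n.+1], the markers, and the bad sets of
   two graphings. The sum over all stages is then [eta / 2]. *)
pose eps n : R := eta / 2 / (2 ^ n.+1)%:R / 4.
have eps0 n : 0 < eps n by rewrite !divr_gt0 // ltr0n expn_gt0.
have epsS n : eps n.+1 <= eps n.
  rewrite /eps ler_pM2r ?invr_gt0 // ler_pM2l ?divr_gt0 // lef_pV2 ?posrE ?ltr0n ?expn_gt0 //.
  by rewrite ler_nat leq_exp2l.
have M_ex n : exists p : set Y * seq G, [/\ measurable p.1, pr nu p.1 < eps n &
    forall y, exists2 h, h \in p.2 & p.1 (b h y)].
  have [A [H [mA prA AP]]] := markers sepV eS freeb Ginf (eps0 n).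
  by exists (A, H).
have [M MP] := choice M_ex.
pose A n := (M n).1; pose H n := (M n).2.
(* Large enough that the defects [del n] over [H n], or over [H n.-1], add up to at most [eps n],
   and that [del n <= eps n]. *)
pose K n : R := (size (H n))%:R + (size (H n.-1))%:R + 1 + n%:R.
have K1 n : 1 <= K n.
  rewrite /K; have := ler0n R (size (H n)); have := ler0n R (size (H n.-1)).
  have := ler0n R n; lra.
have K0 n : 0 < K n by apply: lt_le_trans (K1 n).
pose del n := eps n / K n.
have del0 n : 0 < del n by rewrite divr_gt0.
(* [H n] has to be realised by both [S n] and [S n.+1], whence [H n.-1]; the initial segment of [e]
   makes the union generate. *)
pose F n := H n ++ H n.-1 ++ [seq e i | i <- iota 0 n].
have S_ex n : exists S : (nat -> G) * (nat -> set Y),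
    [/\ forall i, measurable (S.2 i),
        (\esum_(i in [set: nat]) nu (S.2 i) < (1 + eps n)%:E)%E &
        forall f, f \in F n -> pr nu [set y | ~ frel b S.1 S.2 y (b f y)] < del n].
  by apply: good_graphing => //; rewrite a1 lte_fin ltrDl.
have [S SP] := choice S_ex.
have mS n i : measurable ((S n).2 i) by have [+ _ _] := SP n; apply.
pose E n := frel b (S n).1 (S n).2.
have mE n g : measurable [set y | E n y (b g y)] by apply: (measurable_frel1 b sepV).
pose good n h y := E n y (b h y) /\ E n.+1 y (b h y).
have mgood n h : measurable [set y | ~ good n h y].
  exact: (measurable_not (measurable_conj (mE n h) (mE n.+1 h))).
pose bad n := [set y | exists i : 'I_(size (H n)), ~ good n (nth 1%g (H n) i) y].
have mbad n : measurable (bad n) by apply: measurable_exists => i; exact: mgood.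
have prbad n : pr nu (bad n) <= eps n + eps n.+1.
  apply: (@le_trans _ _ ((size (H n))%:R * (del n + del n.+1))).
    apply: (le_trans (@pr_coverF _ _ _ nu _ xpredT
      (fun i : 'I_(size (H n)) => [set y | ~ good n (nth 1%g (H n) i) y]) _ _ _ _)) => //.
      by move=> y [i]; exists i.
    rewrite -[X in X%:R * _]card_ord; apply: sum_le_card.
      by rewrite addr_ge0 // ltW.
    move=> i _; set h := nth _ _ _; have hH : h \in H n by exact: mem_nth.
    have [_ _ /(_ h) +] := SP n; rewrite mem_cat hH => /(_ isT) H1.
    have [_ _ /(_ h) +] := SP n.+1; rewrite !mem_cat hH orbT => /(_ isT) H2.
    apply: (le_trans _ (lerD (ltW H1) (ltW H2))).
    apply: (le_trans _ (prU_le _ _ _)); do ?exact: (measurable_not (mE _ _)).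
    apply: pr_le => //; first by apply: measurableU; exact: (measurable_not (mE _ _)).
    move=> y ng; have [En|] := pselect (E n y (b h y)); last by left.
    by right=> En1; apply: ng.
  rewrite mulrDr lerD // /del mulrA ler_pdivrMr // mulrC ler_wpM2l // ?ltW // /K.
    have := ler0n R (size (H n.-1)); have := ler0n R n; lra.
  have := ler0n R (size (H n.+1)); have := ler0n R n.+1 => /=; lra.
pose A' n := A n `|` bad n.
have mA n : measurable (A n) by have [] := MP n.
have mA' n : measurable (A' n) by exact: measurableU.
have prA' n : pr nu (A' n) <= eps n + (eps n + eps n.+1).
  apply: (le_trans (prU_le _ (mA n) (mbad n))); apply: lerD => //.
  by have [_ /ltW] := MP n.
(* Bad points belong to [A' n] and reach it trivially, so the section is complete everywhere and for
   both relations. *)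
have hit n y : exists z, [/\ A' n z, E n y z & E n.+1 y z].
  have [By|nBy] := pselect (bad n y).
    by exists y; split; [right|exact: rst_refl|exact: rst_refl].
  have [_ _ /(_ y)[h hH Ah]] := MP n; exists (b h y).
  have [En En1] : good n h y.
    apply: contrapT => ng; apply: nBy.
    have hs : (index h (H n) < size (H n))%N by rewrite index_mem.
    by exists (Ordinal hs); rewrite /= nth_index.
  by split=> //; left.
have T_ex n : exists T : (nat -> G) * (nat -> set Y),
    [/\ forall i, measurable (T.2 i),
        forall x y, A' n x -> A' n y -> E n.+1 x y -> frel b T.1 T.2 x y &
        (\esum_(i in [set: nat]) nu (T.2 i) + (1 - pr nu (A' n))%:E <=
         \esum_(i in [set: nat]) nu ((S n.+1).2 i))%E].
  have cpl y : exists z, A' n z /\ frel b (S n.+1).1 (S n.+1).2 y z.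
    by have [z [? ? ?]] := hit n y; exists z.
  have [elT [domT TP]] := contraction eS (mS n.+1) (mA' n) cpl.
  by exists (elT, domT).
have [T TP] := choice T_ex.
have mT n i : measurable ((T n).2 i) by have [+ _ _] := TP n; apply.
have costT n : (\esum_(i in [set: nat]) nu ((T n).2 i) <= (4 * eps n)%:E)%E.
  have [_ _ H1] := TP n; have [_ /ltW H2 _] := SP n.+1.
  have := le_trans H1 H2; rewrite -leeBrDr // -EFinB => /le_trans; apply.
  by rewrite lee_fin; have := prA' n; have := epsS n; lra.
pose elF (k : nat + nat * nat) := match k with
  | inl i => (S 0%N).1 i | inr p => (T p.1).1 p.2 end.
pose domF (k : nat + nat * nat) := match k with
  | inl i => (S 0%N).2 i | inr p => (T p.1).2 p.2 end.
have mF k : measurable (domF k) by case: k => [i|[n i]]; [exact: mS|exact: mT].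
have TF n x y : frel b (T n).1 (T n).2 x y -> frel b elF domF x y.
  by apply: frel_sub => i z Tz; apply: rst_step; exists (inr (n, i)).
(* A connection in [S n.+1] is led at both ends to the section [A' n] through [S n], available by
   induction; between the two points of the section it is a connection in [T n]. *)
have EF n x y : E n x y -> frel b elF domF x y.
  elim: n x y => [|n IHn] x y.
    by apply: frel_sub => i z Sz; apply: rst_step; exists (inl i).
  move=> xy; have [x' [Ax' xx' xx1]] := hit n x; have [y' [Ay' yy' yy1]] := hit n y.
  apply: (@rst_trans _ _ _ x'); first exact: IHn.
  apply: (@rst_trans _ _ _ y'); last by apply: rst_sym; exact: IHn.
  apply: (TF n); have [_ TR _] := TP n; apply: TR => //.
  apply: (@rst_trans _ _ _ x); first exact: rst_sym.
  exact: (@rst_trans _ _ _ y).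
have genF : generating b elF domF.
  move=> g; have [k <-] := eS g; apply/le_anti; rewrite pr_ge0 andbT.
  apply/ler_addgt0Pr => t t0; rewrite add0r.
  have [N _ /(_ N (leqnn N)) Nt] := near_infty_natSinv_lt (PosNum (divr_gt0 t0 eta0)).
  pose n := (maxn N k).+1.
  have [_ _ /(_ (e k))] := SP n; rewrite !mem_cat map_f ?orbT; last first.
    by rewrite mem_iota /= add0n ltnS leq_maxr.
  move=> /(_ isT) Hn; apply: (@le_trans _ _ (del n)).
    apply: le_trans (ltW Hn); apply: pr_le.
    + by apply: measurable_not; apply: (measurable_frel1 b sepV).
    + exact: (measurable_not (mE _ _)).
    + by move=> y nF En; apply: nF; exact: EF En.
  apply: (@le_trans _ _ (eps n)); first by rewrite /del ler_pdivrMr // ler_peMr // ltW.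
  apply: (@le_trans _ _ (eta * N.+1%:R^-1)); last first.
    by rewrite mulrC -ler_pdivlMr // ltW.
  apply: (@le_trans _ _ (eta * (2 ^ n.+1)%:R^-1)).
    have : 0 <= eta * (2 ^ n.+1)%:R^-1 by rewrite mulr_ge0 ?invr_ge0 ?ler0n // ltW.
    rewrite /eps; lra.
  rewrite ler_pM2l // lef_pV2 ?posrE ?ltr0n ?expn_gt0 // ler_nat.
  apply: leq_trans (ltnW (ltn_expl _ _)) => //.
  by rewrite !ltnS (leq_trans (leq_maxl N k)).
apply: (le_trans (action_cost_le sepV eS mF genF)).
rewrite esum_sum_type // EFinD.
rewrite -setXTT -(@esum_esum _ _ _ setT (fun _ => setT) (fun n i => nu ((T n).2 i))) //.
have cost0 : (\esum_(i in [set: nat]) nu (domF (inl i)) <= 1%:E + (eta / 2)%:E)%E.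
  have [_ /ltW H2 _] := SP 0%N; apply: le_trans H2 _; rewrite lee_fin lerD2l.
  rewrite /eps expn1; lra.
rewrite [in leRHS](splitr eta) EFinD addeA; apply: leeD => //.
apply: (le_trans (le_esum (fun n _ => costT n))).
rewrite -nneseries_esumT; last by move=> n; rewrite lee_fin mulr_ge0 // ltW.
apply: le_trans (epsilon_trick0 (eps := eta / 2) xpredT _); last lra.
rewrite (eq_eseriesr (g := fun n => (eta / 2 / (2 ^ n.+1)%:R)%:E)) // => n _.
by congr EFin; rewrite /eps mulrC divfK.
Qed.

End CostOneUpper.

(** * Traces of idempotents *)

Section IdempotentTrace.
Context (R : realType) (M : lmodType R) (good : set M).
Context (mul : M -> M -> M) (tr : M -> M) (ip : M -> M -> R).
Hypothesis goodD : forall x y, good x -> good y -> good (x + y).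
Hypothesis goodZ : forall c x, good x -> good (c *: x).
Hypothesis goodM : forall x y, good x -> good y -> good (mul x y).
Hypothesis goodT : forall x, good x -> good (tr x).
Hypothesis ipD : forall x y z, good x -> good y -> good z ->
  ip (x + y) z = ip x z + ip y z.
Hypothesis ipZ : forall c x z, good x -> good z -> ip (c *: x) z = c * ip x z.
Hypothesis ipC : forall x y, good x -> good y -> ip x y = ip y x.
Hypothesis ip_ge0 : forall x, good x -> 0 <= ip x x.
Hypothesis mulDr : forall r x y, good r -> good x -> good y ->
  mul r (x + y) = mul r x + mul r y.
Hypothesis mulZr : forall c r x, good r -> good x ->
  mul r (c *: x) = c *: mul r x.
Hypothesis mulA : forall x y z, good x -> good y -> good z ->
  mul (mul x y) z = mul x (mul y z).
Hypothesis trM : forall x y, good x -> good y ->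
  tr (mul x y) = mul (tr y) (tr x).
Hypothesis trK : forall x, tr (tr x) = x.
Hypothesis ip_mull : forall c x z, good c -> good x -> good z ->
  ip (mul c x) z = ip x (mul (tr c) z).
Hypothesis ip_mulr : forall c x z, good c -> good x -> good z ->
  ip (mul x c) z = ip x (mul z (tr c)).
Hypothesis bounded : forall c, good c ->
  exists2 K, 0 <= K & forall x, good x -> ip (mul x c) (mul x c) <= K * ip x x.

(** A nonnegative quadratic in [t] has nonpositive discriminant. For [n = 0] it is affine, and
    [t = h / c] rules out a nonzero [c]. *)
Lemma quadratic_bound (n c h : R) : 0 <= n -> 0 < h ->
  (forall t, 0 <= t ^+ 2 * n - 2 * t * c + h) -> c ^+ 2 <= h * n.
Proof.
move=> n0 h0 H; have [n_eq|n_neq] := eqVneq n 0; last first.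
  have np : 0 < n by rewrite lt_neqAle eq_sym n_neq.
  have := H (c / n); rewrite (_ : _ + h = h - c ^+ 2 / n); last by field.
  by rewrite subr_ge0 ler_pdivrMr.
have [->|c0] := eqVneq c 0; first by rewrite n_eq mulr0 expr2 mulr0.
have := H (h / c); rewrite n_eq mulr0 add0r -mulrA divfK //; lra.
Qed.

(* Kaplansky's inequality tr r <= tr e.  The orthogonal projection onto the
   range of [r] may not belong to the algebra, so it is replaced by a
   near-minimizer [u] of the distance from [e] to the right ideal of [r]. *)
Lemma idempotent_trace_le (e r : M) : good e -> good r ->
  tr e = e -> mul r r = r -> mul e r = r -> mul r e = r ->
  ip r e <= ip e e.
Proof.
move=> ge gr te rr er re.
have gtr := goodT gr.
have ipDr x y z : good x -> good y -> good z -> ip x (y + z) = ip x y + ip x z.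
  by move=> gx gy gz; rewrite ipC ?ipD ?(ipC gx) //; exact: goodD.
have ipZr c x z : good x -> good z -> ip x (c *: z) = c * ip x z.
  by move=> gx gz; rewrite ipC ?ipZ ?(ipC gx) //; exact: goodZ.
pose V x := good x /\ mul r x = x.
have VD x y : V x -> V y -> V (x + y).
  by move=> [gx rx] [gy ry]; split; [exact: goodD|rewrite mulDr // rx ry].
have VZ c x : V x -> V (c *: x).
  by move=> [gx rx]; split; [exact: goodZ|rewrite mulZr // rx].
have VM x c : V x -> good c -> V (mul x c).
  by move=> [gx rx] gc; split; [exact: goodM|rewrite -mulA // rx].
pose dist x := ip (e + (-1) *: x) (e + (-1) *: x).
have gdist x : good x -> good (e + (-1) *: x).
  by move=> gx; apply: goodD => //; exact: goodZ.
pose D := [set dist x | x in V].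
have infD : has_inf D.
  split; first by exists (dist r), r.
  by exists 0 => _ [x [gx _] <-]; apply/ip_ge0/gdist.
have [Kr Kr0 KrP] := bounded gr; have [Kt Kt0 KtP] := bounded gtr.
have ee0 := ip_ge0 ge; have rr0 := ip_ge0 gr.
(* A common bound for the squared norms of [u], [r], [mul u r] and [mul u (tr r)], the vectors to be
   tested against [e - u]. It has to be fixed before [u] is chosen, since the precision [h] depends
   on it. *)
pose B := (4 * ip e e + 2) * (1 + Kr + Kt) + ip r r.
have B0 : 0 < B + 1 by rewrite /B; have := mulr_ge0 ee0 Kr0; have := mulr_ge0 ee0 Kt0; lra.
suff H eps : 0 < eps -> ip r e <= ip e e + 4 * eps.
  apply/ler_addgt0Pr => eps eps0; have eps40 : 0 < eps / 4 by lra.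
  by have := H _ eps40; lra.
move=> eps0.
(* [h * B <= eps ^+ 2] turns near-minimality into near-orthogonality within [eps]; [h <= 1] bounds
   the norm of [u] in advance. *)
pose h := Num.min 1 (eps ^+ 2 / (B + 1)).
have h0 : 0 < h by rewrite lt_min ltr01 divr_gt0 // exprn_gt0.
have h1 : h <= 1 by rewrite ge_min lexx.
have hB : h * B <= eps ^+ 2.
  apply: (@le_trans _ _ (h * (B + 1))); first by rewrite ler_pM2l //; lra.
  by rewrite -ler_pdivlMr // ge_min lexx orbT.
have [_ [u [gu ru] <-] ud] := inf_adherent h0 infD.
have [q qd] : exists q, q = e + (-1) *: u by exists (e + (-1) *: u).
have gq : good q by rewrite qd; exact: gdist.
have near N : V N -> ip N N <= B -> `|ip N q| <= eps.
  move=> [gN rN] NB; have N0 := ip_ge0 gN.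
  rewrite -[eps]gtr0_norm // -ler_sqr ?nnegrE // !real_normK ?num_real //.
  apply: le_trans (quadratic_bound N0 h0 _) _; last first.
    by apply: le_trans hB; rewrite ler_pM2l.
  move=> t; have : inf D <= dist (u + t *: N).
    by apply: ge_inf; [exact: infD.2|exists (u + t *: N) => //; apply: VD => //; exact: VZ].
  have -> : dist (u + t *: N) = ip q q - 2 * t * ip N q + t ^+ 2 * ip N N.
    rewrite /dist; have -> : e + (-1) *: (u + t *: N) = q + (- t) *: N.
      by rewrite qd scalerDr addrA scalerA mulN1r.
    have gtN := goodZ (- t) gN; have gqN := goodD gq gtN.
    by rewrite ipD // !(ipDr, ipZ, ipZr) // (ipC gq gN); ring.
  by move: ud; rewrite /dist -qd; lra.
have uq0 : 0 <= ip q q := ip_ge0 gq.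
have qE : ip q q = ip e e - 2 * ip u e + ip u u.
  have gu1 := goodZ (-1) gu; have geu := goodD ge gu1.
  by rewrite qd ipD // !(ipDr, ipZ, ipZr) // (ipC ge gu); ring.
have Nq N : good N -> ip N q = ip N e - ip N u.
  by move=> gN; rewrite qd ipDr ?ipZr //; [ring|exact: goodZ].
have uu0 := ip_ge0 gu.
have uuB : ip u u <= 4 * ip e e + 2.
  have inf_le : inf D <= ip e e.
    apply: ge_inf; first exact: infD.2.
    exists (0 *: r); first exact: VZ.
    by rewrite /dist scale0r scaler0 addr0.
  have qq1 : ip q q <= ip e e + 1 by move: ud; rewrite /dist -qd; lra.
  have : 0 <= ip (2 *: e + (-1) *: u) (2 *: e + (-1) *: u).
    by apply: ip_ge0; apply: goodD; exact: goodZ.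
  have gu1 := goodZ (-1) gu; have ge2 := goodZ 2 ge; have g2eu := goodD ge2 gu1.
  rewrite ipD // !(ipDr, ipZ, ipZr) // (ipC ge gu).
  move: qq1; rewrite qE; lra.
have urB : ip (mul u r) (mul u r) <= B.
  apply: le_trans (KrP _ gu) _; rewrite /B.
  have := ler_wpM2l Kr0 uuB; have := mulr_ge0 ee0 Kr0; have := mulr_ge0 ee0 Kt0; lra.
have utB : ip (mul u (tr r)) (mul u (tr r)) <= B.
  apply: le_trans (KtP _ gu) _; rewrite /B.
  have := ler_wpM2l Kt0 uuB; have := mulr_ge0 ee0 Kr0; have := mulr_ge0 ee0 Kt0; lra.
have rB : ip r r <= B.
  by rewrite /B; have := mulr_ge0 ee0 Kr0; have := mulr_ge0 ee0 Kt0; lra.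
have uB : ip u u <= B.
  by rewrite /B; have := mulr_ge0 ee0 Kr0; have := mulr_ge0 ee0 Kt0; lra.
have Vu : V u by []. have Vr : V r by [].
(* The numbers [ip r e], [ip r u], [ip u (mul u (tr r))], [ip u e] and [ip u u] differ successively
   by at most [eps], and then [0 <= ip q q] gives [ip u e <= ip e e + eps]. For an exact projection
   [u] these differences vanish. *)
have := near _ Vr rB; have := near _ Vu uB.
have := near _ (VM _ _ Vu gr) urB; have := near _ (VM _ _ Vu gtr) utB.
have gur := goodM gu gr; have gut := goodM gu gtr.
rewrite !Nq // !ip_mulr // trK er.
have -> : mul e (tr r) = tr r by rewrite -[in RHS]re trM // te.
have -> : ip u (tr r) = ip u e.
  by rewrite -[tr r in LHS](_ : mul (tr r) e = tr r) -?ip_mull ?ru // -{2}er trM // te.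
rewrite (ipC gu (goodM gu gr)) ip_mulr // (ipC gr gu).
rewrite !ler_norml => /andP[? ?] /andP[? ?] /andP[? ?] /andP[? ?].
move: uq0; rewrite qE; lra.
Qed.

End IdempotentTrace.

(** * Integrals of bounded measurable functions *)

Section BoundedIntegral.
Context (R : realType) (G : groupType).
Context d (Y : measurableType d) (nu : probability Y R) (b : mp_action G nu).

Definition bm (f : Y -> R) :=
  measurable_fun setT f /\ exists C, forall y, `|f y| <= C.

Lemma bm_cst c : bm (fun=> c).
Proof. by split; [exact: measurable_cst|exists `|c|]. Qed.

Lemma bm_add f g : bm f -> bm g -> bm (fun y => f y + g y).
Proof.
move=> [mf [C fC]] [mg [C' gC]]; split; first exact: measurable_funD.
by exists (C + C') => y; apply: (le_trans (ler_normD _ _)); exact: lerD.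
Qed.

Lemma bm_mul f g : bm f -> bm g -> bm (fun y => f y * g y).
Proof.
move=> [mf [C fC]] [mg [C' gC]]; split; first exact: measurable_funM.
by exists (C * C') => y; rewrite normrM ler_pM.
Qed.

Lemma bm_sum (I : Type) (r : seq I) (F : I -> Y -> R) :
  (forall i, bm (F i)) -> bm (fun y => \sum_(i <- r) F i y).
Proof.
move=> bF; elim: r => [|i r IHr].
  rewrite (_ : (fun _ => _) = fun=> 0); first exact: bm_cst.
  by apply/funext => y; rewrite big_nil.
rewrite (_ : (fun _ => _) = fun y => F i y + \sum_(i <- r) F i y).
  exact: bm_add.
by apply/funext => y; rewrite big_cons.
Qed.

Lemma bm_act f g : bm f -> bm (fun y => f (b g y)).
Proof.
move=> [mf [C fC]]; split; last by exists C => y.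
exact: measurableT_comp mf (act_measurable b g).
Qed.

Lemma measurable_asbool (A : set Y) : measurable A ->
  measurable_fun setT (fun y => `[< A y >]).
Proof.
move=> mA; apply: (measurable_fun_bool true); rewrite setTI.
rewrite (_ : _ @^-1` _ = A) //.
by apply/seteqP; split=> y; [move/asboolP|move=> Ay; apply/asboolP].
Qed.

Definition EI (f : Y -> R) : R := \int[nu]_(y in setT) f y.

Lemma bm_integrable f : bm f -> nu.-integrable setT (EFin \o f).
Proof.
move=> [mf [C fC]]; apply: measurable_bounded_integrable => //.
  exact: le_lt_trans (probability_le1 nu measurableT) (ltry 1).
exists C; split; first exact: num_real.
by move=> M CM y _; apply: (le_trans (fC y)); exact: ltW.
Qed.

Lemma EI_add f g : bm f -> bm g -> EI (fun y => f y + g y) = EI f + EI g.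
Proof. by move=> bf bg; rewrite /EI RintegralD //; exact: bm_integrable. Qed.

Lemma EI_scale c f : bm f -> EI (fun y => c * f y) = c * EI f.
Proof. by move=> bf; rewrite /EI RintegralZl //; exact: bm_integrable. Qed.

Lemma EI_sum (I : Type) (r : seq I) (F : I -> Y -> R) :
  (forall i, bm (F i)) ->
  EI (fun y => \sum_(i <- r) F i y) = \sum_(i <- r) EI (F i).
Proof.
move=> bF; elim: r => [|i r IHr].
  rewrite big_nil -[RHS](mul0r (EI (fun=> 0))) -EI_scale; last exact: bm_cst.
  by congr EI; apply/funext => y; rewrite big_nil mul0r.
rewrite big_cons -IHr -EI_add //; last exact: bm_sum.
by congr EI; apply/funext => y; rewrite big_cons.
Qed.

Lemma EI_ge0 f : (forall y, 0 <= f y) -> 0 <= EI f.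
Proof. by move=> f0; apply: Rintegral_ge0. Qed.

Lemma EI_le f g : bm f -> bm g -> (forall y, f y <= g y) -> EI f <= EI g.
Proof. by move=> bf bg fg; apply: le_Rintegral => //; exact: bm_integrable. Qed.

Lemma EI_act f g : bm f -> EI (fun y => f (b g y)) = EI f.
Proof.
move=> bf; rewrite /EI /Rintegral; congr fine.
have mbg := act_measurable b g.
have := @integral_pushforward _ _ _ _ _ _ mbg nu setT (EFin \o f).
rewrite preimage_setT => <- //.
- by apply: eq_measure_integral => A mA _; rewrite /= /pushforward act_preserving.
- by apply: measurableT_comp => //; case: bf.
- exact: (bm_integrable (bm_act g bf)).
Qed.

Lemma EI_indic A : measurable A -> EI (fun y => if `[< A y >] then 1 else 0) = pr nu A.
Proof.
move=> mA; rewrite /EI /Rintegral /pr -[A in RHS]setIT -integral_indic //.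
congr fine; apply: eq_integral => y _; congr EFin; rewrite indicE.
by case: asboolP => Ay; [rewrite mem_set|rewrite memNset].
Qed.

End BoundedIntegral.

Section FiniteSupportSum.
Context (R : realType) (G : groupType).

(** Zero by default when the support is infinite; locality of the kernels keeps supports finite. *)
Definition fsum (F : G -> R) : R := \sum_(g \in [set: G]) F g.

Lemma fsum_seq (L : seq G) (F : G -> R) : uniq L ->
  (forall g, F g != 0 -> g \in L) -> fsum F = \sum_(g <- L) F g.
Proof.
move=> uL FL; rewrite fsbig_seq //; apply/esym/fsbig_widen => //.
move=> g [_ /= gL]; apply/eqP; apply: contraT => /FL gL'.
by case: gL.
Qed.

Lemma fsum_eq0 (F : G -> R) : (forall g, F g = 0) -> fsum F = 0.
Proof. by move=> F0; apply: fsbig1 => g _. Qed.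

Lemma fsum_reindex (s s' : G -> G) (F : G -> R) : cancel s s' -> cancel s' s ->
  fsum F = fsum (fun g => F (s g)).
Proof.
move=> ss' s's; rewrite /fsum (reindex_fsbigT s) //.
by exists s'.
Qed.

End FiniteSupportSum.

(** * The algebra of equivariant kernels of finite propagation *)

Section Kernels.
Context (R : realType) (G : groupType) (I : finType).
Context d (Y : measurableType d) (nu : probability Y R) (b : mp_action G nu).

(** Seen from the base point [y], the pair [(i, h)] stands for the edge of index [i] with source
    [b h y]. *)
Let J := (I * G)%type.
Let M := (Y -> J -> J -> R^o).

Definition sumJ (F : J -> R) : R := \sum_(i : I) fsum (fun g => F (i, g)).

Definition box (K : seq G) : seq J := [seq (i, k) | i <- enum I, k <- K].

Lemma sum_box (K : seq G) (F : J -> R) :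
  \sum_(t <- box K) F t = \sum_(i : I) \sum_(k <- K) F (i, k).
Proof. by rewrite big_allpairs big_enum. Qed.

Lemma sumJ_box K (g : G) (F : J -> R) : uniq K ->
  (forall i h, F (i, h) != 0 -> (h * g^-1)%g \in K) ->
  sumJ F = \sum_(t <- box K) F (t.1, (t.2 * g)%g).
Proof.
move=> uK FK; rewrite sum_box; apply: eq_bigr => i _ /=.
rewrite (fsum_seq (L := [seq (k * g)%g | k <- K])).
- by rewrite big_map.
- by rewrite map_inj_uniq //; exact: mulIg.
- move=> h /FK hK; apply/mapP; exists (h * g^-1)%g => //.
  by rewrite mulgVK.
Qed.

Lemma eq_sumJ (F H : J -> R) : F =1 H -> sumJ F = sumJ H.
Proof. by move=> FH; congr sumJ; apply/funext. Qed.

Definition local (K : seq G) (f : M) :=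
  forall y p q, f y p q != 0 -> (p.2 * q.2^-1)%g \in K.

Definition symmetric_list (K : seq G) := uniq K /\ forall k, k \in K -> (k^-1)%g \in K.

(** Matrices over the algebraic crossed product of the bounded functions by the group: the third
    clause is independence of the base point, locality is finiteness of the support over the
    group. *)
Definition good (f : M) := [/\ forall p q, measurable_fun setT (fun y => f y p q : R),
  exists C : R, forall y p q, `|f y p q| <= C,
  forall l y i h j g, f (b l y) (i, h) (j, g) = f y (i, (h * l)%g) (j, (g * l)%g) &
  exists K, local K f].

Lemma good_local f : good f -> exists K, symmetric_list K /\ local K f.
Proof.
move=> [_ _ _ [K Kf]]; exists (undup (K ++ [seq (k^-1)%g | k <- K])); split.
  split; first exact: undup_uniq.
  move=> k; rewrite !mem_undup !mem_cat => /orP[kK|/mapP[h hK ->]].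
    by rewrite map_f ?orbT.
  by rewrite invgK hK.
by move=> y p q /Kf pq; rewrite mem_undup mem_cat pq.
Qed.

Lemma good_bm f p q : good f -> bm (fun y => f y p q : R).
Proof. by move=> [mf [C fC] _ _]; split=> //; exists C => y; exact: fC. Qed.

Lemma local_inv K f y p q : symmetric_list K -> local K f -> f y p q != 0 ->
  (q.2 * p.2^-1)%g \in K.
Proof. by move=> [_ sK] Kf /Kf/sK; rewrite invgM invgK. Qed.

Definition kmul (f f' : M) : M := fun y p q => sumJ (fun s => f y p s * f' y s q).
Definition ktr (f : M) : M := fun y p q => f y q p.
(** The trace of [kmul (ktr f) f']: its diagonal entries at the base point, integrated. *)
Definition kip (f f' : M) : R :=
  \sum_(j : I) EI nu (fun y => sumJ (fun p => f y p (j, 1%g) * f' y p (j, 1%g))).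

Lemma kmul_col K f f' y p q : uniq K -> local K f' ->
  kmul f f' y p q =
  \sum_(t <- box K) f y p (t.1, (t.2 * q.2)%g) * f' y (t.1, (t.2 * q.2)%g) q.
Proof.
move=> uK Kf'; apply: sumJ_box => // i h; rewrite mulf_eq0 negb_or => /andP[_].
by move=> /Kf'.
Qed.

Lemma kmul_row K f f' y p q : symmetric_list K -> local K f ->
  kmul f f' y p q =
  \sum_(t <- box K) f y p (t.1, (t.2 * p.2)%g) * f' y (t.1, (t.2 * p.2)%g) q.
Proof.
move=> sK Kf; apply: sumJ_box; first by case: sK.
move=> i h; rewrite mulf_eq0 negb_or => /andP[fps _].
exact: (local_inv sK Kf fps).
Qed.

Lemma kipE K f f' : uniq K -> local K f' -> good f -> good f' ->
  kip f f' = \sum_(j : I) \sum_(t <- box K)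
    EI nu (fun y => f y t (j, 1%g) * f' y t (j, 1%g)).
Proof.
move=> uK Kf' gf gf'; apply: eq_bigr => j _; rewrite -EI_sum; last first.
  by move=> t; apply: bm_mul; exact: good_bm.
congr EI; apply/funext => y; rewrite (sumJ_box (g := 1%g) uK).
  by apply: eq_bigr => -[i k] _; rewrite mulg1.
move=> i h; rewrite mulf_eq0 negb_or => /andP[_].
by move=> /Kf'.
Qed.

Lemma good_add f f' : good f -> good f' -> good (f + f').
Proof.
move=> [mf [C fC] ef [K Kf]] [mf' [C' fC'] ef' [K' Kf']]; split.
- by move=> p q; exact: measurable_funD (mf p q) (mf' p q).
- exists (C + C') => y p q; apply: (le_trans (ler_normD _ _)).
  by apply: lerD; [exact: fC|exact: fC'].
- by move=> l y i h j g; rewrite [LHS](congr2 +%R (ef _ _ _ _ _ _) (ef' _ _ _ _ _ _)).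
- exists (K ++ K') => y p q; rewrite mem_cat => ff.
  have [fpq|] := eqVneq (f y p q) 0; last by move=> /Kf ->.
  by rewrite (Kf' y p q) ?orbT //; apply: contra ff => /eqP E;
    rewrite [X in X == _](congr2 +%R fpq E) addr0.
Qed.

Lemma good_scale c f : good f -> good (c *: f).
Proof.
move=> [mf [C fC] ef [K Kf]]; split.
- by move=> p q; exact: measurable_funM (measurable_cst c) (mf p q).
- exists (`|c| * C) => y p q; rewrite [X in `|X|](_ : _ = c * f y p q) // normrM.
  by apply: ler_wpM2l => //; exact: fC.
- by move=> l y i h j g; congr (c *: _); exact: ef.
- exists K => y p q cf; apply: (Kf y p q); apply: contra cf => /eqP E.
  by rewrite [X in X == _](_ : _ = c * f y p q) // E mulr0.
Qed.

Lemma good_tr f : good f -> good (ktr f).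
Proof.
move=> gf; have [K [sK Kf]] := good_local gf; have [mf [C fC] ef _] := gf; split.
- by move=> p q; exact: mf.
- by exists C => y p q; exact: fC.
- by move=> l y i h j g; exact: ef.
- by exists K => y p q /(local_inv sK Kf).
Qed.

Lemma good_mul f f' : good f -> good f' -> good (kmul f f').
Proof.
move=> gf gf'; have [K [sK Kf]] := good_local gf; have [K' [[uK' _] Kf']] := good_local gf'.
have [mf [C fC] ef _] := gf; have [mf' [C' fC'] ef' _] := gf'.
split.
- move=> p q; have [] : bm (fun y => kmul f f' y p q) => //.
  rewrite (_ : (fun _ => _) = fun y => \sum_(t <- box K')
      f y p (t.1, (t.2 * q.2)%g) * f' y (t.1, (t.2 * q.2)%g) q).
    by apply: bm_sum => t; apply: bm_mul; exact: good_bm.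
  by apply/funext => y; exact: kmul_col.
- exists (\sum_(t <- box K') C * C') => y p q; rewrite (kmul_col _ _ _ _ uK' Kf').
  apply: (le_trans (ler_norm_sum _ _ _)); apply: ler_sum => t _.
  by rewrite normrM ler_pM.
- move=> l y i h j g; rewrite !(kmul_col _ _ _ _ uK' Kf').
  by apply: eq_bigr => t _; rewrite ef ef' mulgA.
- exists [seq (k * k')%g | k <- K, k' <- K'] => y p q.
  rewrite (kmul_row _ _ _ _ sK Kf) => nz.
  have [t /andP[fp f'q]] : exists t : J, (f y p (t.1, (t.2 * p.2)%g) != 0) &&
      (f' y (t.1, (t.2 * p.2)%g) q != 0).
    apply: contrapT => H; move/eqP: nz; apply; apply: big1 => t _.
    by apply/eqP; rewrite mulf_eq0; apply: contrapT => /negP;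
      rewrite negb_or => tt; apply: H; exists t.
  apply/allpairsP; exists ((p.2 * (t.2 * p.2)^-1)%g, ((t.2 * p.2) * q.2^-1)%g).
  split; [exact: (Kf _ _ _ fp)|exact: (Kf' _ _ _ f'q)|].
  by rewrite /= mulgA mulgVK.
Qed.

Lemma kip_add x y z : good x -> good y -> good z -> kip (x + y) z = kip x z + kip y z.
Proof.
move=> gx gy gz; have [K [[uK _] Kz]] := good_local gz.
rewrite !(kipE uK Kz) //; last exact: good_add.
rewrite -big_split; apply: eq_bigr => j _; rewrite -big_split; apply: eq_bigr => t _.
rewrite /= -EI_add; do ?[by apply: bm_mul; exact: good_bm].
by congr EI; apply/funext => w; rewrite -mulrDl.
Qed.

Lemma kip_scale c x z : good x -> good z -> kip (c *: x) z = c * kip x z.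
Proof.
move=> gx gz; have [K [[uK _] Kz]] := good_local gz.
rewrite !(kipE uK Kz) //; last exact: good_scale.
rewrite mulr_sumr; apply: eq_bigr => j _; rewrite mulr_sumr; apply: eq_bigr => t _.
rewrite -EI_scale; last by apply: bm_mul; exact: good_bm.
by congr EI; apply/funext => w; rewrite mulrA.
Qed.

Lemma kipC x y : kip x y = kip y x.
Proof.
apply: eq_bigr => j _; congr EI; apply/funext => w; apply: eq_sumJ => p.
exact: mulrC.
Qed.

Lemma kip_ge0 x : good x -> 0 <= kip x x.
Proof.
move=> gx; have [K [[uK _] Kx]] := good_local gx; rewrite (kipE uK Kx) //.
apply: sumr_ge0 => j _; apply: sumr_ge0 => t _; apply: EI_ge0 => y.
by rewrite -expr2 sqr_ge0.
Qed.

Lemma kmul_addr r x y : good r -> kmul r (x + y) = kmul r x + kmul r y.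
Proof.
move=> gr; have [K [sK Kr]] := good_local gr.
apply/funext => w; apply/funext => p; apply/funext => q.
rewrite [RHS](_ : _ = kmul r x w p q + kmul r y w p q) //.
rewrite !(kmul_row _ _ _ _ sK Kr) -big_split; apply: eq_bigr => t _.
exact: mulrDr.
Qed.

Lemma kmul_scaler c r x : good r -> kmul r (c *: x) = c *: kmul r x.
Proof.
move=> gr; have [K [sK Kr]] := good_local gr.
apply/funext => w; apply/funext => p; apply/funext => q.
rewrite [RHS](_ : _ = c * kmul r x w p q) //.
rewrite !(kmul_row _ _ _ _ sK Kr) mulr_sumr; apply: eq_bigr => t _.
exact: mulrCA.
Qed.

Lemma kmulA x y z : good x -> good z -> kmul (kmul x y) z = kmul x (kmul y z).
Proof.
move=> gx gz; have [K [sK Kx]] := good_local gx; have [K' [[uK' _] Kz]] := good_local gz.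
apply/funext => w; apply/funext => p; apply/funext => q.
rewrite (kmul_col _ _ _ _ uK' Kz) (kmul_row _ _ _ _ sK Kx).
under eq_bigr do rewrite (kmul_row _ _ _ _ sK Kx) mulr_suml.
rewrite exchange_big /=; apply: eq_bigr => t _.
rewrite (kmul_col _ _ _ _ uK' Kz) mulr_sumr; apply: eq_bigr => s _.
by rewrite mulrA.
Qed.

Lemma ktr_mul x y : ktr (kmul x y) = kmul (ktr y) (ktr x).
Proof.
apply/funext => w; apply/funext => p; apply/funext => q.
by apply: eq_sumJ => s; exact: mulrC.
Qed.

Lemma kip_mull c x z : good c -> good x -> good z ->
  kip (kmul c x) z = kip x (kmul (ktr c) z).
Proof.
move=> gc gx gz; have [K [[uK _] Kx]] := good_local gx.
have [K' [[uK' _] Kz]] := good_local gz.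
apply: eq_bigr => j _; congr EI; apply/funext => y.
set q := (j, 1%g); rewrite (sumJ_box (g := 1%g) uK'); last first.
  by move=> i h; rewrite mulf_eq0 negb_or => /andP[_ /Kz].
rewrite (sumJ_box (g := 1%g) uK); last first.
  by move=> i h; rewrite mulf_eq0 negb_or => /andP[/Kx].
under eq_bigr do rewrite (kmul_col _ _ _ _ uK Kx) mulr_suml.
rewrite exchange_big /=; apply: eq_bigr => t _.
rewrite (kmul_col _ _ _ _ uK' Kz) mulr_sumr; apply: eq_bigr => s _ /=.
by rewrite /ktr !mulrA (mulrC (x _ _ _)).
Qed.

(** The trace property. Moving the base point by [k] turns an entry in the column at 1 into one in
    the row at 1, and the integral does not change because the action preserves the measure. *)
Lemma kip_tr x z : good x -> good z -> kip (ktr x) (ktr z) = kip x z.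
Proof.
move=> gx gz; have [K [sK Kz]] := good_local gz; have [uK invK] := sK.
have Ktz : local K (ktr z) by move=> y p q /(local_inv sK Kz).
rewrite (kipE uK Kz) // (kipE uK Ktz); [|exact: good_tr..].
under eq_bigr do rewrite sum_box.
under [RHS]eq_bigr do rewrite sum_box.
rewrite exchange_big /=; apply: eq_bigr => j _; apply: eq_bigr => i _.
have pK : perm_eq K [seq (k^-1)%g | k <- K].
  apply: uniq_perm => //; first by rewrite map_inj_uniq //; exact: invg_inj.
  move=> k; apply/idP/mapP => [kK|[h hK ->]]; last exact: invK.
  by exists (k^-1)%g; [exact: invK|rewrite invgK].
rewrite [RHS](perm_big _ pK) big_map; apply: eq_bigr => k _.
have bxz : bm (fun y => x y (i, (k^-1)%g) (j, 1%g) * z y (i, (k^-1)%g) (j, 1%g)).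
  by apply: bm_mul; exact: good_bm.
rewrite -(EI_act b k bxz); congr EI; apply/funext => y.
have [_ _ ex _] := gx; have [_ _ ez _] := gz.
by rewrite /ktr ex ez mulVg mul1g.
Qed.

Lemma kip_mulr c x z : good c -> good x -> good z ->
  kip (kmul x c) z = kip x (kmul z (ktr c)).
Proof.
move=> gc gx gz; have gtc := good_tr gc.
rewrite -kip_tr //; last exact: good_mul.
rewrite ktr_mul kip_mull //; do ?exact: good_tr.
rewrite -[in RHS]kip_tr //; last exact: good_mul.
by rewrite ktr_mul.
Qed.

Lemma sqr_sum_le (T : Type) (r : seq T) (a : T -> R) :
  (\sum_(t <- r) a t) ^+ 2 <= (size r)%:R * \sum_(t <- r) a t ^+ 2.
Proof.
elim: r => [|x r IHr]; first by rewrite !big_nil mulr0 expr2 mulr0.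
rewrite !big_cons /= -natr1; move: IHr.
set S := \sum_(t <- r) a t; set Q := \sum_(t <- r) a t ^+ 2; set n : R := (size r)%:R.
move=> SQ; have Q0 : 0 <= Q by apply: sumr_ge0 => t _; exact: sqr_ge0.
suff : 2 * (a x * S) <= n * a x ^+ 2 + Q by nra.
have [n0|n0] := eqVneq n 0.
  by move: SQ; rewrite n0 mul0r le_eqVlt ltNge sqr_ge0 orbF sqrf_eq0 => /eqP ->; nra.
have np : 0 < n by rewrite lt_neqAle eq_sym n0 ler0n.
rewrite -(ler_pM2l np); have := sqr_ge0 (n * a x - S); nra.
Qed.

Lemma bm_column (f f' : M) q : good f -> good f' ->
  bm (fun y => sumJ (fun p => f y p q * f' y p q)).
Proof.
move=> gf gf'; have [K [[uK _] Kf']] := good_local gf'.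
rewrite (_ : (fun _ => _) = fun y => \sum_(t <- box K)
    f y (t.1, (t.2 * q.2)%g) q * f' y (t.1, (t.2 * q.2)%g) q).
  by apply: bm_sum => t; apply: bm_mul; exact: good_bm.
apply/funext => y; apply: sumJ_box => // i h; rewrite mulf_eq0 negb_or => /andP[_].
by move=> /Kf'.
Qed.

(** A Schur test at fixed [y]: Cauchy-Schwarz over the at most [m] nonzero entries of a row, after
    which each coordinate of [v] is met [n] times for each [i]. The list [V0] witnesses finite
    support, and [B] is independent of it. *)
Lemma left_bound c : good c -> exists2 B, 0 <= B &
  forall y (V0 : seq G) (v : J -> R), (forall i h, v (i, h) != 0 -> h \in V0) ->
    sumJ (fun p => sumJ (fun s => c y p s * v s) ^+ 2) <= B * sumJ (fun s => v s ^+ 2).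
Proof.
move=> gc; have [K [sK Kc]] := good_local gc; have [uK invK] := sK.
have [_ [C0 cC] _ _] := gc; pose C := Num.max C0 0.
have C_ge0 : 0 <= C by rewrite le_max lexx orbT.
have {}cC y p q : `|c y p q| <= C by rewrite le_max cC.
pose m : R := (size (box K))%:R; pose n : R := (size K)%:R.
have m0 : 0 <= m by exact: ler0n.
exists (#|I|%:R * (m * C ^+ 2 * n)); first by rewrite !mulr_ge0 ?sqr_ge0 ?ler0n.
move=> y V0 v vV.
pose L := undup [seq (k * h)%g | k <- K, h <- V0].
have uL : uniq L by exact: undup_uniq.
have vL k i g : k \in K -> v (i, (k * g)%g) != 0 -> g \in L.
  move=> kK /vV kgV; rewrite mem_undup; apply/allpairsP.
  by exists ((k^-1)%g, (k * g)%g); split=> //; [exact: invK|rewrite /= mulKg].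
have boxK t : t \in box K -> t.2 \in K by move=> /allpairsP[[i k] [_ kK ->]].
pose F p := sumJ (fun s => c y p s * v s).
have FE p : F p = \sum_(t <- box K) c y p (t.1, (t.2 * p.2)%g) * v (t.1, (t.2 * p.2)%g).
  apply: sumJ_box => // i h; rewrite mulf_eq0 negb_or => /andP[cps _].
  exact: (local_inv sK Kc cps).
have FL i g : F (i, g) ^+ 2 != 0 -> g \in L.
  rewrite sqrf_eq0 FE; apply: contraR => gL; apply/eqP; rewrite big_seq big1 // => t tK.
  have [->|/(vL _ _ _ (boxK _ tK)) gL'] := eqVneq (v (t.1, (t.2 * g)%g)) 0.
    by rewrite mulr0.
  by rewrite gL' in gL.
have F2 p : F p ^+ 2 <= m * C ^+ 2 * \sum_(t <- box K) v (t.1, (t.2 * p.2)%g) ^+ 2.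
  rewrite FE; apply: (le_trans (sqr_sum_le _ _)); rewrite -/m -mulrA ler_wpM2l //.
  rewrite mulr_sumr; apply: ler_sum => t _; rewrite exprMn ler_wpM2r ?sqr_ge0 //.
  by rewrite -[leLHS]real_normK ?num_real // lerXn2r ?nnegrE.
have mC0 : 0 <= m * C ^+ 2 by rewrite mulr_ge0 ?sqr_ge0.
have colv i : fsum (fun g => F (i, g) ^+ 2) <= m * C ^+ 2 * (n * sumJ (fun s => v s ^+ 2)).
  rewrite (fsum_seq uL (FL i)); apply: (le_trans (ler_sum _ (fun g _ => F2 (i, g)))).
  rewrite -mulr_sumr ler_wpM2l // exchange_big /= big_seq.
  rewrite (eq_bigr (fun t => fsum (fun g => v (t.1, g) ^+ 2))); last first.
    move=> t tK; rewrite (@fsum_reindex _ _ (fun g => (t.2 * g)%g) (fun g => (t.2^-1 * g)%g)).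
    - rewrite (fsum_seq uL) // => g; rewrite sqrf_eq0; exact: vL (boxK _ tK).
    - by move=> g; rewrite mulKg.
    - by move=> g; rewrite mulVKg.
  rewrite -big_seq sum_box /= /sumJ mulr_sumr; apply: ler_sum => i' _.
  by rewrite big_const_seq count_predT iter_addr_0 -mulr_natl.
apply: (le_trans (ler_sum _ (fun i _ => colv i))).
by rewrite sumr_const -[leLHS]mulr_natl !mulrA.
Qed.

Lemma kmul_bounded c : good c -> exists2 B, 0 <= B &
  forall x, good x -> kip (kmul x c) (kmul x c) <= B * kip x x.
Proof.
move=> gc; have [B B0 BP] := left_bound (good_tr gc); exists B => // x gx.
have gtc := good_tr gc; have gtx := good_tr gx.
rewrite -kip_tr ?ktr_mul; do ?exact: good_mul.
rewrite -(kip_tr gx gx) mulr_sumr; apply: ler_sum => j _.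
rewrite -EI_scale; last exact: bm_column.
have gm : good (kmul (ktr c) (ktr x)) by exact: good_mul.
have [K [_ Kx]] := good_local gtx.
apply: EI_le; first exact: bm_column.
  by apply: bm_mul; [exact: bm_cst|exact: bm_column].
move=> y; have := BP y K (fun s => ktr x y s (j, 1%g)).
move=> H; under eq_sumJ do rewrite -expr2.
under [in leRHS]eq_sumJ do rewrite -expr2.
by apply: H => i h /Kx /=; rewrite invg1 mulg1.
Qed.

Lemma kernel_trace_le (e r : M) : good e -> good r ->
  ktr e = e -> kmul r r = r -> kmul e r = r -> kmul r e = r ->
  kip r e <= kip e e.
Proof.
move=> ge gr te rr er re.
apply: (@idempotent_trace_le R M good kmul ktr kip) => //.
- exact: good_add.
- exact: good_scale.
- exact: good_mul.
- exact: good_tr.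
- exact: kip_add.
- exact: kip_scale.
- by move=> x y _ _; exact: kipC.
- exact: kip_ge0.
- by move=> s x y gs _ _; exact: kmul_addr.
- by move=> c s x gs _; exact: kmul_scaler.
- by move=> x y z gx _ gz; exact: kmulA.
- by move=> x y _ _; exact: ktr_mul.
- exact: kip_mull.
- exact: kip_mulr.
- exact: kmul_bounded.
Qed.

End Kernels.

(** * Treeings *)

Section CrossingCount.
Context (R : realType) (G : groupType) (el : nat -> G).

(* Signed number of times the path [w] crosses the edge of index [i] whose
   source is at location [c] relative to the starting point. *)
Fixpoint crossings (w : seq (nat * bool)) (i : nat) (c : G) : R :=
  if w is l :: w' then
    (if (i == l.1) && (c == lsrc el l) then (if l.2 then 1 else -1) else 0) +
    crossings w' i (c * (lel el l)^-1)%g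
  else 0.

Fixpoint sources (w : seq (nat * bool)) : seq G :=
  if w is l :: w' then lsrc el l :: [seq (c * lel el l)%g | c <- sources w'] else [::].

Lemma crossings_sources w i c : crossings w i c != 0 -> c \in sources w.
Proof.
elim: w c => [|l w IHw] c /=; first by rewrite eqxx.
rewrite inE; have [->|cl] := eqVneq c (lsrc el l); first by [].
rewrite andbF add0r => /IHw H; apply/orP; right; apply/mapP.
by exists (c * (lel el l)^-1)%g => //; rewrite mulgVK.
Qed.

Lemma crossings_bound w i c : `|crossings w i c| <= (size w)%:R.
Proof.
elim: w c => [|l w IHw] c /=; first by rewrite normr0.
apply: (le_trans (ler_normD _ _)); rewrite -natr1 [leRHS]addrC; apply: lerD => //.
by case: ifP => _; [case: (l.2); rewrite ?normrN normr1|rewrite normr0].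
Qed.

End CrossingCount.

Section PathKernels.
Context (R : realType) (G : groupType) (N : nat).
Context d (Y : measurableType d) (nu : probability Y R) (b : mp_action G nu).

Let J := ('I_N * G)%type.
Let M := (Y -> J -> J -> R^o).

Lemma sumJ_delta (F : J -> R) p : (forall s, F s != 0 -> s = p) -> sumJ F = F p.
Proof.
move=> Fp; rewrite (@sumJ_box _ _ _ [:: 1%g] p.2) //.
  rewrite sum_box (bigD1 p.1) //= !big_seq1 /= mul1g big1 ?addr0 => [|i ip].
    by case: p {Fp}.
  rewrite big_seq1 mul1g; apply/eqP; apply: contraT => /Fp ip'.
  by move: ip; rewrite -[in p.1]ip' eqxx.
by move=> i h /Fp <-; rewrite /= mulgV inE.
Qed.

Lemma sumJ_add (L : seq G) (F H : J -> R) :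
  (forall i h, F (i, h) != 0 -> h \in L) -> (forall i h, H (i, h) != 0 -> h \in L) ->
  sumJ (fun s => F s + H s) = sumJ F + sumJ H.
Proof.
move=> FL HL; rewrite /sumJ -big_split; apply: eq_bigr => i _ /=.
have uL := undup_uniq L.
rewrite (fsum_seq (F := fun g => F (i, g)) uL) => [|g /FL]; last by rewrite mem_undup.
rewrite (fsum_seq (F := fun g => H (i, g)) uL) => [|g /HL]; last by rewrite mem_undup.
rewrite -big_split; apply: fsum_seq => // g; rewrite mem_undup.
have [->|/FL //] := eqVneq (F (i, g)) 0.
by rewrite add0r => /HL.
Qed.

(** By equivariance an entry depends only on the base point of its column and on the position of its
    row relative to it. *)
Definition kern (al : 'I_N -> 'I_N -> G -> Y -> R) : M :=
  fun y p q => al p.1 q.1 (p.2 * q.2^-1)%g (b q.2 y).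

Lemma good_kern (al : 'I_N -> 'I_N -> G -> Y -> R) : (forall i j c, measurable_fun setT (al i j c)) ->
  (exists C : R, forall i j c y, `|al i j c y| <= C) ->
  (exists K : seq G, forall i j c y, al i j c y != 0 -> c \in K) -> good b (kern al).
Proof.
move=> mal [C alC] [K alK]; split.
- by move=> p q; exact: measurableT_comp (mal _ _ _) (act_measurable b _).
- by exists C => y p q; exact: alC.
- by move=> l y i h j g; rewrite /kern /= -act_mul invgM mulgA mulgK.
- by exists K => y p q /alK.
Qed.

(** The projection onto the edges of the family [D]; its trace is the cost of the family, by
    [kip_diag]. *)
Definition diag (D : 'I_N -> set Y) : M :=
  fun y p q => if `[< p = q /\ D p.1 (b p.2 y) >] then 1 else 0.

Lemma good_diag D : (forall i, measurable (D i)) -> good b (diag D).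
Proof.
move=> mD.
have -> : diag D = kern (fun i j c y => if `[< (i = j /\ c = 1%g) /\ D i y >] then 1 else 0).
  apply/funext => y; apply/funext => -[i h]; apply/funext => -[j g].
  rewrite /diag /kern /=; congr (if _ then _ else _); apply: asbool_equiv_eq.
  split=> [[[-> ->] Dy]|[[-> hg] Dy]]; first by rewrite mulgV.
  by move: hg => /divg1_eq ->.
apply: good_kern.
- move=> i j c; apply: measurable_fun_ifT; try exact: measurable_cst.
  apply: (measurable_asbool (A := [set y | (i = j /\ c = 1%g) /\ D i y])).
  by apply: measurable_conj => //; exact: measurable_prop.
- by exists 1 => i j c y; case: ifP; rewrite ?normr1 ?normr0.
- exists [:: 1%g] => i j c y; case: asboolP => [[[_ ->] _] _|_]; rewrite ?inE //.
  by rewrite eqxx.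
Qed.

Lemma ktr_diag D : ktr (diag D) = diag D.
Proof.
apply/funext => y; apply/funext => p; apply/funext => q; rewrite /ktr /diag.
by congr (if _ then _ else _); apply: asbool_equiv_eq; split=> -[-> ?].
Qed.

Lemma diag_kmul D f y p q :
  kmul (diag D) f y p q = if `[< D p.1 (b p.2 y) >] then f y p q else 0.
Proof.
rewrite /kmul (sumJ_delta (p := p)).
  rewrite /diag; case: asboolP => [[_ H]|H]; case: asboolP => H'; rewrite ?mul1r ?mul0r //.
  by case: H.
by move=> s; rewrite /diag; case: asboolP => [[-> //]|_]; rewrite mul0r eqxx.
Qed.

Lemma kmul_diag D f y p q :
  kmul f (diag D) y p q = if `[< D q.1 (b q.2 y) >] then f y p q else 0.
Proof.
rewrite -[kmul f _]/(ktr (ktr (kmul f (diag D)))) ktr_mul ktr_diag.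
exact: diag_kmul.
Qed.

Lemma kip_diag D : (forall i, measurable (D i)) ->
  kip nu (diag D) (diag D) = \sum_(i < N) pr nu (D i).
Proof.
move=> mD; apply: eq_bigr => j _; rewrite -EI_indic //; congr EI; apply/funext => y.
rewrite (sumJ_delta (p := (j, 1%g))).
  rewrite /diag act_one; case: asboolP => [[_ H]|H]; case: asboolP => H'; rewrite ?mul1r ?mul0r //.
  by case: H.
by move=> s; rewrite /diag; case: asboolP => [[-> //]|_]; rewrite mul0r eqxx.
Qed.

Section Word.
Context (el : nat -> G) (dom : nat -> set Y) (W : seq (seq (nat * bool))).

Definition path_word (f : G) (y : Y) : seq (nat * bool) :=
  head [::] [seq w <- W | `[< wprod el w = f /\ valid b el dom w y >]].

Lemma path_wordP f y : wreach el b dom W f y ->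
  wprod el (path_word f y) = f /\ valid b el dom (path_word f y) y.
Proof.
rewrite /path_word => -[w [wW wf vw]].
have : w \in [seq w <- W | `[< wprod el w = f /\ valid b el dom w y >]].
  by rewrite mem_filter wW andbT; apply/asboolP.
case E : [seq w <- W | _] => [//|v s] _ /=.
have : v \in v :: s by rewrite inE eqxx.
by rewrite -E mem_filter => /andP[/asboolP].
Qed.

Lemma path_word_mem f y : path_word f y = [::] \/ path_word f y \in W.
Proof.
rewrite /path_word; case E : [seq w <- W | _] => [|v s] /=; first by left.
have : v \in v :: s by rewrite inE eqxx.
by rewrite -E mem_filter => /andP[_]; right.
Qed.

Lemma measurable_path_word (F : seq (nat * bool) -> R) f :
  (forall i, measurable (dom i)) -> measurable_fun setT (fun y => F (path_word f y)).
Proof.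
move=> mdom; rewrite /path_word; elim: W => [|w V IHV] /=; first exact: measurable_cst.
rewrite (_ : (fun _ => _) = fun y => if `[< wprod el w = f /\ valid b el dom w y >]
    then F w else F (head [::] [seq w <- V | `[< wprod el w = f /\ valid b el dom w y >]])).
  apply: measurable_fun_ifT => //; apply: measurable_asbool.
  by apply: measurable_conj; [exact: measurable_prop|exact: measurable_valid].
by apply/funext => y; case: ifP.
Qed.

Context (el' : nat -> G) (D : nat -> set Y).

(** The column of an edge is the signed chain of edges crossed by the path that replaces it. *)
Definition path_kernel : M := kern (fun i k c y =>
  if `[< D k y >] then crossings R el (path_word (el' k) y) i c else 0).

Lemma good_path_kernel : (forall i, measurable (dom i)) -> (forall i, measurable (D i)) ->
  good b path_kernel.
Proof.
move=> mdom mD; apply: good_kern.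
- move=> i k c; apply: measurable_fun_ifT; first exact: measurable_asbool.
    exact: (measurable_path_word (fun w => crossings R el w i c)).
  exact: measurable_cst.
- exists (\sum_(w <- W) (size w)%:R) => i k c y; case: ifP => _; last first.
    by rewrite normr0; apply: sumr_ge0 => w _; exact: ler0n.
  have [->|wW] := path_word_mem (el' k) y.
    by rewrite /= normr0; apply: sumr_ge0 => w _; exact: ler0n.
  apply: (le_trans (crossings_bound _ _ _ _ _)); rewrite (big_rem _ wW) /= lerDl.
  by apply: sumr_ge0 => w _; exact: ler0n.
- exists (flatten [seq sources el w | w <- W]) => i k c y; case: ifP => [_|_]; last by rewrite eqxx.
  move=> /crossings_sources cw; have [w0|wW] := path_word_mem (el' k) y.
    by rewrite w0 in cw.
  by apply/flattenP; exists (sources el (path_word (el' k) y)) => //; exact: map_f.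
Qed.

Lemma path_kernelE y i h k g : path_kernel y (i, h) (k, g) =
  if `[< D k (b g y) >] then crossings R el (path_word (el' k) (b g y)) i (h * g^-1)%g else 0.
Proof. by []. Qed.

End Word.

(** A discrete fundamental theorem of calculus: along a path, the differences of [phi] over the
    edges crossed add up to the difference at its ends. *)
Lemma crossings_telescope (el : nat -> G) (dom : nat -> set Y) (phi : Y -> R)
    (psi : J -> R) w y g :
  (forall i, (N <= i)%N -> dom i = set0) ->
  (forall (i : 'I_N) h, dom i (b h y) ->
     psi (i, h) = phi (b (el i) (b h y)) - phi (b h y)) ->
  valid b el dom w (b g y) ->
  sumJ (fun s : J => psi s * crossings R el w s.1 (s.2 * g^-1)%g) =
  phi (b (wprod el w) (b g y)) - phi (b g y).
Proof.
move=> domN psiP; elim: w g => [|l w IHw] g /=.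
  move=> _; rewrite act_one subrr /sumJ big1 // => i _.
  by apply: fsum_eq0 => h; rewrite mulr0.
move=> [Dl vw].
have lN : (l.1 < N)%N by rewrite ltnNge; apply/negP => /domN E; rewrite E in Dl.
rewrite -act_mul in Dl; rewrite -act_mul in vw.
under eq_sumJ do rewrite mulrDr.
rewrite (sumJ_add (L := (lsrc el l * g)%g :: [seq (c * (lel el l * g))%g | c <- sources el w])).
- rewrite (_ : sumJ (fun s : J => psi s * crossings R el w s.1 _) =
      phi (b (wprod el w) (b (lel el l * g)%g y)) - phi (b (lel el l * g)%g y)); last first.
    rewrite -IHw //; congr sumJ; apply/funext => s.
    by rewrite invgM mulgA.
  rewrite (sumJ_delta (p := (Ordinal lN, (lsrc el l * g)%g))); last first.
    move=> [i h] /=; case: ifP; last by rewrite mulr0 eqxx.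
    move=> /andP[/eqP il /eqP hl] _; congr pair; first exact/val_inj.
    by rewrite -hl mulgVK.
  rewrite /= eqxx mulgK eqxx /= psiP //= !act_mul.
  move: Dl; rewrite /lsrc /lel; case: l.2 => _.
    by rewrite act_one mulr1; ring.
  by rewrite actKV mulrN1; ring.
- move=> i h; case: ifP; last by rewrite mulr0 eqxx.
  by move=> /andP[_ /eqP hl] _; rewrite inE -hl mulgVK eqxx.
- move=> i h; rewrite mulf_eq0 negb_or => /andP[_ /crossings_sources H].
  rewrite inE; apply/orP; right; apply/mapP; exists (h * g^-1 * (lel el l)^-1)%g => //.
  by rewrite mulgA mulgVK mulgVK.
Qed.

(** A potential that jumps across a single edge counts the net crossings of that edge; freeness
    recovers the location [c] from the source [z]. *)
Lemma crossings_potential (elT : nat -> G) (domT : nat -> set Y) (phi : Y -> R) k z w x c :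
  free_part b x ->
  (forall j y, domT j y -> phi (b (elT j) y) - phi y =
     if (j == k) && `[< y = z >] then 1 else 0) ->
  valid b elT domT w x -> b c x = z ->
  crossings R elT w k c = phi (b (wprod elT w) x) - phi x.
Proof.
move=> + phiP; elim: w x c => [|l w IHw] x c fx /=; first by rewrite act_one subrr.
move=> [Dl vw] cz; rewrite (IHw (b (lel elT l) x)) //; last 2 first.
- exact: free_part_act.
- by rewrite -act_mul mulgVK.
have -> : (if (k == l.1) && (c == lsrc elT l) then if l.2 then 1 else -1 else 0) =
    phi (b (lel elT l) x) - phi x :> R.
  have := phiP _ _ Dl; have -> : `[< b (lsrc elT l) x = z >] = (c == lsrc elT l).
    apply/asboolP/eqP => [|<- //]; rewrite -cz => /(free_part_inj fx) //.
  rewrite eq_sym; move: Dl vw; rewrite /lsrc /lel; case: l.2 => _ _.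
    by rewrite act_one => ->.
  by rewrite actKV; case: ifP => _; lra.
by rewrite act_mul; ring.
Qed.

End PathKernels.

Section TreeFamily.
Context (R : realType) (G : groupType) (N : nat).
Context d (Y : measurableType d) (nu : probability Y R) (b : mp_action G nu).
Context (elS elT : nat -> G) (domS domT D : nat -> set Y).
Context (WS WT : seq (seq (nat * bool))).
Hypotheses (mdomS : forall i, measurable (domS i)).
Hypotheses (mdomT : forall i, measurable (domT i)).
Hypotheses (mD : forall i, measurable (D i)).
Hypothesis domSN : forall i, (N <= i)%N -> domS i = set0.
Hypothesis domT_free : forall k, domT k `<=` free_part b.
Hypothesis D_domT : forall k, D k `<=` domT k.
Hypothesis S_reach : forall i y, domS i y -> wreach elT b domT WT (elS i) y.
Hypothesis T_reach : forall k y, D k y -> wreach elS b domS WS (elT k) y.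
Hypothesis potential : forall k z, domT k z -> exists phi : Y -> R,
  forall j y, domT j y ->
    phi (b (elT j) y) - phi y = if (j == k) && `[< y = z >] then 1 else 0.

Let J := ('I_N * G)%type.
Let M := (Y -> J -> J -> R^o).

Let eS : M := diag b (fun i : 'I_N => domS i).
Let eT : M := diag b (fun i : 'I_N => D i).
(** [A] writes the edges of [D] as chains of [S], and [P] writes the edges of [S] as chains of the
    whole treeing. Cutting the rows of [P] down to [D] leaves the product with [A] to be computed
    between edges of [D] only. *)
Let A : M := path_kernel b elS domS WS elT D.
Let P : M := path_kernel b elT domT WT elS domS.
Let B : M := kmul eT P.

Let gS : good b eS. Proof. exact: good_diag. Qed.
Let gT : good b eT. Proof. exact: good_diag. Qed.
Let gA : good b A. Proof. exact: good_path_kernel. Qed.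
Let gP : good b P. Proof. exact: good_path_kernel. Qed.
Let gB : good b B. Proof. exact: good_mul. Qed.

Let kext (f f' : M) : (forall y i h k g, f y (i, h) (k, g) = f' y (i, h) (k, g)) -> f = f'.
Proof.
by move=> E; apply/funext => y; apply/funext => -[i h]; apply/funext => -[k g]; exact: E.
Qed.

Let crossing_valid w y x i c : valid b elS domS w (b x y) ->
  crossings R elS w i c != 0 -> domS i (b (c * x)%g y).
Proof.
elim: w x c => [|l w IHw] x c /=; first by rewrite eqxx.
move=> [Dl vw]; case: ifP => [/andP[/eqP -> /eqP ->] _|_].
  by rewrite act_mul.
rewrite add0r -act_mul in vw * => /(IHw _ _ vw).
by rewrite mulgA mulgVK.
Qed.

Lemma eS_A : kmul eS A = A.
Proof.
apply: kext => y i h k g; rewrite diag_kmul /=; case: asboolP => // nS.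
apply/esym/eqP; apply: contraT; rewrite /A path_kernelE; case: asboolP; last by rewrite eqxx.
move=> /T_reach/path_wordP[_ vw] /(crossing_valid vw); rewrite mulgVK => /nS //.
Qed.

Lemma P_eS : kmul P eS = P.
Proof.
apply: kext => y i h k g; rewrite kmul_diag /=; case: asboolP => // nT.
by rewrite /P path_kernelE; case: asboolP.
Qed.

Lemma B_eS : kmul B eS = B.
Proof. by rewrite /B (kmulA _ gT gS) P_eS. Qed.

Lemma eT_B : kmul eT B = B.
Proof.
apply: kext => y i h k g; rewrite diag_kmul /=; case: asboolP => // nT.
by rewrite /B diag_kmul /=; case: asboolP.
Qed.

(** With [phi] the potential of the edge [(k', h')], the row of [P] at this edge is the difference
    of [phi] over the edges of [S]. Along the path replacing [(k, g)] it telescopes to the jump of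
    [phi] over [(k, g)], which is 1 if the two edges coincide and 0 otherwise. *)
Lemma B_A : kmul B A = eT.
Proof.
apply: kext => y k' h' k g.
rewrite /B (kmulA _ gT gA) diag_kmul /=.
have -> : eT y (k', h') (k, g) = if `[< D k' (b h' y) >] then
    (if `[< D k (b g y) >] then (if `[< (k', h') = (k, g) >] then 1 else 0) else 0) else 0.
  rewrite /eT /diag /=; case: asboolP => [[[-> ->] Dy]|nE].
    by case: asboolP => // _; case: asboolP.
  case: asboolP => // D1; case: asboolP => // D2; case: asboolP => // E.
  by case: nE.
case: asboolP => // Dk'; have fy : free_part b y.
  by rewrite -(actK b h' y); apply/free_part_act/(domT_free (k := k'))/D_domT.
case: asboolP => [Dk|nDk]; last first.
  rewrite /kmul /sumJ big1 // => i _; apply: fsum_eq0 => h.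
  by rewrite /A path_kernelE; case: asboolP => // _; rewrite mulr0.
have [phi phiP] := potential (D_domT Dk').
have [wk vk] := path_wordP (T_reach Dk).
rewrite /kmul (_ : (fun s => _) = fun s : J => P y (k', h') s *
    crossings R elS (path_word b elS domS WS (elT k) (b g y)) s.1 (s.2 * g^-1)%g); last first.
  by apply/funext => -[i h]; rewrite /A path_kernelE; case: asboolP.
rewrite (crossings_telescope (phi := phi) domSN _ vk).
  rewrite wk (phiP _ _ (D_domT Dk)); congr (if _ then _ else _).
  apply/andP/asboolP => [[/eqP kk /asboolP E]|[-> ->]]; last first.
    by split=> //; exact/asboolP.
  congr pair; first exact/val_inj.
  by apply/esym; apply: free_part_inj fy E.
move=> i h Si; rewrite /P path_kernelE; case: asboolP => // _.
have [wi vi] := path_wordP (S_reach Si).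
rewrite (crossings_potential _ phiP vi) ?wi //; first exact: free_part_act.
by rewrite -act_mul mulgVK.
Qed.

Lemma tree_family_le :
  \sum_(k < N) pr nu (D k) <= \sum_(i < N) pr nu (domS i).
Proof.
rewrite -(kip_diag b (D := fun i : 'I_N => D i)) //.
rewrite -(kip_diag b (D := fun i : 'I_N => domS i)) // -/eT -/eS.
have teS : ktr eS = eS := ktr_diag _ _.
have teT : ktr eT = eT := ktr_diag _ _.
have BT : kmul (ktr B) eT = ktr B.
  by have := ktr_mul eT B; rewrite eT_B teT => <-.
have BS : kmul eS (ktr B) = ktr B.
  by have := ktr_mul B eS; rewrite B_eS teS => <-.
(* Cyclicity of the trace: both sides reduce to [kip nu A (ktr B)]. *)
have -> : kip nu eT eT = kip nu (kmul A B) eS.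
  rewrite -{1}B_A (kip_mull gB gA gT) (kip_mulr gB gA gS).
  by rewrite BT BS.
apply: (kernel_trace_le gS (good_mul gA gB)) => //.
- rewrite (kmulA _ gA (good_mul gA gB)) -(kmulA _ gB gB) B_A eT_B //.
- by rewrite -(kmulA _ gS gB) eS_A.
- by rewrite (kmulA _ gA gS) B_eS.
Qed.

End TreeFamily.

(** * Potentials on acyclic graphs *)

Section AcyclicGraphs.
Context d (Y : measurableType d) (T : Y -> Y -> Prop).
Hypotheses (symT : forall x y, T x y -> T y x) (acyclicT : acyclic_graph T).

Definition remove_edge u v x y := [/\ T x y, ~ (x = u /\ y = v) & ~ (x = v /\ y = u)].

Lemma clos_path (E : Y -> Y -> Prop) x y : (forall z w, E z w -> E w z) ->
  clos_refl_sym_trans Y E x y ->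
  exists p, path (fun z w => `[< E z w >]) x p /\ last x p = y.
Proof.
move=> symE; elim=> {x y} [x y xy|x|x y _ [p [xp <-]]|x y z _ [p [xp <-]] _ [q [yq <-]]].
- by exists [:: y]; rewrite /= andbT; split=> //; apply/asboolP.
- by exists [::].
- exists (rev (belast x p)); split; last first.
    by case: p {xp} => //= z p; rewrite rev_cons last_rcons.
  rewrite rev_path; apply: sub_path xp => z w /asboolP /symE ?.
  exact/asboolP.
- by exists (p ++ q); rewrite cat_path xp last_cat.
Qed.

Lemma remove_edge_disconnects u v : T u v -> u <> v ->
  ~ clos_refl_sym_trans Y (remove_edge u v) v u.
Proof.
move=> uv neq /clos_path[|p [vp lastp]].
  move=> z w [zw nzw nwz]; split; [exact: symT| |].
    by move=> [wu zv]; apply: nwz.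
  by move=> [wv zu]; apply: nzw.
case/shortenP: vp lastp => q vq uq _ lastq.
(* Length 0 would give [u = v], and length 1 the removed edge; so closing the simple path by the
   edge gives a cycle with at least three vertices. *)
have sq : (1 < size q)%N.
  case: q vq {uq} lastq => [_ /= vu|w [|//] /=]; first by case: neq.
  by rewrite andbT => /asboolP[_ _ nvu] wu; case: nvu.
pose n := (size q).-2; have sn : size q = n.+2 by rewrite /n; case: (size q) sq => [|[]].
apply: (@acyclicT n (fun i => nth v (v :: q) i)).
  move=> i j /eqP; rewrite nth_uniq /= ?sn ?ltn_ord // => /eqP ij.
  exact/val_inj.
move=> i; rewrite /ordS /=.
have [ilt|ige] := ltnP i n.+2.
  rewrite modn_small ?ltnS // /=.
  have /(pathP v)/(_ i) := vq; rewrite sn => /(_ ilt) /asboolP[H _ _].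
  by case: (i : nat) H => [|m].
have -> : (i : nat) = n.+2 by apply/eqP; rewrite eqn_leq ige -ltnS ltn_ord.
rewrite modnn /=; have -> : nth v q n.+1 = u.
  by rewrite -lastq (last_nth v) sn.
exact: uv.
Qed.

(** The indicator of the side of [v] once the edge is removed. *)
Lemma remove_edge_potential (R : realType) u v : T u v -> u <> v ->
  exists phi : Y -> R, [/\ phi v - phi u = 1 &
    forall x y, T x y -> ~ (x = u /\ y = v) -> ~ (x = v /\ y = u) -> phi y - phi x = 0].
Proof.
move=> uv neq; pose C := clos_refl_sym_trans Y (remove_edge u v).
exists (fun z => if `[< C v z >] then 1 else 0); split.
  case: asboolP => [_|nvv]; last by case: nvv; exact: rst_refl.
  by case: asboolP => [/remove_edge_disconnects|]; [case|rewrite subr0].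
move=> x y xy n1 n2; have Cxy : C x y by apply: rst_step; split.
suff -> : `[< C v x >] = `[< C v y >] by rewrite subrr.
apply: asbool_equiv_eq; split=> H.
  exact: (@rst_trans _ _ _ x).
by apply: (@rst_trans _ _ _ y) => //; exact: rst_sym.
Qed.

End AcyclicGraphs.

Section TreeableFamily.
Context (R : realType) (G : groupType).
Context d (Y : measurableType d) (nu : probability Y R) (b : mp_action G nu).
Context (V : nat -> set Y) (sepV : separating V).
Context (e : nat -> G) (eS : forall g, exists n, e n = g).
Hypothesis free : free_action b.
Context (T : Y -> Y -> Prop) (borelT : borel_graph T) (acyclicT : acyclic_graph T).
Hypothesis genT : forall x y, clos_refl_sym_trans Y T x y <-> orbit_rel b x y.

(* The lexicographic order of the sequences [k |-> V k y]; it orients the edges. *)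
Definition precedes x y := exists k, [/\ V k y, ~ V k x &
  forall j, (j < k)%N -> (V j x <-> V j y)].

Lemma precedes_total x y : x <> y -> precedes x y \/ precedes y x.
Proof.
move=> xy; have : exists k, ~ (V k x <-> V k y).
  by apply: contrapT => H; apply: xy; apply: sepV.2 => k; apply: contrapT => nk; apply: H; exists k.
move=> /first_exists[k [Vk minV]].
have eqV j : (j < k)%N -> (V j x <-> V j y) by move=> /minV/contrapT.
have [Vx|nVx] := pselect (V k x); have [Vy|nVy] := pselect (V k y).
- by case: Vk.
- by right; exists k; split=> // j /eqV; move=> H; split=> /H.
- by left; exists k.
- by case: Vk.
Qed.

Lemma precedes_asym x y : precedes x y -> ~ precedes y x.
Proof.
move=> [j [Vjy nVjx eqj]] [k [Vkx nVky eqk]].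
case: (ltngtP j k) => [jk|kj|jk].
- by apply: nVjx; apply/(eqk _ jk).
- by apply: nVky; apply/(eqj _ kj).
- by apply: nVky; rewrite -jk.
Qed.

(** On the free part each unordered edge of [T] occurs exactly once: [precedes] fixes its
    orientation, and [canonical] the index of the group element that carries it. *)
Definition tree_dom k := [set y | (canonical e k /\ free_part b y) /\
  (T y (b (e k) y) /\ precedes y (b (e k) y))].

Lemma measurable_tree_dom k : measurable (tree_dom k).
Proof.
have mb := act_measurable b (e k).
apply: measurable_conj.
  by apply: measurable_conj; [exact: measurable_prop|exact: (measurable_free_part b sepV eS)].
apply: measurable_conj.
  have [_ _ mT] := borelT.
  have := measurable_fun_pair (@measurable_id _ Y setT) mb measurableT mT.
  by rewrite setTI.
rewrite /precedes [X in measurable X](_ : _ = [set y | exists j, V j (b (e k) y) /\ (~ V j y /\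
    forall i, (i < j)%N -> (V i y <-> V i (b (e k) y)))]).
  apply: measurable_exists => j; apply: measurable_conj; first exact: (measurable_act b _ (sepV.1 _)).
  apply: measurable_conj; first exact: measurable_not (sepV.1 _).
  apply: measurable_forall => i; apply: measurable_imply; first exact: measurable_prop.
  by apply: measurable_iff; [exact: sepV.1|exact: (measurable_act b _ (sepV.1 _))].
by apply/seteqP; split=> y [j] => [[? ? ?]|[? [? ?]]]; exists j.
Qed.

Lemma orbit_free x y : orbit_rel b x y -> free_part b x -> free_part b y.
Proof. by move=> [g <-]; exact: free_part_act. Qed.

Lemma tree_frel x y : clos_refl_sym_trans Y T x y -> free_part b x ->
  frel b e tree_dom x y.
Proof.
have [irrT symT _] := borelT.
elim=> {x y} [x y xy fx|x _|x y xy IH fy|x y z xy IH1 _ IH2 fx].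
- have oxy : orbit_rel b x y by apply/genT; exact: rst_step.
  have fy := orbit_free oxy fx; have [g gx] := oxy.
  have xNy : x <> y by move=> E; apply: (irrT x); rewrite [X in T _ X]E.
  have [xy'|yx'] := precedes_total xNy.
    have [k ck ek] := canonical_exists eS g; apply: rst_step; exists k.
    by rewrite /tree_dom /= ek gx; split; split.
  have [k ck ek] := canonical_exists eS (g^-1)%g; apply/rst_sym/rst_step; exists k.
  have xE : b (g^-1)%g y = x by rewrite -gx actK.
  by rewrite /tree_dom /= ek xE; split=> //; split; split=> //; exact: symT.
- exact: rst_refl.
- apply/rst_sym/IH; apply: orbit_free fy; apply/genT; exact: rst_sym.
- apply: (@rst_trans _ _ _ y); first exact: IH1.
  by apply: IH2; apply: orbit_free fx; exact/genT.
Qed.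

Lemma tree_generating : generating b e tree_dom.
Proof.
move=> g; apply: (@pr_null_le _ _ _ _ _ (~` free_part b)).
- apply: measurable_not; apply: (measurable_frel1 b sepV) => k.
  exact: measurable_tree_dom.
- by apply: measurableC; exact: (measurable_free_part b sepV eS).
- exact: (pr_free_part sepV eS free).
- move=> y nf fy; apply: nf; apply: tree_frel => //.
  by apply/genT; exists g.
Qed.

Lemma tree_potential k z : tree_dom k z -> exists phi : Y -> R,
  forall j y, tree_dom j y ->
    phi (b (e j) y) - phi y = if (j == k) && `[< y = z >] then 1 else 0.
Proof.
have [irrT symT _] := borelT.
move=> [[ck fz] [Tz pz]].
have zN : z <> b (e k) z by move=> E; apply: (irrT z); rewrite [X in T _ X]E.
have [phi [phi1 phi0]] := remove_edge_potential symT acyclicT R Tz zN.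
exists phi => j y [[cj fy] [Ty py]]; case: andP => [[/eqP -> /asboolP ->] //|jk].
(* The edge could only be that of [z] again, excluded by freeness and canonical indices, or its
   reversal, excluded by the orientation. *)
apply: phi0 => // -[yE eE].
  apply: jk; split; last exact/asboolP.
  by apply/eqP/(canonical_inj cj ck); apply: (free_part_inj fz); rewrite -{1}yE.
by apply: (precedes_asym pz); rewrite -yE -eE.
Qed.

End TreeableFamily.

(** * Finiteness of the cost of a treeable action *)

Section TreeableCost.
Context (R : realType) (G : groupType).
Context d (X : measurableType d) (mu : probability X R) (a : mp_action G mu).
Context d' (Y : measurableType d') (nu : probability Y R) (b : mp_action G nu).
Context (U : nat -> set X) (sepU : separating U).
Context (V : nat -> set Y) (sepV : separating V).
Context (e : nat -> G) (eS : forall g, exists n, e n = g).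
Hypotheses (free : free_action a) (wc : weakly_contained a b).

(** The bound on the first [n] pieces of the treeing does not depend on [n], so the whole treeing
    has finite cost. *)
Lemma treeable_cost_finite : treeable (orbit_rel b) ->
  (action_cost a < +oo)%E -> (action_cost b < +oo)%E.
Proof.
move=> [T [borelT acyclicT genT]] afin.
have freeb := weakly_contained_free sepU sepV free wc.
have [r ar] : exists r : R, (action_cost a < r%:E)%E.
  case: (action_cost a) afin => [r| |] // _; last by exists 0; rewrite ltNyr.
  by exists (r + 1); rewrite lte_fin ltrDl.
have [ela [doma [mda gena costa]]] := family_of_cost sepU eS ar.
pose TD := tree_dom b V e T.
have mTD k : measurable (TD k) by exact: (measurable_tree_dom b sepV eS borelT).
have genTD : generating b e TD by exact: (tree_generating sepV eS freeb borelT genT).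
have key n (t : R) : 0 < t -> \sum_(k < n) pr nu (TD k) <= r + t.
  move=> t0; pose eps := t / (2 * n%:R + 1).
  have n0 : 0 <= n%:R :> R by exact: ler0n.
  have eps0 : 0 < eps by rewrite divr_gt0 //; lra.
  have epsE : (2 * n%:R + 1) * eps = t by rewrite mulrC divfK //; apply/eqP; lra.
  have [dom' [n1 [WS [mdom' domN cost' WP]]]] :=
    transfer sepU free wc mda gena [seq e i | i <- iota 0 n] costa eps0.
  (* The kernels are square, so both families are indexed by the same ['I_N]. *)
  pose N := maxn n n1.
  (* All edge visits, with their positions, of the words in [WS]. A tree edge can be lost when one
     of these visits uses an edge of the transferred family without a tree path in the finite list
     [WT]. *)
  pose L := flatten [seq wcons ela w 1%g | w <- WS].
  pose c : R := (size L)%:R; have c0 : 0 <= c by exact: ler0n.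
  pose del := eps / (c + 1).
  have del0 : 0 < del by rewrite divr_gt0 //; lra.
  have delE : (c + 1) * del = eps by rewrite mulrC divfK //; apply/eqP; lra.
  have [m mP] := wreach_limit_seq sepV freeb mTD genTD [seq ela i | i <- iota 0 n1] del0.
  pose WT := wlist m.
  have mWT f : measurable [set y | wreach e b TD WT f y] by exact: measurable_wreach.
  (* Edges without a listed tree path are discarded, and [D] below then keeps the tree edges that
     the reduced family still connects. In this way the reachability hypotheses of [tree_family_le]
     hold at every point, not just up to a small set. *)
  pose domS i := [set y | dom' i y /\ wreach e b TD WT (ela i) y].
  have mdomS i : measurable (domS i) by apply: measurable_conj => //; exact: mWT.
  have mWS D f : (forall i, measurable (D i)) -> measurable [set y | wreach ela b D WS f y].
    by move=> mD0; exact: measurable_wreach.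
  pose D k := [set y | TD k y /\ wreach ela b domS WS (e k) y].
  have mD k : measurable (D k) by apply: measurable_conj => //; exact: mWS.
  have DS : \sum_(k < N) pr nu (D k) <= \sum_(i < N) pr nu (domS i).
    apply: (@tree_family_le _ _ N _ _ _ b ela e domS TD D WS WT) => //.
    - move=> i Ni; apply/seteqP; split=> // y []; rewrite domN //.
      by rewrite (leq_trans _ Ni) // leq_maxr.
    - by move=> k y [[]].
    - by move=> k y [].
    - by move=> i y [].
    - by move=> k y [].
    - by move=> k z; exact: (tree_potential borelT acyclicT).
  have SR : \sum_(i < N) pr nu (domS i) <= r.
    rewrite -lee_fin; apply: le_trans (ltW cost'); apply: le_trans (le_sum_esum N _); last first.
      by move=> i; exact: measure_ge0.
    rewrite -sumEFin; apply: lee_sum => i _; rewrite -prE //.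
    by apply: le_measure; rewrite ?inE // => y [].
  pose Bad := [set y | exists i : 'I_(size L), let p := nth (1%g, 0%N) L i in
    dom' p.2 (b p.1 y) /\ ~ wreach e b TD WT (ela p.2) (b p.1 y)].
  pose E i := [set y | dom' i y /\ ~ wreach e b TD WT (ela i) y].
  have mE i : measurable (E i) by apply: measurable_conj => //; exact: measurable_not (mWT _).
  have prE_le i : pr nu (E i) <= del.
    have [i1|i1] := ltnP i n1; last first.
      rewrite (_ : E i = set0) ?pr0 ?ltW //; apply/seteqP; split=> // y [].
      by rewrite domN.
    have iF : ela i \in [seq ela i | i <- iota 0 n1] by rewrite map_f // mem_iota.
    apply: le_trans (ltW (mP _ iF)); apply: pr_le => //; first exact: measurableC (mWT _).
    by move=> y [].
  have mBad : measurable Bad.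
    by apply: measurable_exists => i; exact: (measurable_act b _ (mE _)).
  have prBad : pr nu Bad <= eps.
    apply: (@le_trans _ _ (c * del)); last by rewrite -delE; lra.
    apply: (le_trans (@pr_coverF _ _ _ nu _ xpredT (fun i : 'I_(size L) =>
      let p := nth (1%g, 0%N) L i in [set y | E p.2 (b p.1 y)]) _ mBad _ _)).
    - by move=> i; exact: (measurable_act b _ (mE _)).
    - by move=> y [i H]; exists i.
    - rewrite /c -[X in X%:R * _]card_ord; apply: sum_le_card; first exact: ltW.
      by move=> i _; rewrite /= (pr_act b _ (mE _)).
  (* One [eps] for the transfer, one for [Bad]. *)
  have TDle (k : 'I_n) : pr nu (TD k) - pr nu (D k) <= 2 * eps.
    have kF : e k \in [seq e i | i <- iota 0 n] by rewrite map_f // mem_iota /= ltn_ord.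
    have mnW : measurable [set y | ~ wreach ela b dom' WS (e k) y].
      by apply: measurable_not; exact: mWS.
    have cov : TD k `<=` D k `|` ([set y | ~ wreach ela b dom' WS (e k) y] `|` Bad).
      move=> y Ty; have [[w [wW wk vw]]|nW] := pselect (wreach ela b dom' WS (e k) y); last first.
        by right; left.
      have [By|nB] := pselect (Bad y); first by right; right.
      left; split=> //; exists w; split=> //.
      rewrite -(act_one b y); apply/(valid_wcons b) => p pw.
      have pL : p \in L by apply/flattenP; exists (wcons ela w 1%g) => //; exact: map_f.
      have Dp : dom' p.2 (b p.1 y).
        by move: vw; rewrite -{1}(act_one b y) => /(valid_wcons b)/(_ p pw).
      split=> //; apply: contrapT => nT; apply: nB.
      have ps : (index p L < size L)%N by rewrite index_mem.
      by exists (Ordinal ps); rewrite /= nth_index.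
    have := pr_le nu (mTD k) (measurableU _ _ (mD k) (measurableU _ _ mnW mBad)) cov.
    have := prU_le nu (mD k) (measurableU _ _ mnW mBad).
    have := prU_le nu mnW mBad; have := WP _ kF; lra.
  have c1 : \sum_(k < n) pr nu (TD k) - \sum_(k < n) pr nu (D k) <= n%:R * (2 * eps).
    rewrite -sumrB -[n in n%:R]card_ord; apply: sum_le_card; last by move=> k _; exact: TDle.
    by rewrite mulr_ge0 // ltW.
  have c2 : \sum_(k < n) pr nu (D k) <= \sum_(k < N) pr nu (D k).
    rewrite -!(big_mkord xpredT (fun k => pr nu (D k))) (big_cat_nat _ (leq_maxl n n1)) //=.
    by rewrite lerDl; apply: sumr_ge0 => k _; exact: pr_ge0.
  move: epsE; lra.
apply: (le_lt_trans (action_cost_le sepV eS mTD genTD)).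
apply: (@le_lt_trans _ _ (r + 1)%:E); last exact: ltry.
rewrite -nneseries_esumT //; apply: lime_le; first exact: is_cvg_nneseries.
apply: nearW => n; rewrite big_mkord.
under eq_bigr do rewrite prE //.
by rewrite sumEFin lee_fin; exact: key.
Qed.

End TreeableCost.

Theorem theorem1p6 (R : realType) (G : groupType)
    (G_countable : countable [set: G]) (G_infinite : infinite_set [set: G])
    (d d' : measure_display) (X : measurableType d) (Y : measurableType d')
    (X_standard : standard_borel R X) (Y_standard : standard_borel R Y)
    (mu : probability X R) (nu : probability Y R)
    (a : mp_action G mu) (b : mp_action G nu)
    (a_free : free_action a) (a_wc_b : weakly_contained a b) :
  [/\ (action_cost b < +oo)%E -> (action_cost b <= action_cost a)%E,
      treeable (orbit_rel b) -> (action_cost b <= action_cost a)%E &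
      action_cost a = 1%E -> action_cost b = 1%E].
Proof.
have [U sepU] := standard_borel_separating X_standard.
have [V sepV] := standard_borel_separating Y_standard.
have [e eS] : exists e : nat -> G, forall g, exists n, e n = g.
  have /countable_injP[c cinj] := G_countable.
  have inv n : exists g, forall h, c h = n -> h = g.
    have [[h <-]|nh] := pselect (exists h, c h = n).
      by exists h => k; apply: cinj; rewrite inE.
    by exists 1%g => k ck; case: nh; exists k.
  have [e eP] := choice inv.
  by exists e => g; exists (c g); rewrite -(eP _ g).
have part1 : (action_cost b < +oo)%E -> (action_cost b <= action_cost a)%E.
  move=> bfin; apply: action_cost_real => r eta ar eta0.
  exact: (finite_cost_le sepU sepV eS a_free a_wc_b).
split=> // [tr|a1].
  have [afin|ainf] := ltP (action_cost a) +oo%E; last by apply: le_trans ainf; exact: leey.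
  exact/part1/(treeable_cost_finite sepU sepV eS a_free a_wc_b).
apply/le_anti/andP; split; last first.
  exact: (action_cost_ge1 sepV eS (weakly_contained_free sepU sepV a_free a_wc_b)).
apply/lee_addgt0Pr => eta eta0; rewrite -EFinD.
exact: (cost_one_upper sepU sepV eS a_free a_wc_b).
Qed.
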